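(* Let $\lambda$ be a constant and let $T(\beta)=T(\beta;\lambda)$ be a function with the following properties. 1DSt1: $(\beta+\pi/2)^{-1/2}(\beta-5\pi/2)^{-1/2}T(\beta)$ is analytic in the strip $-\pi\le\mathrm{Re}[\beta]\le3\pi$. 1DSt2: $T(\beta)+T(\beta+4\pi)-\lambda T(\beta+2\pi)=0$ (with the branch convention stated in the context). 1DSt3: $|T(\beta)|<C\exp\{\kappa|\mathrm{Im}[\beta]|\}$ for some real constants $C$ and $\kappa$. 1DSt4: $T(\beta)=T(2\pi-\beta)$. Then $T$ is a solution of an ordinary differential equation of the form $$\left[\frac{d^2}{d\beta^2}+f(\beta)\frac{d}{d\beta}+g(\beta)\right]T(\beta)=0,$$ where $f(\beta)$ and $g(\beta)$ are rational functions (i.e. ratios of polynomials) of $\mathfrak r=e^{i\beta}$. The coefficients satisfy $f(-\beta)=-f(\beta)$ and $g(-\beta)=g(\beta)$, and are bounded as $|\mathrm{Im}[\beta]|\to\infty$.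
   Context: By 1DSt1, $T$ has square-root branch points at $\beta=-\pi/2$ and $\beta=5\pi/2$ in the strip; it is otherwise analytic there. The functional equation 1DSt2 links values of this branching function as follows: the reference triplet is $(-\pi,\pi,3\pi)$, where, starting from $\pi$, the point $-\pi$ is reached along a path passing above the branch point $-\pi/2$, and the point $3\pi$ is reached along a path passing below the branch point $5\pi/2$. Other triplets $(\beta,\beta+2\pi,\beta+4\pi)$ are obtained from the reference triplet by continuity: first along the line $\mathrm{Re}[\beta]=-\pi$, and then the equation is continued analytically. *)

(* Defs.v *)
From Stdlib Require Import Reals List.
From Coquelicot Require Import Coquelicot.

Open Scope C_scope.

Definition analytic_at (f : C -> C) (z : C) : Prop :=
  exists (a : nat -> C) (r : R), (0 < r)%R /\
    forall w : C, (Cmod (w - z) < r)%R ->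
      @is_pseries C_AbsRing C_NormedModule a (w - z) (f w).

(* For a closed [D] this is analyticity in a neighbourhood of [D]. *)
Definition analytic_on (D : C -> Prop) (f : C -> C) : Prop :=
  forall z : C, D z -> analytic_at f z.

Definition strip (b : C) : Prop := (- PI <= Re b <= 3 * PI)%R.

(* The two branch points are joined to infinity by vertical half-lines,
   downwards from -pi/2 and upwards from 5pi/2.  A path from pi to -pi that
   avoids them passes above -pi/2, and one from pi to 3pi passes below 5pi/2;
   the lines Re b = -pi, pi, 3pi do not meet them.  So the values on
   [slit_strip] of the branching function T are those of its branch
   continued from pi in the prescribed way. *)
Definition slit_strip (b : C) : Prop :=
  strip b /\
  ~ (Re b = (- PI / 2)%R /\ (Im b <= 0)%R) /\
  ~ (Re b = (5 * PI / 2)%R /\ (0 <= Im b)%R).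

(* [s] is an analytic branch of (b - a)^(1/2) on [slit_strip]; for
   a = -pi/2 and a = 5pi/2 there are two, which differ by the sign. *)
Definition sqrt_branch (a : R) (s : C -> C) : Prop :=
  analytic_on slit_strip s /\
  forall b : C, slit_strip b -> s b * s b = b - a.

(* [h] is analytic on the whole strip, branch points and slits included. *)
Definition sqrt_ramified (T : C -> C) : Prop :=
  exists s1 s2 h : C -> C,
    sqrt_branch (- PI / 2) s1 /\ sqrt_branch (5 * PI / 2) s2 /\
    analytic_on strip h /\
    forall b : C, slit_strip b -> / s1 b * / s2 b * T b = h b.

(* The line Re b = -pi is the set of b for which the triplet
   (b, b + 2pi, b + 4pi) lies in the strip.  Elsewhere the equation holds by
   analytic continuation (and continues T beyond the strip). *)
Definition shift_equation (lam : C) (T : C -> C) : Prop :=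
  forall b : C, Re b = (- PI)%R ->
    T b + T (b + RtoC (4 * PI)) - lam * T (b + RtoC (2 * PI)) = 0.

Definition exp_growth (T : C -> C) : Prop :=
  exists K kappa : R, forall b : C, slit_strip b ->
    (Cmod (T b) < K * exp (kappa * Rabs (Im b)))%R.

Definition reflection_symmetric (T : C -> C) : Prop :=
  forall b : C, slit_strip b -> T b = T (RtoC (2 * PI) - b).

(* [F t] is the germ at [gamma t] obtained by continuing analytically, along
   the path [gamma] from pi, the germ of T at pi. *)
Definition continuation (T : C -> C) (gamma : R -> C) (F : R -> C -> C) : Prop :=
  gamma 0%R = RtoC PI /\
  (forall t : R, (0 <= t <= 1)%R -> continuous gamma t) /\
  locally (RtoC PI) (fun z => F 0%R z = T z) /\
  (forall t : R, (0 <= t <= 1)%R -> analytic_at (F t) (gamma t)) /\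
  (forall t : R, (0 <= t <= 1)%R -> exists eps : R, (0 < eps)%R /\
     forall s : R, (0 <= s <= 1)%R -> (Rabs (s - t) < eps)%R ->
       locally (gamma s) (fun z => F s z = F t z)).

Definition cexp (z : C) : C := RtoC (exp (Re z)) * (cos (Im z), sin (Im z)).

(* Polynomials are lists of coefficients, constant term first. *)
Definition peval (p : list C) (z : C) : C :=
  fold_right (fun c v => c + z * v) (RtoC 0) p.

Record ratfun : Type := Ratfun {
  num : list C;
  den : list C;
  den_neq0 : exists c : C, In c den /\ c <> 0
}.

(* A rational function [q] of e^(ib), used only where the denominator does not
   vanish. *)
Definition regular_at (q : ratfun) (b : C) : Prop := peval (den q) (cexp (Ci * b)) <> 0.
Definition value_at (q : ratfun) (b : C) : C :=
  peval (num q) (cexp (Ci * b)) / peval (den q) (cexp (Ci * b)).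

Definition rat_odd (q : ratfun) : Prop :=
  forall b : C, regular_at q b -> regular_at q (- b) -> value_at q (- b) = - value_at q b.

Definition rat_even (q : ratfun) : Prop :=
  forall b : C, regular_at q b -> regular_at q (- b) -> value_at q (- b) = value_at q b.

Definition bounded_at_ends (q : ratfun) : Prop :=
  exists M Y : R, forall b : C, (Y <= Rabs (Im b))%R ->
    regular_at q b /\ (Cmod (value_at q b) <= M)%R.

(* Every branch of T, in the strip and beyond it, satisfies
   T'' + f T' + g T = 0 wherever f and g are finite.  The germs are analytic,
   so the total operator [C_derive] is the derivative. *)
Definition solves_ode (f g : ratfun) (T : C -> C) : Prop :=
  forall (gamma : R -> C) (F : R -> C -> C), continuation T gamma F ->
  forall t : R, (0 <= t <= 1)%R ->
    let b := gamma t in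
    regular_at f b -> regular_at g b ->
    C_derive (C_derive (F t)) b + value_at f b * C_derive (F t) b
      + value_at g b * F t b = 0.

(* Main.v *)
Require Import Defs.
From Stdlib Require Import Reals List Lra Lia ClassicalEpsilon FunctionalExtensionality ZArith.
From Coquelicot Require Import Coquelicot.

Open Scope C_scope.

(** Put [S b = T (b + 2 pi)].  On the strip [- pi <= Re b <= pi] the pair [(T, S)]
    behaves like a basis of solutions of a linear equation of order two: going
    around [- pi / 2] changes the sign of [T] only, going around [pi / 2] changes
    the sign of [S] only, and by the functional equation the shift by [2 pi]
    replaces [(T, S)] by [(S, lam S - T)].  All these changes are linear with
    constant coefficients, so with the Wronskians [W = T S' - T' S] and
    [V = T' S'' - T'' S'] the coefficients of the equation solved by both,
    [f = - W' / W] and [g = V / W], are single-valued and [2 pi]-periodic.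

    The products [N = 4 W ^ 2 cos] and [G = 16 W V cos ^ 2] carry no sign, and the
    cosines cancel the poles at the branch points.  They extend to entire periodic
    functions ([periodic_gluing]) of exponential growth; the derivatives are bounded
    by Cauchy's estimate, next to the edge of the strip after an extension by the
    functional equation ([growth_inner], [growth_left]).  An entire periodic
    function of exponential growth is a Laurent polynomial in [e ^ (i b)]
    ([periodic_polynomial]): dividing [H - H 0] by [e ^ (i b) - 1] lowers the order
    of growth, and a function that vanishes at both ends of the cylinder is zero by
    the maximum principle.  So [f = - (N' / N + tan) / 2] and [g = G / (4 cos N)] are
    rational in [e ^ (i b)].  If [W] vanished identically then so would [T], because
    the leading coefficient of the Wronskian at the branch point has an odd, hence
    nonzero, factor ([wron_core_zero]).

    The reflection exchanges [T] and [S], which makes [W] and [V] even, hence [f] odd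
    and [g] even ([even_near]); so boundedness is only needed at the upper end.
    There [f] is a logarithmic derivative.  If [g] had a pole at [e ^ (i b) = 0],
    then on a suitable vertical ray [Re g] would tend to infinity and
    some combination [u] of [T] and [S] would satisfy
    [(|u| ^ 2)'' >= K ^ 2 |u| ^ 2] for every [K], against the exponential bound
    ([no_blowup]).

    The equation holds near [pi], and with cleared denominators it is an identity
    between analytic germs, which propagates along every path
    ([solves_ode_from_pi]).

    The function theory behind this uses power series only: one interchange of
    sums ([sums_rows_antidiagonals]) gives products and expansions about another
    centre, the order of a zero gives the identity theorem, and the leading
    term of a power series gives the maximum principle, from which Cauchy's estimate
    follows for difference quotients. *)

(** * Complex series dominated by a geometric series *)

Fixpoint csum (f : nat -> C) (n : nat) : C :=
  match n with
  | O => 0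
  | S m => csum f m + f m
  end.

Definition sums (f : nat -> C) (l : C) : Prop :=
  forall eps : R, (0 < eps)%R ->
    exists N : nat, forall n : nat, (N <= n)%nat -> (Cmod (csum f n - l) < eps)%R.

Lemma csum_ext (f g : nat -> C) (n : nat) :
  (forall k, (k < n)%nat -> f k = g k) -> csum f n = csum g n.
Proof.
  induction n as [|n IH]; intros H; [reflexivity|].
  simpl; rewrite IH, (H n); auto.
Qed.

Lemma csum_add (f g : nat -> C) (n : nat) :
  csum (fun k => f k + g k) n = csum f n + csum g n.
Proof. induction n as [|n IH]; simpl; [ring|rewrite IH; ring]. Qed.

Lemma csum_mul (c : C) (f : nat -> C) (n : nat) :
  csum (fun k => c * f k) n = c * csum f n.
Proof. induction n as [|n IH]; simpl; [ring|rewrite IH; ring]. Qed.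

Lemma csum_shift (f : nat -> C) (n : nat) :
  csum f (S n) = f O + csum (fun k => f (S k)) n.
Proof. induction n as [|n IH]; [simpl; ring|].
  change (csum f (S (S n))) with (csum f (S n) + f (S n)). rewrite IH; simpl; ring.
Qed.

Lemma Cmod_minus_sym (a b : C) : Cmod (a - b) = Cmod (b - a).
Proof. rewrite <- Cmod_opp; f_equal; ring. Qed.

Lemma Cmod_dist_triangle (a b c : C) : (Cmod (a - c) <= Cmod (a - b) + Cmod (b - c))%R.
Proof. replace (a - c) with ((a - b) + (b - c)) by ring; apply Cmod_triangle. Qed.

Lemma Cmod_sub_le (a b : C) : (Cmod a - Cmod b <= Cmod (a - b))%R.
Proof.
  pose proof (Cmod_triangle (a - b) b) as H.
  replace (a - b + b) with a in H by ring; lra.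
Qed.

Lemma csum_bound (f : nat -> C) (M th : R) (n : nat) :
  (0 <= th < 1)%R -> (forall k, Cmod (f k) <= M * th ^ k)%R ->
  (Cmod (csum f n) <= M * (1 - th ^ n) / (1 - th))%R.
Proof.
  intros Hth H; induction n as [|n IH]; simpl.
  - rewrite Cmod_0; apply Req_le; field; lra.
  - eapply Rle_trans; [apply Cmod_triangle|].
    apply Rle_trans with (M * (1 - th ^ n) / (1 - th) + M * th ^ n)%R.
    + apply Rplus_le_compat; auto.
    + apply Req_le; field; lra.
Qed.

Lemma csum_split (f : nat -> C) (n m : nat) :
  csum f (n + m) = csum f n + csum (fun k => f (n + k)%nat) m.
Proof.
  induction m as [|m IH]; [rewrite Nat.add_0_r; simpl; ring|].
  rewrite Nat.add_succ_r; simpl; rewrite IH; ring.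
Qed.

Lemma geom_bound_nonneg (f : nat -> C) (M th : R) :
  (forall k, Cmod (f k) <= M * th ^ k)%R -> (0 <= M)%R.
Proof. intros H; specialize (H O); simpl in H; pose proof (Cmod_ge_0 (f O)); lra. Qed.

Lemma csum_tail (f : nat -> C) (M th : R) (n m : nat) :
  (0 <= th < 1)%R -> (forall k, Cmod (f k) <= M * th ^ k)%R ->
  (Cmod (csum f (n + m) - csum f n) <= M * th ^ n / (1 - th))%R.
Proof.
  intros Hth H. rewrite csum_split.
  replace (csum f n + csum (fun k => f (n + k)%nat) m - csum f n)
    with (csum (fun k => f (n + k)%nat) m) by ring.
  pose proof (geom_bound_nonneg _ _ _ H) as HM.
  eapply Rle_trans.
  - apply (csum_bound _ (M * th ^ n) th); auto.
    intros k; eapply Rle_trans; [apply H|]. rewrite pow_add; lra.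
  - unfold Rdiv; apply Rmult_le_compat_r.
    + apply Rlt_le, Rinv_0_lt_compat; lra.
    + assert (0 <= th ^ n)%R by (apply pow_le; lra).
      assert (0 <= th ^ m)%R by (apply pow_le; lra).
      assert (0 <= M * th ^ n * th ^ m)%R by (apply Rmult_le_pos; auto; apply Rmult_le_pos; auto). nra.
Qed.

Lemma pow_small (th M eps : R) :
  (0 <= th < 1)%R -> (0 < eps)%R ->
  exists N, forall n, (N <= n)%nat -> (M * th ^ n < eps)%R.
Proof.
  intros Hth He.
  destruct (pow_lt_1_zero th) with (y := (eps / (Rabs M + 1))%R) as [N HN].
  - rewrite Rabs_pos_eq; lra.
  - apply Rdiv_lt_0_compat; auto. pose proof (Rabs_pos M); lra.
  - exists N; intros n Hn; specialize (HN n Hn).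
    pose proof (Rabs_pos M).
    rewrite Rabs_pos_eq in HN by (apply pow_le; lra).
    apply Rle_lt_trans with (Rabs M * th ^ n)%R.
    + apply Rmult_le_compat_r; [apply pow_le; lra| apply Rle_abs].
    + apply Rle_lt_trans with (Rabs M * (eps / (Rabs M + 1)))%R.
      * apply Rmult_le_compat_l; lra.
      * unfold Rdiv. rewrite <- Rmult_assoc. apply Rmult_lt_reg_r with (Rabs M + 1)%R; [lra|].
        rewrite Rmult_assoc, Rinv_l by lra. nra.
Qed.

Lemma Cmod_le_Re_Im (z : C) : (Cmod z <= Rabs (Re z) + Rabs (Im z))%R.
Proof.
  unfold Cmod. rewrite <- (Rabs_pos_eq (Rabs (Re z) + Rabs (Im z))).
  2: pose proof (Rabs_pos (Re z)); pose proof (Rabs_pos (Im z)); lra.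
  rewrite <- sqrt_Rsqr_abs. apply sqrt_le_1_alt. unfold Rsqr, Re, Im.
  pose proof (Rabs_pos (fst z)); pose proof (Rabs_pos (snd z)).
  rewrite <- (pow2_abs (fst z)), <- (pow2_abs (snd z)). nra.
Qed.

Lemma im_le_Cmod (z : C) : (Rabs (Im z) <= Cmod z)%R.
Proof.
  eapply Rle_trans; [|apply Rmax_Cmod]; apply Rmax_r.
Qed.

Lemma sums_unique (f : nat -> C) (l l' : C) : sums f l -> sums f l' -> l = l'.
Proof.
  intros H H'. destruct (Ceq_dec l l') as [|n]; auto. exfalso.
  assert (D : (0 < Cmod (l - l'))%R) by (apply Cmod_gt_0; intros E; apply n;
    replace l with (l - l' + l') by ring; rewrite E; ring).
  destruct (H (Cmod (l - l') / 2)%R) as [N HN]; [lra|].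
  destruct (H' (Cmod (l - l') / 2)%R) as [N' HN']; [lra|].
  specialize (HN (N + N')%nat ltac:(lia)); specialize (HN' (N + N')%nat ltac:(lia)).
  pose proof (Cmod_dist_triangle l (csum f (N + N')) l') as T.
  rewrite (Cmod_minus_sym l (csum f (N + N'))) in T. lra.
Qed.

Lemma sums_geom (f : nat -> C) (M th : R) :
  (0 <= th < 1)%R -> (forall k, Cmod (f k) <= M * th ^ k)%R ->
  exists l, sums f l /\ forall n, (Cmod (csum f n - l) <= M * th ^ n / (1 - th))%R.
Proof.
  intros Hth H. pose proof (geom_bound_nonneg _ _ _ H) as HM.
  assert (Cau : forall eps, (0 < eps)%R -> exists N, forall n m, (n >= N)%nat -> (m >= N)%nat ->
     (Cmod (csum f n - csum f m) < eps)%R).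
  { intros eps He. destruct (pow_small th (M / (1 - th)) eps Hth He) as [N HN].
    exists N.
    assert (G : forall n m, (n >= N)%nat -> (n <= m)%nat -> (Cmod (csum f m - csum f n) < eps)%R).
    { intros n m Hn Hm. replace m with (n + (m - n))%nat by lia.
      eapply Rle_lt_trans; [apply csum_tail; eauto|].
      specialize (HN n Hn). unfold Rdiv in *. lra. }
    intros n m Hn Hm. destruct (Nat.le_ge_cases n m).
    - rewrite Cmod_minus_sym; auto.
    - auto. }
  assert (C1 : Cauchy_crit (fun n => Re (csum f n))).
  { intros eps He; destruct (Cau eps He) as [N HN]; exists N; intros n m Hn Hm.
    unfold Rdist. eapply Rle_lt_trans; [|apply (HN n m Hn Hm)].
    eapply Rle_trans; [|apply re_le_Cmod]. apply Req_le; f_equal. }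
  assert (C2 : Cauchy_crit (fun n => Im (csum f n))).
  { intros eps He; destruct (Cau eps He) as [N HN]; exists N; intros n m Hn Hm.
    unfold Rdist. eapply Rle_lt_trans; [|apply (HN n m Hn Hm)].
    eapply Rle_trans; [|apply im_le_Cmod]. apply Req_le; f_equal. }
  apply Rcomplete.R_complete in C1; apply Rcomplete.R_complete in C2.
  destruct C1 as [l1 L1], C2 as [l2 L2].
  assert (S : sums f (l1, l2)).
  { intros eps He. destruct (L1 (eps / 2)%R) as [N1 H1]; [lra|].
    destruct (L2 (eps / 2)%R) as [N2 H2]; [lra|].
    exists (N1 + N2)%nat; intros n Hn.
    specialize (H1 n ltac:(lia)); specialize (H2 n ltac:(lia)).
    eapply Rle_lt_trans; [apply Cmod_le_Re_Im|].
    unfold Rdist in *. unfold Re, Im in *; simpl in *. unfold Rminus in *. lra. }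
  exists (l1, l2); split; auto.
  intros n. apply Rnot_lt_le; intros Hlt.
  destruct (S (Cmod (csum f n - (l1, l2)) - M * th ^ n / (1 - th))%R) as [N HN]; [lra|].
  specialize (HN (n + N)%nat ltac:(lia)).
  pose proof (csum_tail f M th n N Hth H) as T.
  pose proof (Cmod_dist_triangle (csum f n) (csum f (n + N)) (l1, l2)) as T'.
  rewrite (Cmod_minus_sym (csum f n) (csum f (n+N))) in T'. lra.
Qed.

Lemma sums_ext (f g : nat -> C) (l : C) : (forall k, f k = g k) -> sums f l -> sums g l.
Proof. intros E; replace g with f; auto. now apply functional_extensionality. Qed.

Lemma sums_add (f g : nat -> C) (l l' : C) :
  sums f l -> sums g l' -> sums (fun k => f k + g k) (l + l').
Proof.
  intros H H' eps He. destruct (H (eps / 2)%R) as [N HN]; [lra|].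
  destruct (H' (eps / 2)%R) as [N' HN']; [lra|].
  exists (N + N')%nat; intros n Hn. rewrite csum_add.
  replace (csum f n + csum g n - (l + l')) with ((csum f n - l) + (csum g n - l')) by ring.
  eapply Rle_lt_trans; [apply Cmod_triangle|].
  specialize (HN n ltac:(lia)); specialize (HN' n ltac:(lia)); lra.
Qed.

Lemma sums_mul (c : C) (f : nat -> C) (l : C) :
  sums f l -> sums (fun k => c * f k) (c * l).
Proof.
  intros H eps He. pose proof (Cmod_ge_0 c).
  destruct (H (eps / (Cmod c + 1))%R) as [N HN]; [apply Rdiv_lt_0_compat; lra|].
  exists N; intros n Hn. rewrite csum_mul.
  replace (c * csum f n - c * l) with (c * (csum f n - l)) by ring.
  rewrite Cmod_mult. specialize (HN n Hn).
  apply Rle_lt_trans with (Cmod c * (eps / (Cmod c + 1)))%R.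
  - apply Rmult_le_compat_l; lra.
  - apply Rmult_lt_reg_r with (Cmod c + 1)%R; [lra|].
    unfold Rdiv; rewrite Rmult_assoc, Rmult_assoc, Rinv_l by lra. nra.
Qed.

Lemma sums_shift (f : nat -> C) (l : C) :
  sums f l <-> sums (fun k => f (S k)) (l - f O).
Proof.
  split; intros H eps He; destruct (H eps He) as [N HN].
  - exists N; intros n Hn. specialize (HN (S n) ltac:(lia)).
    rewrite csum_shift in HN.
    replace (csum (fun k => f (S k)) n - (l - f O)) with (f O + csum (fun k => f (S k)) n - l) by ring. auto.
  - exists (S N); intros n Hn. destruct n as [|n]; [lia|]. specialize (HN n ltac:(lia)).
    rewrite csum_shift.
    replace (f O + csum (fun k => f (S k)) n - l) with (csum (fun k => f (S k)) n - (l - f O)) by ring. auto.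
Qed.

Lemma csum_0 (f : nat -> C) n : (forall k, (k < n)%nat -> f k = 0) -> csum f n = 0.
Proof. induction n as [|n IH]; intros H; simpl; auto. rewrite IH, (H n); auto. ring. Qed.

Lemma sums_finite (f : nat -> C) (N : nat) :
  (forall k, (N <= k)%nat -> f k = 0) -> sums f (csum f N).
Proof.
  intros H eps He; exists N; intros n Hn.
  replace n with (N + (n - N))%nat by lia. rewrite csum_split, (csum_0 (fun k => f (N + k)%nat)).
  - replace (csum f N + 0 - csum f N) with (RtoC 0) by ring. now rewrite Cmod_0.
  - intros k _; apply H; lia.
Qed.

Lemma csum_triangle (u : nat -> nat -> C) (N : nat) :
  csum (fun n => csum (fun k => u (n - k)%nat k) (S n)) N
  = csum (fun k => csum (fun j => u j k) (N - k)) N.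
Proof.
  induction N as [|N IH]; [reflexivity|].
  change (csum (fun n => csum (fun k => u (n - k)%nat k) (S n)) (S N))
    with (csum (fun n => csum (fun k => u (n - k)%nat k) (S n)) N
          + csum (fun k => u (N - k)%nat k) (S N)).
  rewrite IH.
  rewrite (csum_ext (fun k => csum (fun j => u j k) (S N - k))
    (fun k => csum (fun j => u j k) (N - k) + u (N - k)%nat k) (S N)).
  - rewrite csum_add. simpl. rewrite Nat.sub_diag. simpl. ring.
  - intros k Hk. replace (S N - k)%nat with (S (N - k)) by lia. reflexivity.
Qed.

Lemma poly_geom_small (th M eps : R) :
  (0 <= th < 1)%R -> (0 < eps)%R ->
  exists N, forall n, (N <= n)%nat -> (INR n * (M * th ^ n) < eps)%R.
Proof.
  intros Hth He. set (t := sqrt th).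
  assert (Ht : (0 <= t < 1)%R).
  { split; [apply sqrt_pos|]. unfold t. rewrite <- sqrt_1. apply sqrt_lt_1_alt; lra. }
  assert (E : th = (t * t)%R) by (unfold t; rewrite sqrt_sqrt; lra).
  (* [n t ^ n] is at most the sum of the [t ^ k] with [k < n]. *)
  assert (B : forall n, (INR n * t ^ n <= 1 / (1 - t))%R).
  { intros n.
    assert (G : (INR n * t ^ n <= (1 - t ^ n) / (1 - t))%R).
    { induction n as [|n IH]; [simpl; apply Req_le; field; lra|].
      rewrite S_INR. simpl pow.
      assert (0 <= t ^ n)%R by (apply pow_le; lra).
      assert (E1 : ((1 - t * t ^ n) / (1 - t) = (1 - t ^ n) / (1 - t) + t ^ n)%R) by (field; lra).
      rewrite E1. pose proof (pos_INR n).
      assert ((INR n * (t * t ^ n) <= INR n * t ^ n)%R).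
      { apply Rmult_le_compat_l; auto. nra. }
      nra. }
    eapply Rle_trans; [apply G|]. apply Rmult_le_compat_r; [apply Rlt_le, Rinv_0_lt_compat; lra|].
    assert (0 <= t ^ n)%R by (apply pow_le; lra). lra. }
  destruct (pow_small t (Rabs M / (1 - t)) eps Ht He) as [N HN].
  exists N; intros n Hn. specialize (HN n Hn).
  rewrite E, Rpow_mult_distr.
  assert (0 <= t ^ n)%R by (apply pow_le; lra).
  pose proof (Rabs_pos M). pose proof (B n) as Bn. pose proof (pos_INR n).
  apply Rle_lt_trans with (Rabs M * (INR n * t ^ n) * t ^ n)%R.
  - replace (INR n * (M * (t ^ n * t ^ n)))%R with (M * (INR n * t ^ n * t ^ n))%R by ring.
    replace (Rabs M * (INR n * t ^ n) * t ^ n)%R with (Rabs M * (INR n * t ^ n * t ^ n))%R by ring.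
    apply Rmult_le_compat_r; [|apply Rle_abs].
    repeat apply Rmult_le_pos; auto.
  - eapply Rle_lt_trans; [|apply HN]. apply Rmult_le_compat_r; auto.
    unfold Rdiv. apply Rmult_le_compat_l; auto. lra.
Qed.

Lemma csum_sub_bound (f g : nat -> C) (B : R) (n : nat) :
  (forall k, (k < n)%nat -> (Cmod (f k - g k) <= B)%R) ->
  (Cmod (csum f n - csum g n) <= INR n * B)%R.
Proof.
  induction n as [|n IH]; intros H.
  - simpl. replace (0 - 0) with (RtoC 0) by ring. rewrite Cmod_0; lra.
  - rewrite S_INR. simpl.
    replace (csum f n + f n - (csum g n + g n)) with ((csum f n - csum g n) + (f n - g n)) by ring.
    eapply Rle_trans; [apply Cmod_triangle|].
    specialize (IH ltac:(auto)). specialize (H n ltac:(lia)). lra.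
Qed.

(** Rows against antidiagonals.  This one exchange of summations gives both the
    Cauchy product and the expansion of a power series about another point. *)
Lemma sums_rows_antidiagonals (u : nat -> nat -> C) (c : nat -> C) (M th : R) (L : C) :
  (0 <= th < 1)%R -> (forall j k, Cmod (u j k) <= M * th ^ (j + k))%R ->
  (forall k, sums (fun j => u j k) (c k)) ->
  (sums c L <-> sums (fun n => csum (fun k => u (n - k)%nat k) (S n)) L).
Proof.
  intros Hth H Hc.
  assert (HM : (0 <= M)%R).
  { specialize (H O O); simpl in H. pose proof (Cmod_ge_0 (u O O)). lra. }
  assert (D : forall N, (Cmod (csum c N - csum (fun n => csum (fun k => u (n - k)%nat k) (S n)) N)
      <= INR N * (M / (1 - th) * th ^ N))%R).
  { intros N. rewrite csum_triangle. apply csum_sub_bound. intros k Hk.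
    destruct (sums_geom (fun j => u j k) (M * th ^ k) th Hth) as [l [Hl Hb]].
    - intros j. eapply Rle_trans; [apply H|]. rewrite pow_add; lra.
    - rewrite (sums_unique _ _ _ (Hc k) Hl). rewrite Cmod_minus_sym.
      eapply Rle_trans; [apply Hb|].
      replace (M * th ^ k * th ^ (N - k) / (1 - th))%R with (M / (1 - th) * (th ^ k * th ^ (N - k)))%R by (field; lra).
      rewrite <- pow_add. replace (k + (N - k))%nat with N by lia. lra. }
  split; intros HS eps He;
    destruct (HS (eps / 2)%R) as [N1 H1]; try lra;
    destruct (poly_geom_small th (M / (1 - th)) (eps / 2) Hth) as [N2 H2]; try lra;
    exists (N1 + N2)%nat; intros n Hn;
    specialize (H1 n ltac:(lia)); specialize (H2 n ltac:(lia)); specialize (D n).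
  - eapply Rle_lt_trans; [apply (Cmod_dist_triangle _ (csum c n))|].
    rewrite Cmod_minus_sym in D. lra.
  - eapply Rle_lt_trans; [apply (Cmod_dist_triangle _ (csum (fun n => csum (fun k => u (n - k)%nat k) (S n)) n))|].
    lra.
Qed.

(** * Neighbourhoods *)

Lemma lt_Rmin_l (x a b : R) : (x < Rmin a b -> x < a)%R.
Proof. intros H; eapply Rlt_le_trans; [exact H|apply Rmin_l]. Qed.

Lemma lt_Rmin_r (x a b : R) : (x < Rmin a b -> x < b)%R.
Proof. intros H; eapply Rlt_le_trans; [exact H|apply Rmin_r]. Qed.

(** Neighbourhoods in terms of [Cmod], as in [analytic_at]; [near_locally] compares
    them with the product topology of [C]. *)
Definition near (z : C) (P : C -> Prop) : Prop :=
  exists r : R, (0 < r)%R /\ forall w : C, (Cmod (w - z) < r)%R -> P w.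

Lemma near_self (z : C) (P : C -> Prop) : near z P -> P z.
Proof.
  intros [r [Hr H]]; apply H. replace (z - z) with (RtoC 0) by ring.
  now rewrite Cmod_0.
Qed.

Lemma near_and (z : C) (P Q : C -> Prop) :
  near z P -> near z Q -> near z (fun w => P w /\ Q w).
Proof.
  intros [r [Hr H]] [s [Hs K]]. exists (Rmin r s); split; [now apply Rmin_glb_lt|].
  intros w Hw; split; [apply H|apply K]; eapply Rlt_le_trans; eauto;
    [apply Rmin_l|apply Rmin_r].
Qed.

Lemma near_imp (z : C) (P Q : C -> Prop) :
  (forall w, P w -> Q w) -> near z P -> near z Q.
Proof. intros I [r [Hr H]]; exists r; auto. Qed.

Lemma near_true (z : C) (P : C -> Prop) : (forall w, P w) -> near z P.
Proof. intros H; exists 1%R; split; auto; lra. Qed.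

Lemma near_near (z : C) (P : C -> Prop) : near z P -> near z (fun w => near w P).
Proof.
  intros [r [Hr H]]. exists r; split; auto. intros w Hw.
  exists (r - Cmod (w - z))%R; split; [lra|]. intros v Hv. apply H.
  pose proof (Cmod_dist_triangle v w z); lra.
Qed.

Lemma near_disk (z : C) (r : R) : (0 < r)%R -> near z (fun w => (Cmod (w - z) < r)%R).
Proof. intros H; exists r; auto. Qed.

Lemma near_locally (z : C) (P : C -> Prop) : near z P <-> locally z P.
Proof.
  split.
  - intros [r [Hr H]]. apply (locally_le_locally_norm (V := C_NormedModule)).
    exists (mkposreal r Hr). intros w Hw. apply H. exact Hw.
  - intros H. apply (locally_norm_le_locally (V := C_NormedModule)) in H.
    destruct H as [eps H]. exists eps; split; [apply cond_pos|].
    intros w Hw; apply H. exact Hw.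
Qed.

Lemma near_shift (z c : C) (P : C -> Prop) :
  near (z + c) P -> near z (fun w => P (w + c)).
Proof.
  intros [r [Hr H]]; exists r; split; auto. intros w Hw; apply H.
  replace (w + c - (z + c)) with (w - z) by ring; auto.
Qed.

Lemma near_reflect (z c : C) (P : C -> Prop) :
  near (c - z) P -> near z (fun w => P (c - w)).
Proof.
  intros [r [Hr H]]; exists r; split; auto. intros w Hw; apply H.
  replace (c - w - (c - z)) with (-(w - z)) by ring. now rewrite Cmod_opp.
Qed.

(** * Power series *)

(** The geometric bound on the coefficients stands for the radius of convergence:
    for each operation on power series it is enough to produce such a bound. *)
Definition ps (f : C -> C) (z : C) (a : nat -> C) : Prop :=
  exists M rho r : R, (0 < rho)%R /\ (0 < r)%R /\
    (forall n, Cmod (a n) <= M * rho ^ n)%R /\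
    forall w : C, (Cmod w < r)%R -> sums (fun n => a n * w ^ n) (f (z + w)).

Lemma pow_n_Cpow (x : C) (n : nat) : @pow_n C_AbsRing x n = x ^ n.
Proof. induction n as [|n IH]; simpl; [reflexivity|now rewrite IH]. Qed.

Lemma sum_n_csum (f : nat -> C) (n : nat) : @sum_n C_AbelianMonoid f n = csum f (S n).
Proof.
  induction n as [|n IH].
  - rewrite sum_O; simpl; ring.
  - rewrite sum_Sn, IH. reflexivity.
Qed.

Lemma is_series_sums (f : nat -> C) (l : C) :
  @is_series C_AbsRing C_NormedModule f l <-> sums f l.
Proof.
  split.
  - intros H eps He. unfold is_series in H.
    apply (filterlim_locally_ball_norm (U := C_NormedModule)) with (eps := mkposreal eps He) in H.
    destruct H as [N H]. exists (S N). intros n Hn. destruct n as [|n]; [lia|].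
    specialize (H n ltac:(lia)). rewrite <- sum_n_csum. exact H.
  - intros H. apply (filterlim_locally_ball_norm (U := C_NormedModule)). intros eps.
    destruct (H eps (cond_pos eps)) as [N HN]. exists N. intros n Hn.
    specialize (HN (S n) ltac:(lia)). rewrite <- sum_n_csum in HN. exact HN.
Qed.

Lemma sums_bounded (f : nat -> C) (l : C) : sums f l -> exists M, forall n, (Cmod (f n) <= M)%R.
Proof.
  intros H. destruct (H 1%R ltac:(lra)) as [N HN].
  assert (F : forall m, exists M, forall n, (n < m)%nat -> (Cmod (f n) <= M)%R).
  { induction m as [|m [M IH]]; [exists 0%R; lia|].
    exists (Rmax M (Cmod (f m))). intros n Hn.
    destruct (Nat.eq_dec n m) as [->|]; [apply Rmax_r|].
    eapply Rle_trans; [apply IH; lia|apply Rmax_l]. }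
  destruct (F N) as [M HM]. exists (Rmax M 2). intros n.
  destruct (lt_dec n N) as [L|L]; [eapply Rle_trans; [apply HM; auto|apply Rmax_l]|].
  eapply Rle_trans; [|apply Rmax_r].
  pose proof (HN n ltac:(lia)) as H1; pose proof (HN (S n) ltac:(lia)) as H2; simpl in H2.
  replace (f n) with ((csum f n + f n - l) + - (csum f n - l)) by ring.
  eapply Rle_trans; [apply Cmod_triangle|]. rewrite Cmod_opp; lra.
Qed.

Lemma RtoC_neq0 (x : R) : x <> 0%R -> RtoC x <> 0.
Proof. intros H E; apply H; now injection E. Qed.

Lemma analytic_ps (f : C -> C) (z : C) : analytic_at f z <-> exists a, ps f z a.
Proof.
  split.
  - intros [a [r [Hr H]]]. exists a.
    assert (S : forall w, (Cmod w < r)%R -> sums (fun n => a n * w ^ n) (f (z + w))).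
    { intros w Hw. specialize (H (z + w)). replace (z + w - z) with w in H by ring.
      specialize (H Hw). apply is_series_sums in H. eapply sums_ext; [|apply H].
      intros k. change (@pow_n C_AbsRing w k * a k = a k * w ^ k).
      rewrite (pow_n_Cpow w k); ring. }
    assert (A : (Cmod (RtoC (r / 2)) < r)%R) by (rewrite Cmod_R, Rabs_pos_eq; lra).
    destruct (sums_bounded _ _ (S _ A)) as [M HM].
    exists M, (2 / r)%R, r. repeat split; auto.
    + apply Rdiv_lt_0_compat; lra.
    + intros n. specialize (HM n). rewrite Cmod_mult, Cmod_pow, Cmod_R, Rabs_pos_eq in HM by lra.
      assert (E : ((r / 2) ^ n * (2 / r) ^ n = 1)%R).
      { rewrite <- Rpow_mult_distr. replace (r / 2 * (2 / r))%R with 1%R by (field; lra). apply pow1. }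
      assert (0 <= (2 / r) ^ n)%R by (apply pow_le, Rlt_le, Rdiv_lt_0_compat; lra).
      replace (Cmod (a n)) with (Cmod (a n) * (r / 2) ^ n * (2 / r) ^ n)%R by (rewrite Rmult_assoc, E; ring).
      now apply Rmult_le_compat_r.
  - intros [a [M [rho [r [Hrho [Hr [HM H]]]]]]]. exists a, r; split; auto.
    intros w Hw. apply is_series_sums. specialize (H (w - z) Hw).
    replace (z + (w - z)) with w in H by ring. eapply sums_ext; [|apply H].
    intros k. change (a k * (w - z) ^ k = @pow_n C_AbsRing (w - z) k * a k).
    rewrite (pow_n_Cpow (w - z) k); ring.
Qed.

Lemma ps_analytic (f : C -> C) (z : C) (a : nat -> C) : ps f z a -> analytic_at f z.
Proof. intros H; apply analytic_ps; eauto. Qed.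

(** Only germs matter, so the radius may be traded for a geometric ratio [d]. *)
Lemma ps_shrink (f : C -> C) (z : C) (a : nat -> C) (d : R) :
  (0 < d)%R -> ps f z a ->
  exists M rho r : R, (0 <= M)%R /\ (0 < rho)%R /\ (0 < r)%R /\ (rho * r <= d)%R /\
    (forall n, Cmod (a n) <= M * rho ^ n)%R /\
    forall w : C, (Cmod w < r)%R -> sums (fun n => a n * w ^ n) (f (z + w)).
Proof.
  intros Hd [M [rho [r [Hrho [Hr [HM H]]]]]].
  exists M, rho, (Rmin r (d / rho)). repeat split; auto.
  - eapply geom_bound_nonneg; eauto.
  - apply Rmin_glb_lt; auto. apply Rdiv_lt_0_compat; lra.
  - apply Rle_trans with (rho * (d / rho))%R; [apply Rmult_le_compat_l; [lra|apply Rmin_r]|].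
    apply Req_le; field; lra.
  - intros w Hw; apply H. eapply lt_Rmin_l; eassumption.
Qed.

Lemma ps_ext (f g : C -> C) (z : C) (a : nat -> C) :
  near z (fun w => f w = g w) -> ps f z a -> ps g z a.
Proof.
  intros [s [Hs E]] [M [rho [r [Hrho [Hr [HM H]]]]]].
  exists M, rho, (Rmin r s). repeat split; auto.
  - now apply Rmin_glb_lt.
  - intros w Hw. rewrite <- E.
    + apply H. eapply lt_Rmin_l; eassumption.
    + replace (z + w - z) with w by ring. eapply lt_Rmin_r; eassumption.
Qed.

Lemma Cpow_0_S (n : nat) : 0 ^ (S n) = 0.
Proof. rewrite Cpow_S; ring. Qed.

Lemma ps_val (f : C -> C) (z : C) (a : nat -> C) : ps f z a -> f z = a O.
Proof.
  intros [M [rho [r [Hrho [Hr [HM H]]]]]].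
  specialize (H 0). rewrite Cmod_0 in H. specialize (H Hr).
  replace (z + 0) with z in H by ring.
  eapply sums_unique; [apply H|].
  replace (a O) with (csum (fun n => a n * 0 ^ n) 1) by (simpl; ring).
  apply sums_finite. intros [|k] Hk; [lia|]. rewrite Cpow_0_S; ring.
Qed.

Lemma ps_const (c z : C) : ps (fun _ => c) z (fun n => match n with O => c | _ => 0 end).
Proof.
  exists (Cmod c), 1%R, 1%R. repeat split; try lra.
  - intros n. rewrite pow1, Rmult_1_r. destruct n; [lra|]. rewrite Cmod_0; apply Cmod_ge_0.
  - intros w _. set (t := fun n : nat => _).
    replace c with (csum t 1) by (unfold t; simpl; ring).
    apply sums_finite. intros [|k] Hk; [lia|]. unfold t; ring.
Qed.

Lemma ps_id (z : C) : ps (fun w => w) z (fun n => match n with O => z | S O => 1 | _ => 0 end).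
Proof.
  exists (Cmod z + 1)%R, 1%R, 1%R. repeat split; try lra.
  - intros n. rewrite pow1, Rmult_1_r. pose proof (Cmod_ge_0 z).
    destruct n as [|[|n]]; rewrite ?Cmod_0, ?Cmod_1; lra.
  - intros w _. set (t := fun n : nat => _).
    replace (z + w) with (csum t 2) by (unfold t; simpl; ring).
    apply sums_finite. intros [|[|k]] Hk; try lia. unfold t; ring.
Qed.

Lemma term_bound (a : nat -> C) (M rho d : R) (w : C) :
  (forall n, Cmod (a n) <= M * rho ^ n)%R -> (0 <= M)%R -> (0 < rho)%R ->
  (rho * Cmod w <= d)%R ->
  forall k, (Cmod (a k * w ^ k) <= M * d ^ k)%R.
Proof.
  intros HM M0 Hrho Hd k. rewrite Cmod_mult, Cmod_pow. pose proof (Cmod_ge_0 w).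
  apply Rle_trans with (M * rho ^ k * (Cmod w) ^ k)%R.
  - apply Rmult_le_compat_r; [apply pow_le; auto|auto].
  - rewrite Rmult_assoc, <- Rpow_mult_distr. apply Rmult_le_compat_l; auto.
    apply pow_incr. split; [apply Rmult_le_pos; lra|auto].
Qed.

(** Taylor's formula with remainder. *)
Lemma ps_tail (f : C -> C) (z : C) (a : nat -> C) (N : nat) : ps f z a ->
  exists K r : R, (0 <= K)%R /\ (0 < r)%R /\ forall w : C, (Cmod w < r)%R ->
    (Cmod (f (z + w)%C - csum (fun n => a n * w ^ n)%C N) <= K * Cmod w ^ N)%R.
Proof.
  intros P.
  destruct (ps_shrink _ _ _ (1/2) ltac:(lra) P) as [M [rho [r [HM0 [Hrho [Hr [Hd [HM H]]]]]]]].
  assert (0 <= rho ^ N)%R by (apply pow_le; lra).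
  exists (2 * M * rho ^ N)%R, r. split; [apply Rmult_le_pos; lra|split; auto].
  intros w Hw. specialize (H w Hw). pose proof (Cmod_ge_0 w).
  assert (Hhalf : (0 <= rho * Cmod w <= 1/2)%R) by (split; [apply Rmult_le_pos|]; nra).
  destruct (sums_geom (fun n => a n * w ^ n) M (rho * Cmod w)) as [l [Hl Hb]]; [lra| |].
  { apply term_bound with rho; auto; lra. }
  specialize (Hb N). rewrite <- (sums_unique _ _ _ H Hl), Cmod_minus_sym in Hb.
  eapply Rle_trans; [apply Hb|]. apply Rmult_le_reg_r with (1 - rho * Cmod w)%R; [lra|].
  unfold Rdiv. rewrite Rmult_assoc, Rinv_l, Rpow_mult_distr by lra.
  assert (0 <= M * rho ^ N * Cmod w ^ N)%R by (repeat apply Rmult_le_pos; auto; apply pow_le; lra).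
  nra.
Qed.

Lemma ps_add (f g : C -> C) (z : C) (a b : nat -> C) :
  ps f z a -> ps g z b -> ps (fun w => f w + g w) z (fun n => a n + b n).
Proof.
  intros [M [rho [r [Hrho [Hr [HM H]]]]]] [M' [rho' [r' [Hrho' [Hr' [HM' H']]]]]].
  pose proof (geom_bound_nonneg _ _ _ HM); pose proof (geom_bound_nonneg _ _ _ HM').
  exists (M + M')%R, (Rmax rho rho'), (Rmin r r'). repeat split.
  - eapply Rlt_le_trans; [|apply Rmax_l]; auto.
  - now apply Rmin_glb_lt.
  - intros n. eapply Rle_trans; [apply Cmod_triangle|]. rewrite Rmult_plus_distr_r.
    apply Rplus_le_compat; (eapply Rle_trans; [apply HM || apply HM'|]);
      apply Rmult_le_compat_l; auto; apply pow_incr; split; try lra; [apply Rmax_l|apply Rmax_r].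
  - intros w Hw. eapply sums_ext; [|apply sums_add; [apply H|apply H']].
    + intros k; simpl; ring.
    + eapply lt_Rmin_l; eassumption.
    + eapply lt_Rmin_r; eassumption.
Qed.

Definition conv (a b : nat -> C) (n : nat) : C := csum (fun k => a (n - k)%nat * b k) (S n).

Lemma csum_le (f : nat -> C) (B : R) (n : nat) :
  (forall k, (k < n)%nat -> (Cmod (f k) <= B)%R) -> (Cmod (csum f n) <= INR n * B)%R.
Proof.
  induction n as [|n IH]; intros H; [simpl; rewrite Cmod_0; lra|].
  rewrite S_INR; simpl. eapply Rle_trans; [apply Cmod_triangle|].
  specialize (IH ltac:(auto)); specialize (H n ltac:(lia)); lra.
Qed.

Lemma INR_le_pow2 (n : nat) : (INR (S n) <= 2 ^ n)%R.
Proof.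
  induction n as [|n IH]; [simpl; lra|]. rewrite S_INR. simpl pow.
  assert (1 <= 2 ^ n)%R by (apply pow_R1_Rle; lra). lra.
Qed.

Lemma ps_mul (f g : C -> C) (z : C) (a b : nat -> C) :
  ps f z a -> ps g z b -> ps (fun w => f w * g w) z (conv a b).
Proof.
  intros Pa Pb.
  destruct (ps_shrink _ _ _ (1/2) ltac:(lra) Pa) as [M [rho [r [HM0 [Hrho [Hr [Hd [HM H]]]]]]]].
  destruct (ps_shrink _ _ _ (1/2) ltac:(lra) Pb) as [M' [rho' [r' [HM0' [Hrho' [Hr' [Hd' [HM' H']]]]]]]].
  set (m := Rmax rho rho').
  assert (Hm : (0 < m)%R) by (eapply Rlt_le_trans; [|apply Rmax_l]; auto).
  exists (M * M')%R, (2 * m)%R, (Rmin r r'). repeat split.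
  - lra.
  - now apply Rmin_glb_lt.
  - intros n. unfold conv. eapply Rle_trans; [apply (csum_le _ (M * M' * m ^ n))|].
    + intros k Hk. rewrite Cmod_mult.
      replace n with ((n - k) + k)%nat at 2 by lia. rewrite pow_add.
      replace (M * M' * (m ^ (n - k) * m ^ k))%R with (M * m ^ (n - k) * (M' * m ^ k))%R by ring.
      apply Rmult_le_compat; try apply Cmod_ge_0;
      (eapply Rle_trans; [apply HM || apply HM'|]); apply Rmult_le_compat_l; auto;
      apply pow_incr; split; try lra; [apply Rmax_l|apply Rmax_r].
    + rewrite Rpow_mult_distr. pose proof (INR_le_pow2 n).
      assert (0 <= M * M' * m ^ n)%R by (repeat apply Rmult_le_pos; auto; apply pow_le; lra).
      replace (M * M' * (2 ^ n * m ^ n))%R with (2 ^ n * (M * M' * m ^ n))%R by ring.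
      now apply Rmult_le_compat_r.
  - intros w Hw.
    assert (W1 : (Cmod w < r)%R) by (eapply lt_Rmin_l; eassumption).
    assert (W2 : (Cmod w < r')%R) by (eapply lt_Rmin_r; eassumption).
    specialize (H w W1); specialize (H' w W2).
    pose proof (Cmod_ge_0 w).
    set (u := fun j k => (a j * w ^ j) * (b k * w ^ k)).
    assert (B1 : forall k, (Cmod (a k * w ^ k) <= M * (1/2) ^ k)%R) by (apply term_bound with rho; auto; nra).
    assert (B2 : forall k, (Cmod (b k * w ^ k) <= M' * (1/2) ^ k)%R) by (apply term_bound with rho'; auto; nra).
    eapply sums_ext.
    2: refine (proj1 (sums_rows_antidiagonals u (fun k => f (z + w) * (b k * w ^ k)) (M * M') (1/2) _ _ _ _) _).
    + intros n. unfold u, conv. rewrite (Cmult_comm (csum (fun k => a (n - k)%nat * b k) (S n)) (w ^ n)), <- csum_mul.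
      apply csum_ext. intros k Hk. replace n with ((n - k) + k)%nat at 3 by lia.
      rewrite Cpow_add_r. ring.
    + lra.
    + intros j k. unfold u. rewrite Cmod_mult, pow_add.
      replace (M * M' * ((1/2) ^ j * (1/2) ^ k))%R with (M * (1/2) ^ j * (M' * (1/2) ^ k))%R by ring.
      apply Rmult_le_compat; auto; apply Cmod_ge_0.
    + intros k. unfold u. rewrite (Cmult_comm (f (z + w))). eapply sums_ext; [|apply sums_mul, H].
      intros j; simpl; ring.
    + now apply sums_mul.
Qed.

Lemma ps_affine (f : C -> C) (c d z : C) (a : nat -> C) :
  ps f (c * z + d) a -> ps (fun w => f (c * w + d)) z (fun n => a n * c ^ n).
Proof.
  intros [M [rho [r [Hrho [Hr [HM H]]]]]]. pose proof (Cmod_ge_0 c).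
  exists M, (rho * (Cmod c + 1))%R, (r / (Cmod c + 1))%R. repeat split.
  - apply Rmult_lt_0_compat; lra.
  - apply Rdiv_lt_0_compat; lra.
  - intros n. rewrite Cmod_mult, Cmod_pow, Rpow_mult_distr, <- Rmult_assoc.
    apply Rmult_le_compat; auto; try apply Cmod_ge_0; [apply pow_le; auto|].
    apply pow_incr; lra.
  - intros w Hw. replace (c * (z + w) + d) with (c * z + d + c * w) by ring.
    eapply sums_ext; [|apply (H (c * w))].
    + intros k; simpl. rewrite Cpow_mult_l; ring.
    + rewrite Cmod_mult. apply Rle_lt_trans with ((Cmod c + 1) * Cmod w)%R.
      * apply Rmult_le_compat_r; [apply Cmod_ge_0|lra].
      * apply Rmult_lt_compat_l with (r := (Cmod c + 1)%R) in Hw; [|lra].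
        replace ((Cmod c + 1) * (r / (Cmod c + 1)))%R with r in Hw by (field; lra). auto.
Qed.

(** The difference quotient; its value at the centre makes it analytic there. *)
Definition dquot (f : C -> C) (z w : C) : C :=
  if Ceq_dec w z then C_derive f z else (f w - f z) / (w - z).

Lemma ps_quot_aux (f : C -> C) (z : C) (a : nat -> C) (g : C -> C) :
  ps f z a -> g z = a 1%nat -> (forall w, w <> z -> g w = (f w - f z) / (w - z)) ->
  ps g z (fun n => a (S n)).
Proof.
  intros P G0 G. pose proof (ps_val _ _ _ P) as V.
  destruct P as [M [rho [r [Hrho [Hr [HM H]]]]]].
  exists (M * rho)%R, rho, r. repeat split; auto.
  - intros n. eapply Rle_trans; [apply HM|]. simpl. apply Req_le; ring.
  - intros w Hw. destruct (Ceq_dec w 0) as [->|Nw].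
    + replace (z + 0) with z by ring. rewrite G0.
      replace (a 1%nat) with (csum (fun n => a (S n) * 0 ^ n) 1) by (simpl; ring).
      apply sums_finite. intros [|k] Hk; [lia|]. rewrite Cpow_0_S; ring.
    + assert (z + w <> z) by (intros E; apply Nw; replace w with (z + w - z) by ring; rewrite E; ring).
      rewrite G by auto. specialize (H w Hw). apply sums_shift in H.
      replace ((f (z + w) - f z) / (z + w - z)) with (/ w * (f (z + w) - a O * w ^ 0)).
      2:{ rewrite V. simpl. replace (z + w - z) with w by ring. field; auto. }
      eapply sums_ext; [|apply sums_mul, H].
      intros k; simpl. field; auto.
Qed.

Lemma ps_deriv (f : C -> C) (z : C) (a : nat -> C) :
  ps f z a -> is_derive (K := C_AbsRing) (V := C_NormedModule) f z (a 1%nat).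
Proof.
  intros P. pose proof (ps_val _ _ _ P) as V.
  destruct (ps_tail f z a 2 P) as [K [r [K0 [Hr H]]]].
  split; [apply is_linear_scal_l|]. intros x Hx eps.
  apply (is_filter_lim_locally_unique (V := AbsRing_NormedModule C_AbsRing)) in Hx. subst x.
  assert (Hdel : (0 < Rmin r (eps / (K + 1)))%R).
  { apply Rmin_glb_lt; auto. apply Rdiv_lt_0_compat; [apply cond_pos|lra]. }
  assert (Q : forall y : C, (Cmod (y - z) < Rmin r (eps / (K + 1)))%R ->
     (Cmod (f y - f z - (y - z) * a 1%nat) <= eps * Cmod (y - z))%R).
  2: exists (mkposreal _ Hdel); intros y Hy; exact (Q y Hy).
  intros y Hy. specialize (H (y - z) (lt_Rmin_l _ _ _ Hy)). apply lt_Rmin_r in Hy.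
  replace (z + (y - z)) with y in H by ring. set (w := y - z) in *. simpl csum in H.
  replace (f y - (0 + a 0%nat * 1 + a 1%nat * (w * 1))) with (f y - f z - w * a 1%nat) in H
    by (rewrite V; ring).
  pose proof (Cmod_ge_0 w). eapply Rle_trans; [apply H|]. simpl. rewrite Rmult_1_r, <- Rmult_assoc.
  apply Rmult_le_compat_r; auto.
  apply Rmult_lt_compat_r with (r := (K + 1)%R) in Hy; [|lra].
  replace (eps / (K + 1) * (K + 1))%R with (eps : R) in Hy by (field; lra). nra.
Qed.

Lemma ps_C_derive (f : C -> C) (z : C) (a : nat -> C) : ps f z a -> C_derive f z = a 1%nat.
Proof. intros H; now apply is_C_derive_unique, ps_deriv. Qed.

Lemma ps_dquot (f : C -> C) (z : C) (a : nat -> C) :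
  ps f z a -> ps (dquot f z) z (fun n => a (S n)).
Proof.
  intros H. eapply ps_quot_aux; eauto; unfold dquot.
  - destruct (Ceq_dec z z); [|congruence]. now apply ps_C_derive.
  - intros w Hw. destruct (Ceq_dec w z); congruence.
Qed.

(** Coefficient of [h ^ k] in [(w + h) ^ n]. *)
Fixpoint binom_coef (w : C) (n k : nat) : C :=
  match n, k with
  | O, O => 1
  | O, S _ => 0
  | S m, O => w * binom_coef w m O
  | S m, S j => w * binom_coef w m (S j) + binom_coef w m j
  end.

Lemma binom_coef_gt (w : C) (n k : nat) : (n < k)%nat -> binom_coef w n k = 0.
Proof.
  revert k; induction n as [|n IH]; intros [|k] H; try lia; simpl; auto.
  rewrite !IH by lia. ring.
Qed.

Lemma binom_coef_sum (w h : C) (n : nat) :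
  csum (fun k => binom_coef w n k * h ^ k) (S n) = (w + h) ^ n.
Proof.
  induction n as [|n IH]; [simpl; ring|].
  rewrite csum_shift, (Cpow_S (w + h) n), <- IH.
  rewrite (csum_ext (fun k => binom_coef w (S n) (S k) * h ^ (S k))
     (fun k => w * (binom_coef w n (S k) * h ^ (S k)) + h * (binom_coef w n k * h ^ k))).
  2: intros k _; simpl; ring.
  rewrite csum_add, !csum_mul.
  assert (E : csum (fun k => binom_coef w n (S k) * h ^ (S k)) (S n)
     = csum (fun k => binom_coef w n k * h ^ k) (S n) - binom_coef w n 0).
  { pose proof (csum_shift (fun k => binom_coef w n k * h ^ k) (S n)) as S1.
    change (csum (fun k => binom_coef w n k * h ^ k) (S (S n))) with
      (csum (fun k => binom_coef w n k * h ^ k) (S n) + binom_coef w n (S n) * h ^ (S n)) in S1.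
    rewrite (binom_coef_gt w n (S n)) in S1 by lia.
    assert (E0 : csum (fun k => binom_coef w n k * h ^ k) (S n)
      = csum (fun k => binom_coef w n k * h ^ k) (S n) + 0 * h ^ (S n)) by ring.
    rewrite E0, S1. change (h ^ 0) with (RtoC 1). ring. }
  rewrite E. simpl. ring.
Qed.

Lemma binom_coef_bound (w : C) (s : R) (n k : nat) :
  (Cmod w <= s)%R -> (Cmod (binom_coef w n k) * s ^ k <= (2 * s) ^ n)%R.
Proof.
  intros Hs. pose proof (Cmod_ge_0 w) as W0. revert k.
  induction n as [|n IH]; intros [|k]; simpl.
  - rewrite Cmod_1; lra.
  - rewrite Cmod_0; lra.
  - rewrite Cmod_mult. specialize (IH O); simpl in IH. pose proof (Cmod_ge_0 (binom_coef w n 0)).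
    assert (0 <= (2 * s) ^ n)%R by (apply pow_le; lra). nra.
  - pose proof (IH (S k)) as I1; pose proof (IH k) as I2; simpl in I1.
    assert (0 <= s ^ k)%R by (apply pow_le; lra).
    apply Rle_trans with ((s * Cmod (binom_coef w n (S k)) + Cmod (binom_coef w n k)) * (s * s ^ k))%R.
    + apply Rmult_le_compat_r; [apply Rmult_le_pos; lra|].
      eapply Rle_trans; [apply Cmod_triangle|]. apply Rplus_le_compat_r. rewrite Cmod_mult.
      apply Rmult_le_compat_r; [apply Cmod_ge_0|auto].
    + nra.
Qed.

Lemma binom_coef_1 (w : C) (j : nat) : binom_coef w (S j) 1 = INR (S j) * w ^ j.
Proof.
  assert (Z : forall n, binom_coef w n 0 = w ^ n) by (induction n as [|n IH]; simpl; [auto|now rewrite IH]).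
  induction j as [|j IH]; [simpl; ring|].
  change (binom_coef w (S (S j)) 1) with (w * binom_coef w (S j) 1 + binom_coef w (S j) 0).
  rewrite IH, Z, (S_INR (S j)), RtoC_plus. simpl Cpow. ring.
Qed.

(** The terms of [a n * (w + h) ^ n], summed along rows instead of antidiagonals.
    The coefficient of degree one is made explicit because it is the derivative. *)
Lemma ps_recenter (f : C -> C) (z : C) (a : nat -> C) :
  ps f z a -> exists r, (0 < r)%R /\ forall w, (Cmod w < r)%R ->
    exists b, ps f (z + w) b /\ sums (fun j => (INR (S j) * a (S j)) * w ^ j) (b 1%nat).
Proof.
  intros P.
  destruct (ps_shrink _ _ _ (1/2) ltac:(lra) P) as [M [rho [r [HM0 [Hrho [Hr [Hd [HM H]]]]]]]].
  set (s := Rmin (r / 2) (1 / (8 * rho))).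
  assert (Hs : (0 < s)%R) by (apply Rmin_glb_lt; [lra|apply Rdiv_lt_0_compat; lra]).
  assert (s1 : (s <= r / 2)%R) by apply Rmin_l.
  assert (s2 : (rho * (2 * s) <= 1 / 4)%R).
  { assert (s <= 1 / (8 * rho))%R by apply Rmin_r.
    apply Rle_trans with (rho * (2 * (1 / (8 * rho))))%R; [nra|]. apply Req_le; field; lra. }
  exists s; split; auto. intros w Hw.
  set (u := fun j k => a (j + k)%nat * binom_coef w (j + k) k).
  assert (B : forall j k, (Cmod (u j k) * s ^ k <= M * (1/4) ^ (j + k))%R).
  { intros j k. unfold u. rewrite Cmod_mult, Rmult_assoc.
    apply Rle_trans with (M * rho ^ (j + k) * (2 * s) ^ (j + k))%R.
    - apply Rmult_le_compat; auto; [apply Cmod_ge_0|apply Rmult_le_pos; [apply Cmod_ge_0|apply pow_le; lra]|].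
      apply binom_coef_bound; lra.
    - rewrite Rmult_assoc, <- Rpow_mult_distr. apply Rmult_le_compat_l; auto.
      apply pow_incr. split; [|lra]. apply Rmult_le_pos; lra. }
  assert (B' : forall j k, (Cmod (u j k) <= M * (1/4) ^ (j + k) * (/ s) ^ k)%R).
  { intros j k. assert (0 < s ^ k)%R by (apply pow_lt; lra).
    rewrite pow_inv. apply Rmult_le_reg_r with (s ^ k)%R; auto.
    rewrite (Rmult_assoc _ (/ s ^ k)), Rinv_l by lra. rewrite Rmult_1_r. apply B. }
  assert (CV : forall k, exists l, sums (fun j => u j k) l /\ (Cmod l <= 2 * M * (/ (4 * s)) ^ k)%R).
  { intros k. destruct (sums_geom (fun j => u j k) (M * (1/4) ^ k * (/ s) ^ k) (1/4)) as [l [Hl Hb]]; [lra| |].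
    - intros j. eapply Rle_trans; [apply B'|]. rewrite pow_add. apply Req_le; ring.
    - exists l; split; auto. specialize (Hb O). simpl in Hb. rewrite Cmod_minus_sym in Hb.
      replace (l - 0) with l in Hb by ring. eapply Rle_trans; [apply Hb|].
      replace (/ (4 * s))%R with (1/4 * / s)%R by (field; lra). rewrite Rpow_mult_distr.
      assert (0 <= M * (1/4) ^ k * (/ s) ^ k)%R.
      { repeat apply Rmult_le_pos; auto; apply pow_le; [lra|]. apply Rlt_le, Rinv_0_lt_compat; lra. }
      unfold Rdiv. rewrite Rmult_1_r. apply Rle_trans with (M * (1 * / 4) ^ k * (/ s) ^ k * 2)%R; [|apply Req_le; ring].
      apply Rmult_le_compat_l; [unfold Rdiv in *; auto|]. lra. }
  set (c := fun k => proj1_sig (constructive_indefinite_description _ (CV k))).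
  assert (Hc : forall k, sums (fun j => u j k) (c k) /\ (Cmod (c k) <= 2 * M * (/ (4 * s)) ^ k)%R).
  { intros k. unfold c. exact (proj2_sig (constructive_indefinite_description _ (CV k))). }
  exists c. split.
  - exists (2 * M)%R, (/ (4 * s))%R, s. repeat split; auto.
    + apply Rinv_0_lt_compat; lra.
    + apply Hc.
    + intros h Hh.
      refine (proj2 (sums_rows_antidiagonals (fun j k => u j k * h ^ k) (fun k => c k * h ^ k) M (1/4) _ _ _ _) _).
      * lra.
      * intros j k. rewrite Cmod_mult, Cmod_pow. eapply Rle_trans; [|apply B].
        apply Rmult_le_compat_l; [apply Cmod_ge_0|]. apply pow_incr. split; [apply Cmod_ge_0|lra].
      * intros k. rewrite (Cmult_comm (c k)). eapply sums_ext; [|apply sums_mul, Hc]. intros j; simpl; ring.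
      * specialize (H (w + h)). replace (z + (w + h)) with (z + w + h) in H by ring.
        eapply sums_ext; [|apply H].
        -- intros n; cbn beta. rewrite <- binom_coef_sum, <- csum_mul. apply csum_ext.
           intros k Hk. unfold u. replace (n - k + k)%nat with n by lia. ring.
        -- eapply Rle_lt_trans; [apply Cmod_triangle|]. lra.
  - eapply sums_ext; [|apply (proj1 (Hc 1%nat))].
    intros j. unfold u. rewrite Nat.add_1_r, binom_coef_1. ring.
Qed.

(** The derivative at a point near [z] is the coefficient of degree one of the
    expansion about that point. *)
Lemma ps_derived (f : C -> C) (z : C) (a : nat -> C) :
  ps f z a -> ps (C_derive f) z (fun n => INR (S n) * a (S n)).
Proof.
  intros P. destruct (ps_recenter _ _ _ P) as [r [Hr H]].
  destruct P as [M [rho [r' [Hrho [Hr' [HM _]]]]]].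
  pose proof (geom_bound_nonneg _ _ _ HM).
  exists (M * rho)%R, (2 * rho)%R, r. repeat split; try lra.
  - intros n. rewrite Cmod_mult, Cmod_R, Rabs_pos_eq by apply pos_INR.
    rewrite Rpow_mult_distr. replace (M * rho * (2 ^ n * rho ^ n))%R with (2 ^ n * (M * rho ^ S n))%R by (simpl; ring).
    apply Rmult_le_compat; auto; [apply pos_INR|apply Cmod_ge_0|apply INR_le_pow2].
  - intros w Hw. destruct (H w Hw) as [b [Hb Sb]]. rewrite (ps_C_derive _ _ _ Hb). exact Sb.
Qed.

(** The triangular recursion for the coefficients of the reciprocal needs all the
    preceding ones; [recip_prefix a n] stores those of index at most [n]. *)
Fixpoint recip_prefix (a : nat -> C) (n : nat) : nat -> C :=
  match n with
  | O => fun _ => / a O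
  | S m => fun k => if le_lt_dec k m then recip_prefix a m k
      else - (/ a O) * csum (fun j => a (S m - j)%nat * recip_prefix a m j) (S m)
  end.

Definition recip_coef (a : nat -> C) (n : nat) : C := recip_prefix a n n.

Lemma recip_prefix_coef (a : nat -> C) (n k : nat) :
  (k <= n)%nat -> recip_prefix a n k = recip_coef a k.
Proof.
  induction n as [|n IH]; intros H.
  - assert (k = O) by lia; now subst.
  - destruct (Nat.eq_dec k (S n)) as [->|Hk]; [reflexivity|].
    simpl. destruct (le_lt_dec k n); [apply IH; lia|lia].
Qed.

Lemma recip_coef_S (a : nat -> C) (n : nat) :
  recip_coef a (S n) = - (/ a O) * csum (fun j => a (S n - j)%nat * recip_coef a j) (S n).
Proof.
  unfold recip_coef at 1. cbn [recip_prefix]. destruct (le_lt_dec (S n) n); [lia|].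
  f_equal. apply csum_ext. intros k Hk. rewrite recip_prefix_coef by lia. reflexivity.
Qed.

Lemma conv_recip (a : nat -> C) (n : nat) :
  a O <> 0 -> conv a (recip_coef a) n = match n with O => 1 | _ => 0 end.
Proof.
  intros H0. unfold conv. destruct n as [|n].
  - simpl. unfold recip_coef; simpl. field; auto.
  - change (csum (fun k => a (S n - k)%nat * recip_coef a k) (S (S n)))
      with (csum (fun k => a (S n - k)%nat * recip_coef a k) (S n) + a (S n - S n)%nat * recip_coef a (S n)).
    rewrite Nat.sub_diag, recip_coef_S. field; auto.
Qed.

Lemma csum_le_geom (f : nat -> C) (K q : R) (n : nat) :
  (forall k, (k < n)%nat -> (Cmod (f k) <= K * (q - 1) * q ^ k)%R) ->
  (Cmod (csum f n) <= K * (q ^ n - 1))%R.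
Proof.
  induction n as [|n IH]; intros H; [simpl; rewrite Cmod_0; lra|].
  simpl. eapply Rle_trans; [apply Cmod_triangle|].
  specialize (IH ltac:(auto)); specialize (H n ltac:(lia)). nra.
Qed.

(** With [|a n| <= M rho ^ n] and [q = 1 + M / |a 0|], induction leads to the
    geometric sum of the [(q - 1) q ^ k], which telescopes. *)
Lemma recip_coef_bound (a : nat -> C) (M rho : R) :
  a O <> 0 -> (0 < rho)%R -> (forall n, Cmod (a n) <= M * rho ^ n)%R ->
  forall n, (Cmod (recip_coef a n) <= / Cmod (a O) * (rho * (1 + M / Cmod (a O))) ^ n)%R.
Proof.
  intros H0 Hrho HM. set (A := Cmod (a O)).
  assert (A0 : (0 < A)%R) by now apply Cmod_gt_0.
  assert (M0 : (0 < M)%R) by (specialize (HM O); simpl in HM; unfold A in A0; lra).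
  assert (Q0 : (0 < M / A)%R) by now apply Rdiv_lt_0_compat.
  induction n as [n IH] using lt_wf_ind. destruct n as [|n].
  - unfold recip_coef; simpl. rewrite Cmod_inv by auto. fold A. lra.
  - rewrite recip_coef_S, Cmod_mult, Cmod_opp, Cmod_inv by auto. fold A.
    apply Rmult_le_compat_l; [apply Rlt_le, Rinv_0_lt_compat; auto|].
    eapply Rle_trans; [apply (csum_le_geom _ (rho ^ (S n)) (1 + M / A))|].
    + intros k Hk. rewrite Cmod_mult.
      apply Rle_trans with ((M * rho ^ (S n - k)) * (/ A * (rho * (1 + M / A)) ^ k))%R.
      * apply Rmult_le_compat; try apply Cmod_ge_0; [apply HM|apply IH; lia].
      * rewrite Rpow_mult_distr. replace (S n) with ((S n - k) + k)%nat at 2 by lia.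
        rewrite pow_add. apply Req_le. unfold Rdiv. ring.
    + rewrite Rpow_mult_distr. assert (0 <= rho ^ S n)%R by (apply pow_le; lra). nra.
Qed.

Lemma ps_near_ne0 (f : C -> C) (z : C) (a : nat -> C) :
  ps f z a -> f z <> 0 -> near z (fun w => f w <> 0).
Proof.
  intros P N0. pose proof (ps_val _ _ _ P) as V.
  destruct (ps_tail f z a 1 P) as [K [r [K0 [Hr H]]]].
  assert (A0 : (0 < Cmod (f z))%R) by now apply Cmod_gt_0.
  exists (Rmin r (Cmod (f z) / (K + 1))). split.
  { apply Rmin_glb_lt; auto. apply Rdiv_lt_0_compat; lra. }
  intros y Hy E. specialize (H (y - z) (lt_Rmin_l _ _ _ Hy)). apply lt_Rmin_r in Hy.
  replace (z + (y - z)) with y in H by ring. rewrite E in H. simpl in H.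
  rewrite Cmod_minus_sym, <- V, Rmult_1_r in H. replace (0 + f z * 1 - 0) with (f z) in H by ring.
  pose proof (Cmod_ge_0 (y - z)). apply Rmult_lt_compat_r with (r := (K + 1)%R) in Hy; [|lra].
  replace (Cmod (f z) / (K + 1) * (K + 1))%R with (Cmod (f z)) in Hy by (field; lra). nra.
Qed.

Lemma ps_inv (f : C -> C) (z : C) (a : nat -> C) :
  ps f z a -> f z <> 0 -> ps (fun w => / f w) z (recip_coef a).
Proof.
  intros P N0. pose proof (ps_val _ _ _ P) as V.
  assert (a0 : a O <> 0) by now rewrite <- V.
  destruct (ps_shrink _ _ _ (1/2) ltac:(lra) P) as [M [rho [r [HM0 [Hrho [Hr [Hd [HM H]]]]]]]].
  assert (A0 : (0 < Cmod (a O))%R) by now apply Cmod_gt_0.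
  set (L := (rho * (1 + M / Cmod (a O)))%R).
  assert (L0 : (0 < L)%R).
  { apply Rmult_lt_0_compat; auto. assert (0 <= M / Cmod (a O))%R by (apply Rdiv_le_0_compat; auto). lra. }
  pose proof (recip_coef_bound a M rho a0 Hrho HM) as HB. fold L in HB.
  set (g := fun w => epsilon (inhabits (RtoC 0)) (sums (fun n => recip_coef a n * (w - z) ^ n))).
  assert (P' : ps g z (recip_coef a)).
  { exists (/ Cmod (a O))%R, L, (/ (2 * L))%R. repeat split; auto.
    - apply Rinv_0_lt_compat; lra.
    - intros w Hw. unfold g. replace (z + w - z) with w by ring. apply epsilon_spec.
      destruct (sums_geom (fun n => recip_coef a n * w ^ n) (/ Cmod (a O)) (1/2)) as [l [Hl _]].
      + lra.
      + apply term_bound with L; auto; [apply Rlt_le, Rinv_0_lt_compat; auto|].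
        apply Rmult_lt_compat_l with (r := L) in Hw; auto.
        replace (L * / (2 * L))%R with (1/2)%R in Hw by (field; lra). lra.
      + now exists l. }
  apply (ps_ext g); auto.
  pose proof (ps_mul _ _ _ _ _ P P') as PM.
  destruct PM as [M1 [rho1 [r1 [Hrho1 [Hr1 [HM1 H1]]]]]].
  destruct (near_and _ _ _ (ps_near_ne0 _ _ _ P N0) (near_disk z r1 Hr1)) as [r2 [Hr2 H2]].
  exists r2; split; auto. intros w Hw. destruct (H2 w Hw) as [Fw Dw].
  specialize (H1 (w - z) Dw). replace (z + (w - z)) with w in H1 by ring.
  assert (E : f w * g w = 1).
  { eapply sums_unique; [apply H1|].
    replace (RtoC 1) with (csum (fun n => conv a (recip_coef a) n * (w - z) ^ n) 1).
    - apply sums_finite. intros [|k] Hk; [lia|]. rewrite conv_recip by auto. ring.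
    - cbn [csum]. rewrite conv_recip by auto. simpl; ring. }
  apply (f_equal (fun t => / f w * t)) in E. rewrite Cmult_assoc, Cinv_l in E by auto.
  rewrite Cmult_1_l, Cmult_1_r in E. exact E.
Qed.

(** * Calculus of analytic functions *)

Lemma an_ext (f g : C -> C) (z : C) :
  near z (fun w => f w = g w) -> analytic_at f z -> analytic_at g z.
Proof.
  intros E H. apply analytic_ps in H. destruct H as [a H]. eapply ps_analytic, ps_ext; eauto.
Qed.

Lemma an_const (c z : C) : analytic_at (fun _ => c) z.
Proof. eapply ps_analytic, ps_const. Qed.

Lemma an_id (z : C) : analytic_at (fun w => w) z.
Proof. eapply ps_analytic, ps_id. Qed.

Lemma an_add (f g : C -> C) (z : C) :
  analytic_at f z -> analytic_at g z -> analytic_at (fun w => f w + g w) z.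
Proof.
  intros H K. apply analytic_ps in H, K. destruct H as [a H], K as [b K].
  eapply ps_analytic, ps_add; eauto.
Qed.

Lemma an_mul (f g : C -> C) (z : C) :
  analytic_at f z -> analytic_at g z -> analytic_at (fun w => f w * g w) z.
Proof.
  intros H K. apply analytic_ps in H, K. destruct H as [a H], K as [b K].
  eapply ps_analytic, ps_mul; eauto.
Qed.

Lemma an_opp (f : C -> C) (z : C) : analytic_at f z -> analytic_at (fun w => - f w) z.
Proof.
  intros H. apply (an_ext (fun w => (- (1)) * f w)).
  - apply near_true; intros w; ring.
  - apply an_mul; auto. apply an_const.
Qed.

Lemma an_sub (f g : C -> C) (z : C) :
  analytic_at f z -> analytic_at g z -> analytic_at (fun w => f w - g w) z.
Proof. intros H K; apply an_add; auto. now apply an_opp. Qed.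

Lemma an_inv (f : C -> C) (z : C) :
  analytic_at f z -> f z <> 0 -> analytic_at (fun w => / f w) z.
Proof.
  intros H N. apply analytic_ps in H. destruct H as [a H].
  eapply ps_analytic, ps_inv; eauto.
Qed.

Lemma an_div (f g : C -> C) (z : C) :
  analytic_at f z -> analytic_at g z -> g z <> 0 -> analytic_at (fun w => f w / g w) z.
Proof. intros H K N. apply an_mul; auto. now apply an_inv. Qed.

Lemma an_pow (f : C -> C) (z : C) (n : nat) :
  analytic_at f z -> analytic_at (fun w => f w ^ n) z.
Proof.
  intros H; induction n as [|n IH]; simpl; [apply an_const|now apply an_mul].
Qed.

Lemma an_affine (f : C -> C) (c d z : C) :
  analytic_at f (c * z + d) -> analytic_at (fun w => f (c * w + d)) z.
Proof.
  intros H. apply analytic_ps in H. destruct H as [a H].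
  eapply ps_analytic, ps_affine; eauto.
Qed.

Lemma an_shift (f : C -> C) (d z : C) :
  analytic_at f (z + d) -> analytic_at (fun w => f (w + d)) z.
Proof.
  intros H. apply (an_ext (fun w => f (1 * w + d))).
  - apply near_true; intros w; f_equal; ring.
  - apply an_affine. now replace (1 * z + d) with (z + d) by ring.
Qed.

Lemma an_reflect (f : C -> C) (d z : C) :
  analytic_at f (d - z) -> analytic_at (fun w => f (d - w)) z.
Proof.
  intros H. apply (an_ext (fun w => f (- (1) * w + d))).
  - apply near_true; intros w; f_equal; ring.
  - apply an_affine. now replace (- (1) * z + d) with (d - z) by ring.
Qed.

Lemma an_D (f : C -> C) (z : C) : analytic_at f z -> analytic_at (C_derive f) z.
Proof.
  intros H. apply analytic_ps in H. destruct H as [a H].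
  eapply ps_analytic, ps_derived; eauto.
Qed.

Lemma an_near (f : C -> C) (z : C) : analytic_at f z -> near z (fun w => analytic_at f w).
Proof.
  intros H. apply analytic_ps in H. destruct H as [a H].
  destruct (ps_recenter _ _ _ H) as [r [Hr K]]. exists r; split; auto.
  intros w Hw. destruct (K (w - z) Hw) as [b [Hb _]].
  replace (z + (w - z)) with w in Hb by ring. eapply ps_analytic; eauto.
Qed.

Lemma an_is_derive (f : C -> C) (z : C) : analytic_at f z ->
  is_derive (K := C_AbsRing) (V := C_NormedModule) f z (C_derive f z).
Proof.
  intros H. apply analytic_ps in H. destruct H as [a H].
  rewrite (ps_C_derive _ _ _ H). now apply ps_deriv.
Qed.

Lemma an_cont (f : C -> C) (z : C) (eps : R) :
  analytic_at f z -> (0 < eps)%R -> near z (fun w => (Cmod (f w - f z) < eps)%R).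
Proof.
  intros H He. apply an_is_derive in H.
  assert (K : ex_derive (K := C_AbsRing) (V := C_NormedModule) f z) by (eexists; eauto).
  apply ex_derive_continuous in K.
  apply (filterlim_locally_ball_norm (U := C_NormedModule)) with (eps := mkposreal eps He) in K.
  destruct K as [d K]. exists d; split; [apply cond_pos|]. intros w Hw.
  apply K. exact Hw.
Qed.

(** A function [fun x => c * x] must not be reduced to the partial application of
    [Cmult]: the tactics below recognise sums and products by their syntax. *)
Ltac eta_reduce f :=
  lazymatch f with
  | fun x => ?c + x => f
  | fun x => ?c - x => f
  | fun x => ?c * x => f
  | fun x => - x => f
  | fun x => ?h x => h
  | _ => f
  end.

Create HintDb analytic.

Ltac an :=
  match goal with
  | H : ?P |- ?P => exact H
  | |- analytic_at (fun _ => ?c) _ => apply an_const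
  | |- analytic_at (fun z => z) _ => apply an_id
  | |- analytic_at (fun z => @?f z + @?g z) ?w =>
      let f := eta_reduce f in let g := eta_reduce g in apply (an_add f g w); an
  | |- analytic_at (fun z => @?f z - @?g z) ?w =>
      let f := eta_reduce f in let g := eta_reduce g in apply (an_sub f g w); an
  | |- analytic_at (fun z => @?f z * @?g z) ?w =>
      let f := eta_reduce f in let g := eta_reduce g in apply (an_mul f g w); an
  | |- analytic_at (fun z => - @?f z) ?w => let f := eta_reduce f in apply (an_opp f w); an
  | |- analytic_at (fun z => @?f z ^ ?n) ?w => let f := eta_reduce f in apply (an_pow f w); an
  | |- analytic_at (fun z => ?f (z + ?c)) ?w => apply (an_shift f c w); an
  | |- analytic_at (fun z => ?f (?c - z)) ?w => apply (an_reflect f c w); an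
  | |- analytic_at (C_derive ?f) ?w => apply (an_D f w); an
  | |- analytic_at _ _ => solve [auto with analytic]
  end.

Lemma D_ext (f g : C -> C) (z : C) :
  near z (fun w => f w = g w) -> analytic_at f z -> C_derive g z = C_derive f z.
Proof.
  intros E H. apply analytic_ps in H. destruct H as [a H].
  rewrite (ps_C_derive _ _ _ H). eapply ps_C_derive, ps_ext; eauto.
Qed.

Lemma D_const (c z : C) : C_derive (fun _ => c) z = 0.
Proof. exact (ps_C_derive _ _ _ (ps_const c z)). Qed.

Lemma D_id (z : C) : C_derive (fun w => w) z = 1.
Proof. exact (ps_C_derive _ _ _ (ps_id z)). Qed.

Lemma D_add (f g : C -> C) (z : C) : analytic_at f z -> analytic_at g z ->
  C_derive (fun w => f w + g w) z = C_derive f z + C_derive g z.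
Proof.
  intros H K. apply analytic_ps in H, K. destruct H as [a H], K as [b K].
  rewrite (ps_C_derive _ _ _ H), (ps_C_derive _ _ _ K).
  exact (ps_C_derive _ _ _ (ps_add _ _ _ _ _ H K)).
Qed.

Lemma D_mul (f g : C -> C) (z : C) : analytic_at f z -> analytic_at g z ->
  C_derive (fun w => f w * g w) z = C_derive f z * g z + f z * C_derive g z.
Proof.
  intros H K. apply analytic_ps in H, K. destruct H as [a H], K as [b K].
  rewrite (ps_C_derive _ _ _ H), (ps_C_derive _ _ _ K), (ps_val _ _ _ H), (ps_val _ _ _ K).
  rewrite (ps_C_derive _ _ _ (ps_mul _ _ _ _ _ H K)). unfold conv. simpl. ring.
Qed.

Lemma D_affine (f : C -> C) (c d z : C) : analytic_at f (c * z + d) ->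
  C_derive (fun w => f (c * w + d)) z = c * C_derive f (c * z + d).
Proof.
  intros H. apply analytic_ps in H. destruct H as [a H].
  rewrite (ps_C_derive _ _ _ H), (ps_C_derive _ _ _ (ps_affine _ _ _ _ _ H)). simpl; ring.
Qed.

Lemma D_shift (f : C -> C) (d z : C) : analytic_at f (z + d) ->
  C_derive (fun w => f (w + d)) z = C_derive f (z + d).
Proof.
  intros H. assert (H' : analytic_at f (1 * z + d)) by now replace (1 * z + d) with (z + d) by ring.
  rewrite (D_ext (fun w => f (1 * w + d))).
  - rewrite D_affine by auto. replace (1 * z + d) with (z + d) by ring. ring.
  - apply near_true; intros w; f_equal; ring.
  - now apply an_affine.
Qed.

Lemma D_reflect (f : C -> C) (d z : C) : analytic_at f (d - z) ->
  C_derive (fun w => f (d - w)) z = - C_derive f (d - z).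
Proof.
  intros H. assert (H' : analytic_at f (- (1) * z + d)) by now replace (- (1) * z + d) with (d - z) by ring.
  rewrite (D_ext (fun w => f (- (1) * w + d))).
  - rewrite D_affine by auto. replace (- (1) * z + d) with (d - z) by ring. ring.
  - apply near_true; intros w; f_equal; ring.
  - now apply an_affine.
Qed.

Lemma D_scal (c : C) (f : C -> C) (z : C) : analytic_at f z ->
  C_derive (fun w => c * f w) z = c * C_derive f z.
Proof. intros H. rewrite D_mul by (auto; apply an_const). rewrite D_const. ring. Qed.

Lemma D_opp (f : C -> C) (z : C) : analytic_at f z ->
  C_derive (fun w => - f w) z = - C_derive f z.
Proof.
  intros H. rewrite (D_ext (fun w => - (1) * f w)).
  - rewrite D_scal by auto. ring.
  - apply near_true; intros; ring.
  - apply an_mul; auto; apply an_const.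
Qed.

Lemma D_sub (f g : C -> C) (z : C) : analytic_at f z -> analytic_at g z ->
  C_derive (fun w => f w - g w) z = C_derive f z - C_derive g z.
Proof.
  intros H K. unfold Cminus. rewrite (D_add f (fun w => - g w)); auto.
  - now rewrite D_opp.
  - now apply an_opp.
Qed.

Ltac D_expand :=
  repeat match goal with
  | |- context [C_derive (fun _ => ?c) ?w] => rewrite (D_const c w)
  | |- context [C_derive (fun z => z) ?w] => rewrite (D_id w)
  | |- context [C_derive (fun z => @?f z + @?g z) ?w] =>
      let f := eta_reduce f in let g := eta_reduce g in rewrite (D_add f g w) by an
  | |- context [C_derive (fun z => @?f z - @?g z) ?w] =>
      let f := eta_reduce f in let g := eta_reduce g in rewrite (D_sub f g w) by an
  | |- context [C_derive (fun z => @?f z * @?g z) ?w] =>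
      let f := eta_reduce f in let g := eta_reduce g in rewrite (D_mul f g w) by an
  | |- context [C_derive (fun z => ?f (z + ?c)) ?w] => rewrite (D_shift f c w) by an
  | |- context [C_derive (fun z => ?f (?c - z)) ?w] => rewrite (D_reflect f c w) by an
  end.

Lemma an_dquot (f : C -> C) (z w : C) :
  analytic_at f z -> analytic_at f w -> analytic_at (dquot f z) w.
Proof.
  intros Hz Hw. destruct (Ceq_dec w z) as [->|N].
  - apply analytic_ps in Hz. destruct Hz as [a H]. eapply ps_analytic, ps_dquot; eauto.
  - assert (N' : w - z <> 0) by (intros E; apply N; replace w with (w - z + z) by ring; rewrite E; ring).
    apply (an_ext (fun v => (f v - f z) / (v - z))).
    + exists (Cmod (w - z)). split; [now apply Cmod_gt_0|]. intros v Hv.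
      unfold dquot. destruct (Ceq_dec v z) as [->|]; auto.
      rewrite Cmod_minus_sym in Hv. lra.
    + apply an_div; auto.
      * apply an_sub; auto. apply an_const.
      * apply an_sub; [apply an_id|apply an_const].
Qed.

Lemma dquot_mul (f : C -> C) (z w : C) : f w - f z = (w - z) * dquot f z w.
Proof.
  unfold dquot. destruct (Ceq_dec w z) as [->|N]; [ring|].
  field. intros E; apply N; replace w with (w - z + z) by ring; rewrite E; ring.
Qed.

(** * Zeros *)

Lemma csum_zero_series (a : nat -> C) (w : C) : (forall n, a n = 0) -> sums (fun n => a n * w ^ n) 0.
Proof.
  intros H. replace (RtoC 0) with (csum (fun n => a n * w ^ n) 0) by reflexivity.
  apply sums_finite. intros k _. rewrite H; ring.
Qed.

Lemma ps_factor (k : nat) : forall (f : C -> C) (z : C) (a : nat -> C),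
  ps f z a -> (forall n, (n < k)%nat -> a n = 0) -> a k <> 0 ->
  exists g, analytic_at g z /\ g z <> 0 /\ forall w, f w = (w - z) ^ k * g w.
Proof.
  induction k as [|k IH]; intros f z a P Z N.
  - exists f. repeat split.
    + eapply ps_analytic; eauto.
    + now rewrite (ps_val _ _ _ P).
    + intros w; simpl; ring.
  - destruct (IH _ _ _ (ps_dquot _ _ _ P)) as [g [Hg [Ng E]]]; auto.
    { intros n Hn; apply Z; lia. }
    exists g. repeat split; auto. intros w.
    pose proof (dquot_mul f z w) as Q. rewrite (ps_val _ _ _ P), (Z O) in Q by lia.
    rewrite E in Q. replace (f w) with (f w - 0) by ring. rewrite Q. simpl. ring.
Qed.

(** Either all the coefficients vanish or the first nonzero one gives the order of
    the zero. *)
Lemma an_zero_or_factor (f : C -> C) (z : C) : analytic_at f z ->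
  near z (fun w => f w = 0) \/
  exists (k : nat) (g : C -> C), analytic_at g z /\ g z <> 0 /\ forall w, f w = (w - z) ^ k * g w.
Proof.
  intros H. apply analytic_ps in H. destruct H as [a P].
  destruct (classic (forall n, a n = 0)) as [Z|N].
  - left. destruct P as [M [rho [r [_ [Hr [_ H]]]]]]. exists r; split; auto.
    intros w Hw. specialize (H (w - z) Hw). replace (z + (w - z)) with w in H by ring.
    eapply sums_unique; [apply H|]. now apply csum_zero_series.
  - right. apply not_all_ex_not in N.
    destruct (dec_inh_nat_subset_has_unique_least_element (fun n => a n <> 0)) as [k [[Hk Hmin] _]]; auto.
    { intros n. apply classic. }
    exists k. eapply ps_factor; eauto. intros n Hn. apply NNPP. intros C1.
    specialize (Hmin n C1). lia.
Qed.

Lemma an_ne0 (f : C -> C) (z : C) : analytic_at f z -> f z <> 0 -> near z (fun w => f w <> 0).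
Proof.
  intros H N. apply analytic_ps in H. destruct H as [a P]. eapply ps_near_ne0; eauto.
Qed.

Lemma Csub_ne0 (w z : C) : w <> z -> w - z <> 0.
Proof. intros N E; apply N; replace w with (w - z + z) by ring; rewrite E; ring. Qed.

Lemma an_dichotomy (f : C -> C) (z : C) : analytic_at f z ->
  near z (fun w => f w = 0) \/ near z (fun w => w <> z -> f w <> 0).
Proof.
  intros H. destruct (an_zero_or_factor f z H) as [Z|[k [g [Hg [Ng E]]]]]; [now left|right].
  eapply near_imp; [|apply (an_ne0 g z Hg Ng)]. intros w Gw Nw. rewrite E.
  apply Cmult_neq_0; auto. apply Cpow_nz. now apply Csub_ne0.
Qed.

Lemma an_zero_accum (f : C -> C) (z : C) : analytic_at f z ->
  (forall eps, (0 < eps)%R -> exists w, w <> z /\ (Cmod (w - z) < eps)%R /\ f w = 0) ->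
  near z (fun w => f w = 0).
Proof.
  intros H A. destruct (an_dichotomy f z H) as [Z|[r [Hr N]]]; auto.
  destruct (A r Hr) as [w [W1 [W2 W3]]]. exfalso; now apply (N w W2 W1).
Qed.

Lemma near_punctured (z : C) (P : C -> Prop) : near z P -> exists w, w <> z /\ P w.
Proof.
  intros [r [Hr H]]. exists (z + RtoC (r / 2)). split.
  - intros E. assert (E' : RtoC (r / 2) = 0) by (replace (RtoC (r/2)) with (z + RtoC (r / 2) - z) by ring; rewrite E; ring).
    injection E'; lra.
  - apply H. replace (z + RtoC (r / 2) - z) with (RtoC (r / 2)) by ring.
    rewrite Cmod_R, Rabs_pos_eq; lra.
Qed.

Lemma an_mul_zero (f g : C -> C) (z : C) : analytic_at f z -> analytic_at g z ->
  near z (fun w => f w * g w = 0) -> near z (fun w => f w = 0) \/ near z (fun w => g w = 0).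
Proof.
  intros Hf Hg Z. destruct (an_dichotomy f z Hf) as [|Nf]; [now left|].
  destruct (an_dichotomy g z Hg) as [|Ng]; [now right|].
  destruct (near_punctured _ _ (near_and _ _ _ Z (near_and _ _ _ Nf Ng))) as [w [W [Zw [Fw Gw]]]].
  exfalso. apply (Cmult_neq_0 _ _ (Fw W) (Gw W)). exact Zw.
Qed.

(** * Continuation of identities *)

(** Connectedness of [[0, 1]], for locally constant properties. *)
Lemma interval_connected (P : R -> Prop) :
  P 0%R ->
  (forall t, (0 <= t <= 1)%R -> exists eps, (0 < eps)%R /\
     forall s, (0 <= s <= 1)%R -> (Rabs (s - t) < eps)%R -> (P s <-> P t)) ->
  forall t, (0 <= t <= 1)%R -> P t.
Proof.
  intros P0 L.
  set (E := fun t => (0 <= t <= 1)%R /\ forall s, (0 <= s <= t)%R -> P s).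
  assert (E0 : E 0%R).
  { split; [lra|]. intros s Hs. now replace s with 0%R by lra. }
  destruct (completeness E) as [m [Hub Hl]].
  { exists 1%R. intros t [Ht _]; lra. }
  { now exists 0%R. }
  assert (Hm : (0 <= m <= 1)%R).
  { split; [now apply Hub|]. apply Hl. intros t [Ht _]; lra. }
  destruct (L m Hm) as [eps [He Hloc]].
  assert (X : exists t, E t /\ (m - eps < t)%R).
  { apply NNPP; intros N. assert (m <= m - eps)%R; [|lra]. apply Hl. intros t Ht.
    apply Rnot_lt_le; intros C1. apply N; eauto. }
  destruct X as [t0 [[Ht0 Pt0] Hlt]].
  assert (t0 <= m)%R by (apply Hub; split; auto).
  assert (Pm : P m).
  { apply (Hloc t0); [lra| |apply Pt0; lra]. rewrite Rabs_left1; lra. }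
  assert (All : forall s, (0 <= s <= 1)%R -> (s < m + eps)%R -> P s).
  { intros s Hs Hsm. destruct (Rle_dec s t0); [apply Pt0; lra|].
    apply (Hloc s Hs); auto. apply Rabs_def1; lra. }
  assert (M1 : m = 1%R).
  { destruct (Rlt_dec m 1); [|lra]. exfalso.
    set (t1 := Rmin 1 (m + eps / 2)).
    assert (t1 <= 1)%R by apply Rmin_l. assert (t1 <= m + eps / 2)%R by apply Rmin_r.
    assert (m < t1)%R by (apply Rmin_glb_lt; lra).
    assert (t1 <= m)%R; [|lra]. apply Hub. split; [lra|]. intros s Hs. apply All; lra. }
  intros t Ht. apply All; lra.
Qed.

(** The germs [E t] may change along the path, as they do for a branch of a
    multivalued function. *)
Lemma identity_along (gamma : R -> C) (E : R -> C -> C) :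
  (forall t, (0 <= t <= 1)%R -> forall eps, (0 < eps)%R -> exists d, (0 < d)%R /\
     forall s, (0 <= s <= 1)%R -> (Rabs (s - t) < d)%R -> (Cmod (gamma s - gamma t) < eps)%R) ->
  (forall t, (0 <= t <= 1)%R -> analytic_at (E t) (gamma t)) ->
  (forall t, (0 <= t <= 1)%R -> exists eps, (0 < eps)%R /\
     forall s, (0 <= s <= 1)%R -> (Rabs (s - t) < eps)%R -> near (gamma s) (fun z => E s z = E t z)) ->
  near (gamma 0%R) (fun z => E 0%R z = 0) ->
  forall t, (0 <= t <= 1)%R -> near (gamma t) (fun z => E t z = 0).
Proof.
  intros Cg An Co Z0. apply interval_connected; auto.
  intros t Ht. destruct (Co t Ht) as [e1 [He1 H1]].
  assert (K : exists r, (0 < r)%R /\ forall z, (Cmod (z - gamma t) < r)%R ->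
     (near z (fun z => E t z = 0) <-> near (gamma t) (fun z => E t z = 0))).
  { destruct (an_dichotomy _ _ (An t Ht)) as [Z|N].
    - destruct (near_near _ _ Z) as [r [Hr H]]. exists r; split; auto.
      intros z Hz; split; auto.
    - destruct (near_near _ _ N) as [r [Hr H]]. exists r; split; auto.
      intros z Hz; split; intros Z; exfalso.
      + destruct (Ceq_dec z (gamma t)) as [E0|D].
        * rewrite E0 in Z. destruct (near_punctured _ _ (near_and _ _ _ Z N)) as [w [W [A B]]].
          exact (B W A).
        * exact (near_self _ _ (H z Hz) D (near_self _ _ Z)).
      + destruct (near_punctured _ _ (near_and _ _ _ Z N)) as [w [W [A B]]]. exact (B W A). }
  destruct K as [r [Hr K]]. destruct (Cg t Ht r Hr) as [d [Hd Hg]].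
  exists (Rmin e1 d). split; [now apply Rmin_glb_lt|]. intros s Hs Hst.
  specialize (H1 s Hs (lt_Rmin_l _ _ _ Hst)). specialize (Hg s Hs (lt_Rmin_r _ _ _ Hst)).
  rewrite <- (K _ Hg). split; intros Z; eapply near_imp; try apply (near_and _ _ _ Z H1);
    intros w [A B]; cbn beta in *; congruence.
Qed.

Definition convex (D : C -> Prop) : Prop :=
  forall x y (t : R), D x -> D y -> (0 <= t <= 1)%R -> D (x + t * (y - x)).

(** The identity theorem, along the segment from [z] to [w]. *)
Lemma identity_convex (D : C -> Prop) (f : C -> C) (z w : C) :
  convex D -> analytic_on D f -> D z -> near z (fun v => f v = 0) -> D w ->
  near w (fun v => f v = 0).
Proof.
  intros Cv An Dz Z Dw.
  pose proof (identity_along (fun t => z + RtoC t * (w - z)) (fun _ => f)) as H.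
  replace w with (z + 1%R * (w - z)) by ring. apply H; try lra.
  - intros t Ht eps He. pose proof (Cmod_ge_0 (w - z)).
    exists (eps / (Cmod (w - z) + 1))%R. split; [apply Rdiv_lt_0_compat; lra|].
    intros s Hs Hst. replace (z + s * (w - z) - (z + t * (w - z))) with (RtoC (s - t) * (w - z))
      by (rewrite RtoC_minus; ring).
    rewrite Cmod_mult, Cmod_R.
    apply Rle_lt_trans with (Rabs (s - t) * (Cmod (w - z) + 1))%R.
    + apply Rmult_le_compat_l; [apply Rabs_pos|lra].
    + apply Rmult_lt_compat_r with (r := (Cmod (w - z) + 1)%R) in Hst; [|lra].
      replace (eps / (Cmod (w - z) + 1) * (Cmod (w - z) + 1))%R with eps in Hst by (field; lra). auto.
  - intros t Ht. apply An, Cv; auto.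
  - intros t _. exists 1%R; split; [lra|]. intros. now apply near_true.
  - replace (z + 0%R * (w - z)) with z by ring. auto.
Qed.

(** * Maximum principle *)

Definition cis (x : R) : C := (cos x, sin x).

Lemma cis_add (x y : R) : cis (x + y) = cis x * cis y.
Proof. unfold cis, Cmult; simpl. rewrite cos_plus, sin_plus. f_equal; ring. Qed.

Lemma cis_0 : cis 0 = 1.
Proof. unfold cis. now rewrite cos_0, sin_0. Qed.

Lemma cis_pow (x : R) (n : nat) : cis x ^ n = cis (INR n * x).
Proof.
  induction n as [|n IH].
  - simpl. now rewrite Rmult_0_l, cis_0.
  - rewrite Cpow_S, IH, <- cis_add, S_INR. f_equal; ring.
Qed.

Lemma Cmod_cis (x : R) : Cmod (cis x) = 1%R.
Proof.
  unfold Cmod, cis. cbn [fst snd]. replace (cos x ^ 2 + sin x ^ 2)%R with 1%R; [apply sqrt_1|].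
  pose proof (sin2_cos2 x) as H; unfold Rsqr in H. lra.
Qed.

(** Three equidistributed directions have sum zero, so a nonzero number makes an
    acute angle with one of them. *)
Lemma acute_direction (b : C) : b <> 0 ->
  exists x : R, (x = - PI \/ x = - PI / 3 \/ x = PI / 3)%R /\ (0 < Re (b * cis (- x)))%R.
Proof.
  intros Hb. destruct b as [b1 b2].
  assert (S3 : (0 < sqrt 3)%R) by (apply sqrt_lt_R0; lra).
  destruct (Rlt_dec 0 (- b1)) as [H|H].
  - exists (- PI)%R; split; auto. unfold cis, Re, Cmult; simpl.
    rewrite Ropp_involutive, cos_PI, sin_PI. lra.
  - destruct (Rle_dec 0 b2) as [H2|H2].
    + exists (PI / 3)%R; split; auto. unfold cis, Re, Cmult; simpl.
      rewrite cos_neg, sin_neg, cos_PI3, sin_PI3.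
      assert (b1 <> 0 \/ b2 <> 0)%R.
      { destruct (Req_dec b1 0); destruct (Req_dec b2 0); auto. exfalso; apply Hb; subst; reflexivity. }
      assert (0 <= b2 * (sqrt 3 / 2))%R by (apply Rmult_le_pos; lra).
      destruct (Rlt_dec 0 b1); [lra|].
      assert (0 < b2 * (sqrt 3 / 2))%R by (apply Rmult_lt_0_compat; lra). lra.
    + exists (- PI / 3)%R; split; auto. unfold cis, Re, Cmult; simpl.
      replace (- (- PI / 3))%R with (PI / 3)%R by field. rewrite cos_PI3, sin_PI3.
      assert (0 < - b2 * (sqrt 3 / 2))%R by (apply Rmult_lt_0_compat; lra). lra.
Qed.

Lemma Re_mult_conj_expand (c d : C) :
  (Cmod (c + d) ^ 2 = Cmod c ^ 2 + 2 * Re (Cconj c * d) + Cmod d ^ 2)%R.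
Proof. rewrite !Cmod2_alt. destruct c, d; unfold Re, Im, Cconj, Cmult, Cplus; simpl. ring. Qed.

Lemma Re_scal (t : R) (z : C) : Re (RtoC t * z) = (t * Re z)%R.
Proof. destruct z; unfold Re, Cmult, RtoC; simpl; ring. Qed.

(** If [f w = f z + (w - z) ^ k * g w] with [g z <> 0], some direction makes the
    second term point along [f z] and increases the modulus. *)
Lemma maximum_principle (f : C -> C) (z : C) : analytic_at f z ->
  near z (fun w => (Cmod (f w) <= Cmod (f z))%R) -> near z (fun w => f w = f z).
Proof.
  intros H Hmax.
  destruct (an_zero_or_factor (fun w => f w - f z) z) as [Z|[k [g [Hg [Ng E]]]]].
  { apply an_sub; auto. apply an_const. }
  { eapply near_imp; [|apply Z]. intros w Hw. replace (f w) with (f w - f z + f z) by ring.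
    cbn beta in Hw. rewrite Hw; ring. }
  destruct (Ceq_dec (f z) 0) as [F0|F0].
  { eapply near_imp; [|apply Hmax]. intros w Hw. rewrite F0 in *. rewrite Cmod_0 in Hw.
    apply Cmod_eq_0. pose proof (Cmod_ge_0 (f w)); lra. }
  exfalso.
  assert (K0 : k <> O).
  { intros ->. apply Ng. specialize (E z). simpl in E.
    replace (g z) with (1 * g z) by ring. rewrite <- E; ring. }
  assert (B0 : Cconj (f z) * g z <> 0).
  { apply Cmult_neq_0; auto. intros C0. apply F0. apply Cmod_eq_0. rewrite <- Cmod_conj, C0. apply Cmod_0. }
  destruct (acute_direction _ B0) as [x [_ Hx]].
  set (om := cis (- x / INR k)).
  assert (Om : om ^ k = cis (- x)).
  { unfold om. rewrite cis_pow. f_equal. field. apply not_0_INR; auto. }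
  set (h := fun w => Cconj (f z) * om ^ k * g w).
  assert (Hh : analytic_at h z) by (apply an_mul; auto; apply an_const).
  assert (Hz : (0 < Re (h z))%R).
  { unfold h. rewrite Om. replace (Cconj (f z) * cis (- x) * g z) with (Cconj (f z) * g z * cis (- x)) by ring. auto. }
  pose proof (an_cont h z _ Hh Hz) as Cont.
  destruct (near_and _ _ _ Hmax Cont) as [r [Hr N]].
  set (t := (r / 2)%R). set (w := z + RtoC t * om).
  assert (D : (Cmod (w - z) < r)%R).
  { unfold w. replace (z + RtoC t * om - z) with (RtoC t * om) by ring.
    rewrite Cmod_mult, Cmod_R. unfold om. rewrite Cmod_cis, Rabs_pos_eq; unfold t; lra. }
  destruct (N w D) as [N1 N2].
  assert (Hpos : (0 < Re (h w))%R).
  { pose proof (re_le_Cmod (h w - h z)) as Q.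
    assert (Q' : (Rabs (Re (h w) - Re (h z)) <= Cmod (h w - h z))%R).
    { eapply Rle_trans; [|exact Q]. apply Req_le. f_equal. }
    assert (Q2 : (Rabs (Re (h w) - Re (h z)) < Re (h z))%R) by lra. apply Rabs_def2 in Q2. lra. }
  specialize (E w). replace (w - z) with (RtoC t * om) in E by (unfold w; ring).
  assert (Fw : f w = f z + (RtoC t * om) ^ k * g w) by (rewrite <- E; ring).
  pose proof (Re_mult_conj_expand (f z) ((RtoC t * om) ^ k * g w)) as X. rewrite <- Fw in X.
  replace (Cconj (f z) * ((RtoC t * om) ^ k * g w)) with (RtoC (t ^ k) * h w) in X.
  2:{ unfold h. rewrite Cpow_mult_l, RtoC_pow. ring. }
  rewrite Re_scal in X.
  assert (0 < t ^ k)%R by (apply pow_lt; unfold t; lra).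
  assert (0 < t ^ k * Re (h w))%R by (apply Rmult_lt_0_compat; auto).
  pose proof (pow2_ge_0 (Cmod ((RtoC t * om) ^ k * g w))).
  assert (Cmod (f w) ^ 2 <= Cmod (f z) ^ 2)%R by (apply pow_incr; split; [apply Cmod_ge_0|auto]).
  lra.
Qed.

Definition rect (a b c d : R) (z : C) : Prop := (a <= Re z <= b /\ c <= Im z <= d)%R.

Lemma rect_convex (a b c d : R) : convex (rect a b c d).
Proof.
  intros x y t [Hx1 Hx2] [Hy1 Hy2] Ht. destruct x as [x1 x2], y as [y1 y2].
  unfold rect, Re, Im in *; simpl in *. split; nra.
Qed.

Lemma near_box (z : C) (P : C -> Prop) : near z P ->
  exists d : posreal, forall w, (Rabs (Re w - Re z) < d)%R -> (Rabs (Im w - Im z) < d)%R -> P w.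
Proof.
  intros [r [Hr H]]. assert (Hr2 : (0 < r / 2)%R) by lra.
  exists (mkposreal _ Hr2). intros w H1 H2. apply H.
  eapply Rle_lt_trans; [apply Cmod_le_Re_Im|].
  replace (Re (w - z)) with (Re w - Re z)%R by reflexivity.
  replace (Im (w - z)) with (Im w - Im z)%R by reflexivity. simpl in *. lra.
Qed.

(** The gauge is at most [1 / (|phi| + 1)] at each point, so the uniform lower bound
    [e] which compactness provides for the gauge bounds [phi] as well. *)
Lemma rect_bounded (a b c d : R) (phi : C -> R) :
  (forall z, rect a b c d z -> forall eps, (0 < eps)%R -> near z (fun w => (Rabs (phi w - phi z) < eps)%R)) ->
  exists B, forall z, rect a b c d z -> (phi z <= B)%R.
Proof.
  intros Cont.
  assert (X : forall u v : R, exists del : posreal, rect a b c d (u, v) ->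
    (del <= / (Rabs (phi (u, v)) + 1) /\
     forall w : C, Rabs (Re w - u) < del -> Rabs (Im w - v) < del -> phi w < phi (u, v) + 1)%R).
  { intros u v. destruct (classic (rect a b c d (u, v))) as [Ruv|N].
    - destruct (near_box _ _ (Cont _ Ruv 1%R Rlt_0_1)) as [e He].
      pose proof (Rabs_pos (phi (u, v))).
      assert (Hm : (0 < Rmin e (/ (Rabs (phi (u, v)) + 1)))%R).
      { apply Rmin_glb_lt; [apply cond_pos|apply Rinv_0_lt_compat; lra]. }
      exists (mkposreal _ Hm). intros _; split; [apply Rmin_r|].
      intros w W1 W2. simpl in W1, W2.
      specialize (He w (lt_Rmin_l _ _ _ W1) (lt_Rmin_l _ _ _ W2)). apply Rabs_def2 in He. lra.
    - exists (mkposreal 1 Rlt_0_1). intros R1; now exfalso. }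
  set (del := fun u v => proj1_sig (constructive_indefinite_description _ (X u v))).
  assert (Hdel : forall u v, rect a b c d (u, v) -> (del u v <= / (Rabs (phi (u, v)) + 1) /\
     forall w : C, Rabs (Re w - u) < del u v -> Rabs (Im w - v) < del u v -> phi w < phi (u, v) + 1)%R).
  { intros u v. unfold del. exact (proj2_sig (constructive_indefinite_description _ (X u v))). }
  destruct (compactness_value_2d a b c d del) as [e He].
  exists (/ e)%R. intros [x y] [Hx Hy]. apply Rnot_lt_le; intros Hlt.
  apply (He x y Hx Hy). intros [u [v [Hu [Hv [D1 [D2 D3]]]]]].
  destruct (Hdel u v (conj Hu Hv)) as [K1 K2]. specialize (K2 (x, y) D1 D2).
  assert (He0 := cond_pos e).
  pose proof (Rabs_pos (phi (u, v))). pose proof (Rle_abs (phi (u, v))).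
  assert (K3 : (Rabs (phi (u, v)) + 1 <= / e)%R).
  { rewrite <- (Rinv_inv (Rabs (phi (u, v)) + 1)). apply Rinv_le_contravar; lra. }
  lra.
Qed.

(** If the supremum [M] were not attained, the continuous function
    [1 / (M - phi)] would be unbounded. *)
Lemma rect_max (a b c d : R) (phi : C -> R) : (a <= b)%R -> (c <= d)%R ->
  (forall z, rect a b c d z -> forall eps, (0 < eps)%R -> near z (fun w => (Rabs (phi w - phi z) < eps)%R)) ->
  exists m, rect a b c d m /\ forall z, rect a b c d z -> (phi z <= phi m)%R.
Proof.
  intros Hab Hcd Cont. destruct (rect_bounded _ _ _ _ _ Cont) as [B HB].
  set (E := fun y => exists z, rect a b c d z /\ y = phi z).
  destruct (completeness E) as [M [Hub Hl]].
  { exists B. intros y [z [Hz ->]]; auto. }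
  { exists (phi (a, c)), (a, c). split; auto. unfold rect, Re, Im; simpl; lra. }
  apply NNPP; intros N.
  assert (Lt : forall z, rect a b c d z -> (phi z < M)%R).
  { intros z Hz. assert (phi z <= M)%R by (apply Hub; exists z; auto).
    destruct (Req_dec (phi z) M) as [Em|]; [|lra]. exfalso; apply N.
    exists z; split; auto. intros w Hw. rewrite Em. apply Hub; exists w; auto. }
  destruct (rect_bounded a b c d (fun z => / (M - phi z))%R) as [B' HB'].
  { intros z Hz eps He. specialize (Lt z Hz). set (g := (M - phi z)%R).
    assert (Hg : (0 < g)%R) by (unfold g; lra).
    set (e := Rmin (g / 2) (eps * (g * g) / 2)).
    assert (He' : (0 < e)%R).
    { apply Rmin_glb_lt; [lra|]. assert (0 < g * g)%R by (apply Rmult_lt_0_compat; auto).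
      assert (0 < eps * (g * g))%R by (apply Rmult_lt_0_compat; auto). lra. }
    eapply near_imp; [|apply (Cont z Hz e He')]. intros w Hw.
    pose proof (lt_Rmin_l _ _ _ Hw) as W1; pose proof (lt_Rmin_r _ _ _ Hw) as W2.
    cbn beta. fold g. set (h := (M - phi w)%R). replace (phi w - phi z)%R with (g - h)%R in * by (unfold g, h; ring).
    assert (Hh : (g / 2 < h)%R) by (apply Rabs_def2 in W1; lra).
    replace (/ h - / g)%R with ((g - h) * (/ (h * g)))%R by (field; lra).
    rewrite Rabs_mult, (Rabs_pos_eq (/ (h * g))).
    2:{ apply Rlt_le, Rinv_0_lt_compat, Rmult_lt_0_compat; lra. }
    apply Rmult_lt_reg_r with (h * g)%R; [apply Rmult_lt_0_compat; lra|].
    rewrite Rmult_assoc, Rinv_l by (apply Rgt_not_eq, Rmult_lt_0_compat; lra).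
    rewrite Rmult_1_r. eapply Rlt_le_trans; [apply W2|].
    replace (eps * (g * g) / 2)%R with (eps * (g / 2 * g))%R by field.
    apply Rmult_le_compat_l; [lra|]. apply Rmult_le_compat_r; lra. }
  assert (Bp : (0 < B')%R).
  { assert (R0 : rect a b c d (a, c)) by (unfold rect, Re, Im; simpl; lra).
    eapply Rlt_le_trans; [|apply (HB' _ R0)]. apply Rinv_0_lt_compat. specialize (Lt _ R0); lra. }
  assert (M <= M - / B')%R.
  { apply Hl. intros y [z [Hz ->]]. specialize (HB' z Hz). cbn beta in HB'. specialize (Lt z Hz).
    assert (/ B' <= M - phi z)%R; [|lra].
    rewrite <- (Rinv_inv (M - phi z)). apply Rinv_le_contravar; auto.
    apply Rinv_0_lt_compat; lra. }
  assert (0 < / B')%R by now apply Rinv_0_lt_compat. lra.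
Qed.

Lemma an_Cmod_cont (f : C -> C) (z : C) (eps : R) : analytic_at f z -> (0 < eps)%R ->
  near z (fun w => (Rabs (Cmod (f w) - Cmod (f z)) < eps)%R).
Proof.
  intros H He. eapply near_imp; [|apply (an_cont f z eps H He)]. intros w Hw. cbn beta in *.
  pose proof (Cmod_sub_le (f w) (f z)). pose proof (Cmod_sub_le (f z) (f w)) as H1.
  rewrite (Cmod_minus_sym (f z)) in H1. apply Rabs_def1; lra.
Qed.

Definition square (z : C) (rho : R) : C -> Prop :=
  rect (Re z - rho) (Re z + rho) (Im z - rho) (Im z + rho).

Lemma square_center (z : C) (rho : R) : (0 <= rho)%R -> square z rho z.
Proof. unfold square, rect; lra. Qed.

(** The bound is only asked at distance [rho] from the centre or more, which is
    where the sides of the square lie. *)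
Lemma square_max (F : C -> C) (z : C) (rho M : R) : (0 < rho)%R ->
  analytic_on (square z rho) F ->
  (forall w, square z rho w -> (rho <= Cmod (w - z))%R -> (Cmod (F w) <= M)%R) ->
  (Cmod (F z) <= M)%R.
Proof.
  intros Hrho An Hb.
  destruct (rect_max (Re z - rho) (Re z + rho) (Im z - rho) (Im z + rho) (fun w => Cmod (F w)))
    as [m [Hm Hmax]]; try lra.
  { intros w Hw eps He. apply an_Cmod_cont; auto. }
  apply Rle_trans with (Cmod (F m)); [apply Hmax, square_center; lra|].
  destruct (Rle_dec rho (Cmod (m - z))) as [Hge|Hlt]; [now apply Hb|].
  assert (N : near m (fun w => F w = F m)).
  { apply maximum_principle; [now apply An|].
    exists (rho - Cmod (m - z))%R. split; [lra|]. intros w Hw. apply Hmax.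
    pose proof (Cmod_dist_triangle w m z).
    pose proof (re_le_Cmod (w - z)) as Q1; pose proof (im_le_Cmod (w - z)) as Q2.
    replace (Re (w - z)) with (Re w - Re z)%R in Q1 by reflexivity.
    replace (Im (w - z)) with (Im w - Im z)%R in Q2 by reflexivity.
    unfold rect.
    assert (A1 : (Rabs (Re w - Re z) <= rho)%R) by lra. assert (A2 : (Rabs (Im w - Im z) <= rho)%R) by lra.
    apply Rabs_le_between in A1, A2. lra. }
  (* The modulus is constant up to the side of the square, where it is at most [M]. *)
  set (c := (z + RtoC rho)).
  assert (Sc : square z rho c).
  { unfold square, rect, c, Re, Im; destruct z; simpl; lra. }
  assert (Z : near c (fun w => F w - F m = 0)).
  { apply (identity_convex (square z rho) _ m); auto.
    - apply rect_convex.
    - intros w Hw. apply an_sub; [now apply An|apply an_const].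
    - eapply near_imp; [|apply N]. intros w ->; ring. }
  apply near_self in Z. replace (F m) with (F c).
  - apply Hb; auto. unfold c. replace (z + rho - z) with (RtoC rho) by ring.
    rewrite Cmod_R, Rabs_pos_eq; lra.
  - replace (F c) with (F c - F m + F m) by ring. rewrite Z; ring.
Qed.

(** Cauchy's estimate: the maximum principle for the difference quotient. *)
Lemma cauchy_estimate (f : C -> C) (z : C) (rho M : R) : (0 < rho)%R ->
  analytic_on (square z rho) f ->
  (forall w, square z rho w -> (Cmod (f w) <= M)%R) ->
  (Cmod (C_derive f z) <= 2 * M / rho)%R.
Proof.
  intros Hrho An Hb.
  assert (Sz : square z rho z) by (apply square_center; lra).
  replace (C_derive f z) with (dquot f z z).
  2:{ unfold dquot. destruct (Ceq_dec z z); congruence. }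
  apply square_max with rho; auto.
  - intros w Hw. apply an_dquot; auto.
  - intros w Hw Hge. unfold dquot. destruct (Ceq_dec w z) as [->|N].
    { replace (z - z) with (RtoC 0) in Hge by ring. rewrite Cmod_0 in Hge. lra. }
    rewrite Cmod_div by now apply Csub_ne0.
    assert (Cmod (f w - f z) <= 2 * M)%R.
    { unfold Cminus. eapply Rle_trans; [apply Cmod_triangle|]. rewrite Cmod_opp.
      pose proof (Hb w Hw); pose proof (Hb z Sz); lra. }
    pose proof (Cmod_ge_0 (f w - f z)).
    apply Rle_trans with (2 * M / Cmod (w - z))%R; unfold Rdiv.
    + apply Rmult_le_compat_r; auto. apply Rlt_le, Rinv_0_lt_compat; lra.
    + apply Rmult_le_compat_l; [lra|]. apply Rinv_le_contravar; lra.
Qed.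

(** * The exponential and polynomials in it *)

Lemma cexp_add (z w : C) : cexp (z + w) = cexp z * cexp w.
Proof.
  unfold cexp. destruct z as [x y], w as [u v]. cbn [Re Im fst snd Cplus].
  unfold Cplus; cbn [fst snd]. rewrite exp_plus, cos_plus, sin_plus.
  unfold Cmult, RtoC; cbn [fst snd]. f_equal; ring.
Qed.

Lemma cexp_0 : cexp 0 = 1.
Proof.
  unfold cexp; simpl. rewrite exp_0, cos_0, sin_0. unfold Cmult, RtoC; simpl; f_equal; ring.
Qed.

Lemma Cmod_cexp (z : C) : Cmod (cexp z) = exp (Re z).
Proof.
  unfold cexp. change (cos (Im z), sin (Im z)) with (cis (Im z)).
  rewrite Cmod_mult, Cmod_cis, Cmod_R, Rabs_pos_eq by (apply Rlt_le, exp_pos). ring.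
Qed.

Lemma cexp_neq0 (z : C) : cexp z <> 0.
Proof. intros E. pose proof (Cmod_cexp z) as H. rewrite E, Cmod_0 in H. pose proof (exp_pos (Re z)); lra. Qed.

Definition exp_coef (n : nat) : C := RtoC (/ INR (fact n)).

Lemma exp_coef_bound (w : C) (k : nat) : (Cmod w <= 1/4)%R -> (Cmod (exp_coef k * w ^ k) <= 1 * (1/4) ^ k)%R.
Proof.
  intros Hw. rewrite Cmod_mult, Cmod_pow. unfold exp_coef.
  assert (1 <= INR (fact k))%R by (apply (le_INR 1), lt_O_fact).
  rewrite Cmod_R, Rabs_pos_eq by (apply Rlt_le, Rinv_0_lt_compat; lra).
  apply Rmult_le_compat.
  - apply Rlt_le, Rinv_0_lt_compat; lra.
  - apply pow_le, Cmod_ge_0.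
  - rewrite <- Rinv_1. apply Rinv_le_contravar; lra.
  - apply pow_incr; split; [apply Cmod_ge_0|auto].
Qed.

Lemma csum_RtoC (f : nat -> R) (n : nat) : csum (fun k => RtoC (f k)) (S n) = RtoC (sum_f_R0 f n).
Proof.
  induction n as [|n IH]; [simpl; ring|].
  change (csum (fun k => RtoC (f k)) (S n) + RtoC (f (S n)) = RtoC (sum_f_R0 f (S n))).
  rewrite IH. simpl. now rewrite RtoC_plus.
Qed.

Lemma exp_coef_real (x : R) : sums (fun n => exp_coef n * RtoC x ^ n) (RtoC (exp x)).
Proof.
  intros eps He. unfold exp. destruct (exist_exp x) as [l Hl]. simpl.
  destruct (Hl eps He) as [N HN]. exists (S N). intros n Hn. destruct n as [|n]; [lia|].
  specialize (HN n ltac:(lia)). unfold Rdist in HN.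
  rewrite (csum_ext _ (fun k => RtoC (/ INR (fact k) * x ^ k))).
  - rewrite csum_RtoC, <- RtoC_minus, Cmod_R. exact HN.
  - intros k _. unfold exp_coef. now rewrite RtoC_mult, RtoC_pow.
Qed.

Lemma fact_inv_S (n : nat) : (/ INR (fact (S n)) = / INR (fact n) * / INR (S n))%R.
Proof.
  rewrite fact_simpl, mult_INR, Rinv_mult. ring.
Qed.

Lemma Ci_pow_even (y : R) (n : nat) : (Ci * y) ^ (2 * n) = RtoC ((-1) ^ n * (Rsqr y) ^ n).
Proof.
  assert (E : (Ci * y) ^ 2 = RtoC (-1 * Rsqr y)).
  { apply injective_projections; unfold Rsqr; simpl; ring. }
  now rewrite Cpow_mult_r, <- Rpow_mult_distr, RtoC_pow, E.
Qed.

Lemma exp_coef_imag_partial (y : R) (N : nat) :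
  csum (fun n => exp_coef n * (Ci * y) ^ n) (2 * S N)
  = RtoC (sum_f_R0 (fun i => cos_n i * (Rsqr y) ^ i)%R N)
    + Ci * RtoC (y * sum_f_R0 (fun i => sin_n i * (Rsqr y) ^ i)%R N).
Proof.
  assert (T : forall n, exp_coef (2 * n) * (Ci * y) ^ (2 * n) = RtoC (cos_n n * Rsqr y ^ n)).
  { intros n. rewrite Ci_pow_even. unfold exp_coef, cos_n. rewrite <- RtoC_mult. f_equal. unfold Rdiv; ring. }
  assert (T' : forall n, exp_coef (S (2 * n)) * (Ci * y) ^ (S (2 * n)) = Ci * RtoC (y * (sin_n n * Rsqr y ^ n))).
  { intros n. rewrite Cpow_S, Ci_pow_even. unfold exp_coef, sin_n.
    replace (2 * n + 1)%nat with (S (2 * n)) by lia.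
    rewrite !RtoC_mult. unfold Rdiv. rewrite RtoC_mult. ring. }
  induction N as [|N IH].
  - change (2 * 1)%nat with (S (S 0)). cbn [csum].
    pose proof (T O) as T0; pose proof (T' O) as T0'. simpl Nat.mul in T0, T0'. rewrite T0, T0'.
    cbn [sum_f_R0]. ring.
  - replace (2 * S (S N))%nat with (S (S (2 * S N))) by lia. cbn [csum].
    rewrite IH, T, T'. cbn [sum_f_R0].
    rewrite !Rmult_plus_distr_l, !RtoC_plus, !RtoC_mult. ring.
Qed.

Lemma exp_coef_imag (y : R) : (Rabs y <= 1/4)%R -> sums (fun n => exp_coef n * (Ci * y) ^ n) (cis y).
Proof.
  intros Hy.
  destruct (sums_geom (fun n => exp_coef n * (Ci * y) ^ n) 1 (1/4)) as [l [Hl _]]; [lra| |].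
  { intros k. apply exp_coef_bound. rewrite Cmod_mult, Cmod_R, Cmod_Ci. lra. }
  replace (cis y) with l; auto.
  destruct (Ceq_dec l (cis y)) as [|N]; auto. exfalso.
  assert (D : (0 < Cmod (l - cis y))%R) by now apply Cmod_gt_0, Csub_ne0.
  set (d := Cmod (l - cis y)) in *.
  destruct (Hl (d / 4)%R) as [N1 H1]; [lra|].
  unfold cis, cos, sin in d, D.
  destruct (exist_cos (Rsqr y)) as [a Ha], (exist_sin (Rsqr y)) as [b Hb].
  destruct (Ha (d / 4)%R) as [N2 H2]; [lra|]. destruct (Hb (d / 4)%R) as [N3 H3]; [lra|].
  set (n := (N1 + N2 + N3)%nat).
  specialize (H1 (2 * S n)%nat ltac:(lia)). specialize (H2 n ltac:(lia)). specialize (H3 n ltac:(lia)).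
  rewrite exp_coef_imag_partial in H1. unfold Rdist in H2, H3.
  set (A := sum_f_R0 (fun i => cos_n i * Rsqr y ^ i)%R n) in *.
  set (B := sum_f_R0 (fun i => sin_n i * Rsqr y ^ i)%R n) in *.
  assert (X : (Cmod (RtoC A + Ci * RtoC (y * B) - (a, (y * b)%R)) <= Rabs (A - a) + Rabs (y * (B - b)))%R).
  { eapply Rle_trans; [apply Cmod_le_Re_Im|]. apply Req_le.
    unfold Re, Im, Cminus, Cplus, Copp, Cmult, Ci, RtoC; cbn [fst snd]. f_equal; f_equal; ring. }
  rewrite Rabs_mult in X. pose proof (Rabs_pos (B - b)). pose proof (Rabs_pos y).
  assert (X2 : (Rabs y * Rabs (B - b) <= Rabs (B - b))%R) by nra.
  pose proof (Cmod_dist_triangle l (RtoC A + Ci * RtoC (y * B)) (a, (y * b)%R)) as Tr.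
  rewrite (Cmod_minus_sym l (RtoC A + Ci * RtoC (y * B))) in Tr. unfold d in *. lra.
Qed.

(** The exponential series of a sum, by antidiagonals: the real part gives [exp],
    the imaginary part [cos] and [sin]. *)
Lemma cexp_series (w : C) : (Cmod w <= 1/4)%R -> sums (fun n => exp_coef n * w ^ n) (cexp w).
Proof.
  intros Hw. pose proof (re_le_Cmod w) as Hx; pose proof (im_le_Cmod w) as Hy.
  set (x := Re w) in *. set (y := Im w) in *.
  assert (Ew : w = RtoC x + Ci * RtoC y).
  { unfold x, y. destruct w; unfold Cplus, Cmult, Ci, RtoC; simpl; f_equal; ring. }
  assert (EC : cexp w = RtoC (exp x) * cis y) by reflexivity.
  set (u := fun j k => (exp_coef j * RtoC x ^ j) * (exp_coef k * (Ci * RtoC y) ^ k)).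
  eapply sums_ext.
  2: refine (proj1 (sums_rows_antidiagonals u (fun k => RtoC (exp x) * (exp_coef k * (Ci * RtoC y) ^ k)) 1 (1/4) _ _ _ _) _).
  - intros n. cbn beta. rewrite Ew, <- (binom_coef_sum (RtoC x) (Ci * RtoC y)), <- csum_mul.
    apply csum_ext. intros k Hk. unfold u.
    assert (Bf : forall z m j, (j <= m)%nat -> binom_coef z m j * exp_coef m = exp_coef (m - j) * exp_coef j * z ^ (m - j)).
    { clear. intros z m. induction m as [|m IH]; intros j Hj.
      - assert (j = O) by lia; subst. unfold exp_coef; simpl. rewrite Rinv_1. ring.
      - assert (ES : exp_coef (S m) = exp_coef m * / RtoC (INR (S m))).
        { unfold exp_coef. rewrite fact_inv_S, RtoC_mult, (RtoC_inv (INR (S m))); [reflexivity|apply not_0_INR; lia]. }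
        assert (NZ : RtoC (INR (S m)) <> 0) by (apply RtoC_neq0, not_0_INR; lia).
        destruct j as [|j].
        + cbn [binom_coef]. rewrite ES. rewrite Nat.sub_0_r.
          replace (z * binom_coef z m 0 * (exp_coef m * / INR (S m)))
            with (z * (binom_coef z m 0 * exp_coef m) * / INR (S m)) by ring.
          rewrite IH, Nat.sub_0_r by lia. rewrite ES. simpl Cpow. ring.
        + cbn [binom_coef]. rewrite ES. replace (S m - S j)%nat with (m - j)%nat by lia.
          replace ((z * binom_coef z m (S j) + binom_coef z m j) * (exp_coef m * / INR (S m)))
            with ((z * (binom_coef z m (S j) * exp_coef m) + binom_coef z m j * exp_coef m) * / INR (S m)) by ring.
          rewrite (IH j) by lia.
          assert (ES' : exp_coef j = exp_coef (S j) * RtoC (INR (S j))).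
          { unfold exp_coef. rewrite fact_inv_S, <- RtoC_mult. f_equal. field. split; apply not_0_INR; [lia|]. apply fact_neq_0. }
          destruct (Nat.eq_dec j m) as [->|Nj].
          * rewrite (binom_coef_gt z m (S m)) by lia. rewrite Nat.sub_diag. rewrite ES.
            simpl Cpow. ring.
          * rewrite (IH (S j)) by lia. destruct (m - j)%nat as [|p] eqn:Ep; [lia|].
            replace (m - S j)%nat with p by lia.
            assert (ES2 : exp_coef p = exp_coef (S p) * RtoC (INR (S p))).
            { unfold exp_coef. rewrite fact_inv_S, <- RtoC_mult. f_equal. field. split; apply not_0_INR; [lia|]. apply fact_neq_0. }
            rewrite ES2, ES'. replace (INR (S m)) with (INR (S p) + INR (S j))%R.
            2:{ rewrite <- plus_INR. f_equal. lia. }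
            rewrite RtoC_plus. simpl Cpow. field. rewrite <- RtoC_plus, <- plus_INR.
            apply RtoC_neq0, not_0_INR. lia. }
    replace (exp_coef n * (binom_coef x n k * (Ci * y) ^ k))
      with (binom_coef x n k * exp_coef n * (Ci * y) ^ k) by ring.
    rewrite Bf by lia. ring.
  - lra.
  - intros j k. unfold u. rewrite Cmod_mult, pow_add.
    replace (1 * ((1/4) ^ j * (1/4) ^ k))%R with ((1 * (1/4) ^ j) * (1 * (1/4) ^ k))%R by ring.
    apply Rmult_le_compat; try apply Cmod_ge_0; apply exp_coef_bound.
    + rewrite Cmod_R; lra.
    + rewrite Cmod_mult, Cmod_R, Cmod_Ci; lra.
  - intros k. unfold u. rewrite (Cmult_comm (RtoC (exp x))).
    eapply sums_ext; [|apply sums_mul, exp_coef_real]. intros j; simpl; ring.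
  - rewrite EC. apply sums_mul, exp_coef_imag. lra.
Qed.

Lemma ps_cexp_0 : ps cexp 0 exp_coef.
Proof.
  exists 1%R, 1%R, (1/4)%R. repeat split; try lra.
  - intros n. rewrite pow1. unfold exp_coef.
    assert (1 <= INR (fact n))%R by (apply (le_INR 1), lt_O_fact).
    rewrite Cmod_R, Rabs_pos_eq by (apply Rlt_le, Rinv_0_lt_compat; lra).
    rewrite Rmult_1_r, <- Rinv_1. apply Rinv_le_contravar; lra.
  - intros w Hw. replace (0 + w) with w by ring. apply cexp_series; lra.
Qed.

(** The coordinate on the cylinder [C / 2 pi Z]. *)
Definition expi (z : C) : C := cexp (Ci * z).

Lemma expi_add (z w : C) : expi (z + w) = expi z * expi w.
Proof. unfold expi. rewrite <- cexp_add. f_equal; ring. Qed.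

Lemma expi_0 : expi 0 = 1.
Proof. unfold expi. replace (Ci * 0) with (RtoC 0) by ring. apply cexp_0. Qed.

Lemma expi_neq0 (z : C) : expi z <> 0.
Proof. apply cexp_neq0. Qed.

Lemma expi_opp (z : C) : expi (- z) = / expi z.
Proof.
  pose proof (expi_neq0 z). assert (E : expi z * expi (- z) = 1).
  { rewrite <- expi_add. replace (z + - z) with (RtoC 0) by ring. apply expi_0. }
  replace (expi (- z)) with (/ expi z * (expi z * expi (- z))) by (field; auto). rewrite E. ring.
Qed.

Lemma Cmod_expi (z : C) : Cmod (expi z) = exp (- Im z).
Proof. unfold expi. rewrite Cmod_cexp. f_equal. destruct z; unfold Re, Im, Ci, Cmult; simpl; ring. Qed.

Lemma expi_real (x : R) : expi x = cis x.
Proof.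
  unfold expi, cexp. unfold Ci, Cmult, RtoC, Re, Im, cis; simpl.
  replace (0 * x - 1 * 0)%R with 0%R by ring. rewrite exp_0.
  replace (0 * 0 + 1 * x)%R with x by ring. f_equal; ring.
Qed.

Lemma expi_period (z : C) : expi (z + RtoC (2 * PI)) = expi z.
Proof.
  rewrite expi_add, expi_real. unfold cis. rewrite cos_2PI, sin_2PI. change (1%R, 0%R) with (RtoC 1). ring.
Qed.

Lemma ps_expi (z : C) : exists a, ps expi z a /\ a 1%nat = Ci * expi z.
Proof.
  exists (conv (fun n => match n with O => expi z | _ => 0 end) (fun n => exp_coef n * Ci ^ n)). split.
  - apply (ps_ext (fun w => expi z * cexp (Ci * w + - Ci * z))).
    + apply near_true; intros w. unfold expi. rewrite <- cexp_add. f_equal; ring.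
    + apply (ps_mul (fun _ => expi z) (fun w => cexp (Ci * w + - Ci * z))); [apply ps_const|].
      apply ps_affine. replace (Ci * z + - Ci * z) with (RtoC 0) by ring. apply ps_cexp_0.
  - unfold conv, exp_coef; simpl. rewrite Rinv_1. ring.
Qed.

Lemma an_expi (z : C) : analytic_at expi z.
Proof. destruct (ps_expi z) as [a [H _]]. eapply ps_analytic; eauto. Qed.

Lemma D_expi (z : C) : C_derive expi z = Ci * expi z.
Proof. destruct (ps_expi z) as [a [H <-]]. now apply ps_C_derive. Qed.

#[local] Hint Resolve an_expi : analytic.

Definition is_poly (F : C -> C) : Prop := exists p, forall z, F z = peval p z.

Lemma poly_ext (F G : C -> C) : (forall z, F z = G z) -> is_poly F -> is_poly G.
Proof. intros E [p H]; exists p; intros z; now rewrite <- E. Qed.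

Lemma poly_const (c : C) : is_poly (fun _ => c).
Proof. exists (c :: nil). intros z; simpl; ring. Qed.

Lemma poly_id : is_poly (fun z => z).
Proof. exists (RtoC 0 :: RtoC 1 :: nil). intros z; simpl; ring. Qed.

Lemma poly_add (F G : C -> C) : is_poly F -> is_poly G -> is_poly (fun z => F z + G z).
Proof.
  intros [p Hp] [q Hq]. assert (X : exists s, forall z, peval p z + peval q z = peval s z).
  { clear. revert q. induction p as [|a p IH]; intros q; [exists q; intros z; simpl; ring|].
    destruct q as [|b q]; [exists (a :: p); intros z; simpl; ring|].
    destruct (IH q) as [s Hs]. exists ((a + b) :: s). intros z. simpl. rewrite <- Hs. ring. }
  destruct X as [s Hs]. exists s; intros z. now rewrite Hp, Hq.
Qed.

Lemma poly_scal (c : C) (F : C -> C) : is_poly F -> is_poly (fun z => c * F z).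
Proof.
  intros [p Hp]. exists (map (fun a => c * a) p). intros z. rewrite Hp. clear.
  induction p as [|a p IH]; simpl; [ring|]. rewrite <- IH. ring.
Qed.

Lemma poly_X (F : C -> C) : is_poly F -> is_poly (fun z => z * F z).
Proof. intros [p Hp]. exists (RtoC 0 :: p). intros z. rewrite Hp. simpl. ring. Qed.

Lemma poly_mul (F G : C -> C) : is_poly F -> is_poly G -> is_poly (fun z => F z * G z).
Proof.
  intros [p Hp] HG. apply (poly_ext (fun z => peval p z * G z)); [intros z; now rewrite Hp|]. clear Hp.
  induction p as [|a p IH].
  - apply (poly_ext (fun _ => 0)); [intros z; simpl; ring|apply poly_const].
  - apply (poly_ext (fun z => a * G z + z * (peval p z * G z))); [intros z; simpl; ring|].
    apply poly_add; [now apply poly_scal|now apply poly_X].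
Qed.

Lemma poly_sub (F G : C -> C) : is_poly F -> is_poly G -> is_poly (fun z => F z - G z).
Proof.
  intros HF HG. apply (poly_ext (fun z => F z + - (1) * G z)); [intros z; ring|].
  apply poly_add; auto. now apply poly_scal.
Qed.

Lemma poly_pow (n : nat) : is_poly (fun z => z ^ n).
Proof. induction n as [|n IH]; simpl; [apply poly_const|now apply poly_X]. Qed.

Lemma an_poly (F : C -> C) (z : C) : is_poly F -> analytic_at F z.
Proof.
  intros [p Hp]. apply (an_ext (peval p)); [apply near_true; intros w; now rewrite Hp|]. clear Hp.
  induction p as [|a p IH]; [apply (an_const 0)|].
  apply (an_add (fun _ => a) (fun w => w * peval p w)); [apply an_const|].
  apply an_mul; auto. apply an_id.
Qed.

Lemma poly_D (F : C -> C) : is_poly F -> is_poly (C_derive F).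
Proof.
  intros [p Hp]. assert (EF : F = peval p) by now apply functional_extensionality.
  subst F. clear Hp. induction p as [|a p IH].
  - apply (poly_ext (fun _ => 0)); [|apply poly_const]. intros z. symmetry. exact (D_const 0 z).
  - apply (poly_ext (fun z => peval p z + z * C_derive (peval p) z)).
    + intros z. assert (Ap : analytic_at (peval p) z) by (apply an_poly; now exists p).
      symmetry. change (C_derive (fun w => a + w * peval p w) z = peval p z + z * C_derive (peval p) z).
      D_expand. ring.
    + apply poly_add; [now exists p|now apply poly_X].
Qed.

Lemma an_poly_expi (F : C -> C) (z : C) : is_poly F -> analytic_at (fun w => F (expi w)) z.
Proof.
  intros [p Hp]. apply (an_ext (fun w => peval p (expi w))); [apply near_true; intros w; now rewrite Hp|]. clear Hp.
  induction p as [|a p IH]; [apply (an_const 0)|].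
  apply (an_add (fun _ => a) (fun w => expi w * peval p (expi w))); [apply an_const|].
  apply an_mul; auto. apply an_expi.
Qed.

Lemma D_poly_expi (F : C -> C) (z : C) : is_poly F ->
  C_derive (fun w => F (expi w)) z = C_derive F (expi z) * (Ci * expi z).
Proof.
  intros [p Hp]. assert (EF : F = peval p) by now apply functional_extensionality.
  subst F. clear Hp. induction p as [|a p IH].
  - change (C_derive (fun _ : C => 0) z = C_derive (fun _ : C => 0) (expi z) * (Ci * expi z)).
    rewrite !D_const. ring.
  - assert (Ap : forall w, analytic_at (peval p) w) by (intros w; apply an_poly; now exists p).
    assert (Apr : analytic_at (fun w => peval p (expi w)) z) by (apply an_poly_expi; now exists p).
    pose proof (Ap (expi z)).
    change (C_derive (fun w => a + expi w * peval p (expi w)) z = C_derive (fun w => a + w * peval p w) (expi z) * (Ci * expi z)).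
    assert (Am : analytic_at (fun w => expi w * peval p (expi w)) z) by (apply an_mul; auto using an_expi).
    rewrite (D_add (fun _ => a) (fun w => expi w * peval p (expi w))) by an.
    rewrite (D_mul expi (fun w => peval p (expi w))), IH, D_expi by auto using an_expi. D_expand. ring.
Qed.

(** * Entire functions on the cylinder *)

Lemma period_Z {A : Type} (F : C -> A) : (forall z, F (z + RtoC (2 * PI)) = F z) ->
  forall (k : Z) (z : C), F (z + RtoC (2 * PI * IZR k)) = F z.
Proof.
  intros H.
  assert (P : forall (n : nat) z, F (z + RtoC (2 * PI * INR n)) = F z).
  { induction n as [|n IH]; intros z.
    - simpl. rewrite Rmult_0_r. f_equal; ring.
    - rewrite S_INR, Rmult_plus_distr_l, Rmult_1_r, RtoC_plus, Cplus_assoc, H. apply IH. }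
  intros k z. destruct (Z_le_gt_dec 0 k) as [Hk|Hk].
  - rewrite <- (Z2Nat.id k Hk), <- INR_IZR_INZ. apply P.
  - rewrite <- (P (Z.to_nat (- k)) (z + RtoC (2 * PI * IZR k))).
    f_equal. rewrite INR_IZR_INZ, Z2Nat.id by lia. rewrite opp_IZR.
    rewrite <- Cplus_assoc, <- RtoC_plus. replace (2 * PI * IZR k + 2 * PI * - IZR k)%R with 0%R by ring. ring.
Qed.

Lemma reduce_period (x : R) : exists k : Z, (- PI <= x + 2 * PI * IZR k < PI)%R.
Proof.
  pose proof PI_RGT_0. set (y := ((x + PI) / (2 * PI))%R).
  destruct (archimed y) as [A1 A2]. exists (1 - up y)%Z. rewrite minus_IZR.
  assert (E : (x = 2 * PI * y - PI)%R) by (unfold y; field; lra).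
  rewrite E. split.
  - assert (0 <= 2 * PI * (y - IZR (up y) + 1))%R by (apply Rmult_le_pos; lra). lra.
  - assert (0 < 2 * PI * (IZR (up y) - y))%R by (apply Rmult_lt_0_compat; lra). lra.
Qed.

Definition univ (z : C) : Prop := True.

Lemma univ_convex : convex univ.
Proof. intros x y t _ _ _; exact I. Qed.

Definition entire (F : C -> C) : Prop := forall z, analytic_at F z.

Lemma identity_entire (F : C -> C) (z w : C) : entire F -> near z (fun v => F v = 0) -> F w = 0.
Proof.
  intros E Z. apply (near_self w (fun v => F v = 0)). apply (identity_convex univ F z); auto.
  - apply univ_convex.
  - intros v _; apply E.
  - exact I.
  - exact I.
Qed.

(** The modulus has a maximum by periodicity, so the function is constant.  Asking
    periodicity of the modulus only leaves room for a factor [e ^ (i z / 2)]. *)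
Lemma cylinder_vanishing (F : C -> C) : entire F ->
  (forall z, Cmod (F (z + RtoC (2 * PI))) = Cmod (F z)) ->
  (forall eps, (0 < eps)%R -> exists Y, forall z, (Y <= Rabs (Im z))%R -> (Cmod (F z) <= eps)%R) ->
  forall z, F z = 0.
Proof.
  intros HE HP H0 w. apply NNPP; intros N.
  assert (Fw : (0 < Cmod (F w))%R) by now apply Cmod_gt_0.
  destruct (H0 (Cmod (F w) / 2)%R) as [Y HY]; [lra|].
  pose proof PI_RGT_0.
  set (Y' := Rmax (Rabs Y) (Rabs (Im w))).
  assert (Y1 : (Rabs Y <= Y')%R) by apply Rmax_l. assert (Y2 : (Rabs (Im w) <= Y')%R) by apply Rmax_r.
  assert (Y0 : (0 <= Y')%R) by (pose proof (Rabs_pos Y); lra).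
  destruct (rect_max (- PI) PI (- Y') Y' (fun z => Cmod (F z))) as [m [Hm Hmax]]; try lra.
  { intros z Hz eps He. now apply an_Cmod_cont. }
  pose proof (period_Z (fun z => Cmod (F z)) HP) as HZ. cbn beta in HZ.
  assert (In : forall z, (Rabs (Im z) <= Y')%R -> (Cmod (F z) <= Cmod (F m))%R).
  { intros z Hz. destruct (reduce_period (Re z)) as [k Hk]. rewrite <- (HZ k z). apply Hmax.
    unfold rect. destruct z as [x y]; unfold Re, Im, Cplus, RtoC in *; simpl in *.
    apply Rabs_le_between in Hz. lra. }
  assert (Glob : forall z, (Cmod (F z) <= Cmod (F m))%R).
  { intros z. destruct (Rle_dec (Rabs (Im z)) Y') as [L|L]; auto.
    apply Rle_trans with (Cmod (F w)); [|now apply In].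
    apply Rle_trans with (Cmod (F w) / 2)%R; [|lra]. apply HY. pose proof (Rle_abs Y). lra. }
  assert (Cst : near m (fun z => F z - F m = 0)).
  { eapply near_imp; [|apply (maximum_principle F m (HE m)); now apply near_true].
    intros z ->; ring. }
  set (v := (0%R, (Rabs Y + 1)%R) : C).
  assert (Ev : F v - F m = 0).
  { apply (identity_entire (fun z => F z - F m) m); auto. intros z. apply an_sub; [apply HE|apply an_const]. }
  assert (Fv : F v = F m) by (replace (F v) with (F v - F m + F m) by ring; rewrite Ev; ring).
  assert (Cmod (F v) <= Cmod (F w) / 2)%R.
  { apply HY. unfold v, Im; simpl. pose proof (Rle_abs Y). pose proof (Rabs_pos Y).
    rewrite (Rabs_pos_eq (Rabs Y + 1)) by lra. lra. }
  pose proof (Glob w). rewrite Fv in *. lra.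
Qed.

Lemma expi_eq_1 (z : C) : expi z = 1 -> exists k : Z, z = RtoC (2 * PI * IZR k).
Proof.
  intros H. assert (Hi : Im z = 0%R).
  { pose proof (Cmod_expi z) as M. rewrite H, Cmod_1 in M. rewrite <- exp_0 in M. apply exp_inv in M. lra. }
  destruct z as [x y]. simpl in Hi. subst y. change (x, 0%R) with (RtoC x) in *.
  rewrite expi_real in H. unfold cis in H. injection H as Hc Hs.
  assert (S2 : sin (x / 2) = 0%R).
  { replace x with (2 * (x / 2))%R in Hc by field. rewrite cos_2a_sin in Hc.
    assert (sin (x / 2) * sin (x / 2) = 0)%R by lra. now apply Rsqr_0_uniq. }
  destruct (sin_eq_0_0 _ S2) as [k Hk]. exists k. f_equal. lra.
Qed.

Lemma cexp_half_mod (z : C) : Cmod (cexp (Ci * z * / 2)) = exp (- Im z / 2).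
Proof.
  rewrite Cmod_cexp. f_equal. rewrite <- RtoC_inv by lra.
  destruct z; unfold Re, Im, Ci, Cmult, RtoC; simpl. field.
Qed.

Lemma an_cexp_half (z : C) : analytic_at (fun w => cexp (Ci * w * / 2)) z.
Proof.
  apply (an_ext (fun w => expi (/ 2 * w + 0))).
  - apply near_true; intros w. unfold expi. f_equal; ring.
  - apply an_affine, an_expi.
Qed.

Lemma exp_mono (x y : R) : (x <= y -> exp x <= exp y)%R.
Proof. intros [H| ->]; [now apply Rlt_le, exp_increasing|apply Rle_refl]. Qed.

Lemma exp_decay (K eps : R) : (0 < eps)%R -> exists Y, (0 <= Y)%R /\ forall y, (Y <= y)%R -> (K * exp (- y / 2) <= eps)%R.
Proof.
  intros He. set (Y := (2 * (Rabs K / eps))%R). pose proof (Rabs_pos K).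
  assert (Y0 : (0 <= Y)%R) by (unfold Y; apply Rmult_le_pos; [lra|apply Rdiv_le_0_compat; auto]).
  exists Y; split; auto. intros y Hy.
  assert (E1 : (1 + y / 2 <= exp (y / 2))%R) by apply exp_ineq1_le.
  replace (- y / 2)%R with (- (y / 2))%R by field. rewrite exp_Ropp.
  assert (P := exp_pos (y / 2)).
  apply Rmult_le_reg_r with (exp (y / 2)); auto. rewrite Rmult_assoc, Rinv_l by lra.
  assert (Rabs K <= eps * (y / 2))%R.
  { assert (Rabs K / eps <= y / 2)%R by (unfold Y in Hy; lra).
    replace (Rabs K) with (eps * (Rabs K / eps))%R by (field; lra). apply Rmult_le_compat_l; lra. }
  pose proof (Rle_abs K). nra.
Qed.

(** Each step subtracts the value at [0] and divides by [expi - 1], whose zeros are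
    simple and form one orbit of the period; this lowers the order of growth at the
    lower end by one.  When the order is [-1], [cylinder_vanishing] applies to
    [H z * e ^ (i z / 2)]. *)
Lemma periodic_polynomial (n : nat) : forall (H : C -> C) (K Y : R), entire H ->
  (forall z, H (z + RtoC (2 * PI)) = H z) ->
  (forall z, Y <= Im z -> Cmod (H z) <= K)%R ->
  (forall z, Y <= - Im z -> Cmod (H z) <= K * exp ((INR n - 1) * - Im z))%R ->
  exists P, is_poly P /\ forall z, H z = P (expi z).
Proof.
  induction n as [|n IH]; intros H K Y HE HP Up Dn.
  - exists (fun _ => 0). split; [apply poly_const|].
    assert (Z : forall z, H z * cexp (Ci * z * / 2) = 0).
    { apply (cylinder_vanishing (fun z => H z * cexp (Ci * z * / 2))).
      - intros z. apply an_mul; [apply HE|apply an_cexp_half].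
      - intros z. rewrite !Cmod_mult, HP, !cexp_half_mod. do 3 f_equal. destruct z; unfold Im; simpl; ring.
      - intros eps He. destruct (exp_decay K eps He) as [Y1 [Y10 HY1]].
        exists (Rmax Y Y1). intros z Hz.
        pose proof (Rmax_l Y Y1); pose proof (Rmax_r Y Y1).
        rewrite Cmod_mult, cexp_half_mod. pose proof (exp_pos (- Im z / 2)).
        destruct (Rle_dec 0 (Im z)).
        + rewrite Rabs_pos_eq in Hz by auto.
          eapply Rle_trans; [|apply (HY1 (Im z)); lra]. apply Rmult_le_compat_r; [lra|]. apply Up; lra.
        + rewrite Rabs_left in Hz by lra.
          eapply Rle_trans; [|apply (HY1 (- Im z)%R); lra].
          eapply Rle_trans; [apply Rmult_le_compat_r; [lra|apply Dn; lra]|].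
          rewrite Rmult_assoc, <- exp_plus. apply Req_le. f_equal. f_equal. simpl. field. }
    intros z. specialize (Z z). apply NNPP; intros N.
    apply (Cmult_neq_0 _ _ N (cexp_neq0 _) Z).
  - set (Q := fun z => if Ceq_dec (expi z) 1 then C_derive H z / Ci else (H z - H 0) / (expi z - 1)).
    assert (Ci0 : Ci <> 0) by (intros E; injection E; lra).
    assert (HQ : forall z, H z = H 0 + (expi z - 1) * Q z).
    { intros z. unfold Q. destruct (Ceq_dec (expi z) 1) as [E|N].
      - rewrite E. destruct (expi_eq_1 z E) as [k Hk]. rewrite Hk.
        replace (RtoC (2 * PI * IZR k)) with (0 + RtoC (2 * PI * IZR k)) at 1 by ring.
        rewrite (period_Z H HP). ring.
      - field. now apply Csub_ne0. }
    assert (EQ : entire Q).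
    { intros z0. destruct (Ceq_dec (expi z0) 1) as [E|N].
      - assert (A : analytic_at (dquot expi z0) z0) by (apply an_dquot; apply an_expi).
        assert (V : dquot expi z0 z0 = Ci).
        { unfold dquot. destruct (Ceq_dec z0 z0); [|congruence]. rewrite D_expi, E; ring. }
        assert (NV : dquot expi z0 z0 <> 0) by (rewrite V; auto).
        apply (an_ext (fun w => dquot H z0 w / dquot expi z0 w)).
        + eapply near_imp; [|apply (an_ne0 _ _ A NV)]. intros w Nw.
          destruct (Ceq_dec w z0) as [->|D].
          * rewrite V. unfold Q, dquot. destruct (Ceq_dec z0 z0); [|congruence].
            destruct (Ceq_dec (expi z0) 1); [auto|congruence].
          * pose proof (dquot_mul expi z0 w) as M. rewrite E in M.
            pose proof (Csub_ne0 _ _ D) as D'.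
            assert (N1 : expi w - 1 <> 0) by (rewrite M; now apply Cmult_neq_0).
            unfold Q. destruct (Ceq_dec (expi w) 1) as [E1|_].
            { exfalso; apply N1; rewrite E1; ring. }
            assert (HH : H z0 = H 0).
            { rewrite (HQ z0), E. ring. }
            rewrite M. unfold dquot at 1. destruct (Ceq_dec w z0); [congruence|].
            rewrite HH. field. auto.
        + apply an_div; auto. apply an_dquot; apply HE.
      - assert (N' := Csub_ne0 _ _ N).
        apply (an_ext (fun w => (H w - H 0) / (expi w - 1))).
        + assert (A : analytic_at (fun w => expi w - 1) z0) by (apply an_sub; [apply an_expi|apply an_const]).
          eapply near_imp; [|apply (an_ne0 _ _ A N')]. intros w Nw. unfold Q.
          destruct (Ceq_dec (expi w) 1) as [E1|_]; auto. exfalso; apply Nw; rewrite E1; ring.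
        + apply an_div; auto; [apply an_sub; [apply HE|apply an_const]|apply an_sub; [apply an_expi|apply an_const]]. }
    assert (PQ : forall z, Q (z + RtoC (2 * PI)) = Q z).
    { intros z. unfold Q. rewrite expi_period, HP. destruct (Ceq_dec (expi z) 1); auto.
      f_equal. rewrite <- (D_shift H) by apply HE. apply D_ext; [|apply HE].
      apply near_true; auto. }
    set (Y1 := Rmax Y 1). pose proof (Rmax_l Y 1) as YY1; pose proof (Rmax_r Y 1) as YY2. fold Y1 in YY1, YY2.
    set (K1 := (2 * (Rabs K + Cmod (H 0)))%R).
    pose proof (Rabs_pos K); pose proof (Cmod_ge_0 (H 0)); pose proof (Rle_abs K).
    assert (e1 : (2 <= exp 1)%R) by (pose proof (exp_ineq1_le 1); lra).
    destruct (IH Q K1 Y1) as [P [HPo HPe]]; auto.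
    + intros z Hz.
      assert (L : (1/2 <= Cmod (expi z - 1))%R).
      { pose proof (Cmod_sub_le 1 (expi z)) as S1. rewrite Cmod_minus_sym, Cmod_1, Cmod_expi in S1.
        assert (exp (- Im z) <= 1/2)%R; [|lra].
        apply Rle_trans with (exp (- (1))); [apply exp_mono; lra|]. rewrite exp_Ropp.
        apply Rmult_le_reg_r with (exp 1); [lra|]. rewrite Rinv_l; lra. }
      assert (X : (Cmod (expi z - 1) * Cmod (Q z) <= Rabs K + Cmod (H 0))%R).
      { rewrite <- Cmod_mult. replace ((expi z - 1) * Q z) with (H z - H 0) by (rewrite HQ; ring).
        unfold Cminus; eapply Rle_trans; [apply Cmod_triangle|]. rewrite Cmod_opp.
        specialize (Up z ltac:(lra)). lra. }
      pose proof (Cmod_ge_0 (Q z)). unfold K1. nra.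
    + intros z Hz. set (y := (- Im z)%R) in *.
      assert (L : (exp y / 2 <= Cmod (expi z - 1))%R).
      { pose proof (Cmod_sub_le (expi z) 1) as S1. rewrite Cmod_1, Cmod_expi in S1. fold y in S1.
        assert (exp 1 <= exp y)%R by (apply exp_mono; lra). lra. }
      assert (E1 : (1 <= exp (INR n * y))%R).
      { rewrite <- exp_0. apply exp_mono. apply Rmult_le_pos; [apply pos_INR|lra]. }
      assert (X : (Cmod (expi z - 1) * Cmod (Q z) <= (Rabs K + Cmod (H 0)) * exp (INR n * y))%R).
      { rewrite <- Cmod_mult. replace ((expi z - 1) * Q z) with (H z - H 0) by (rewrite HQ; ring).
        unfold Cminus; eapply Rle_trans; [apply Cmod_triangle|]. rewrite Cmod_opp.
        specialize (Dn z). fold y in Dn. specialize (Dn ltac:(lra)). rewrite S_INR in Dn.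
        replace ((INR n + 1 - 1) * y)%R with (INR n * y)%R in Dn by ring. nra. }
      pose proof (Cmod_ge_0 (Q z)). pose proof (exp_pos y).
      replace ((INR n - 1) * y)%R with (INR n * y + - y)%R by ring. rewrite exp_plus, exp_Ropp.
      apply Rmult_le_reg_r with (exp y / 2)%R; [lra|].
      replace (K1 * (exp (INR n * y) * / exp y) * (exp y / 2))%R
        with ((Rabs K + Cmod (H 0)) * exp (INR n * y))%R by (unfold K1; field; lra).
      eapply Rle_trans; [|apply X]. rewrite Rmult_comm. apply Rmult_le_compat_r; auto.
    + exists (fun v => H 0 + (v - 1) * P v). split.
      * apply poly_add; [apply poly_const|]. apply poly_mul; auto. apply poly_sub; [apply poly_id|apply poly_const].
      * intros z. rewrite HQ at 1. now rewrite HPe.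
Qed.

(** * Gluing across the sides of a period strip *)

Definition vstrip (a b : R) (z : C) : Prop := (a <= Re z <= b)%R.

Lemma Re_add_R (z : C) (x : R) : Re (z + RtoC x) = (Re z + x)%R.
Proof. destruct z; reflexivity. Qed.

Lemma Im_add_R (z : C) (x : R) : Im (z + RtoC x) = Im z.
Proof. destruct z; unfold Im; simpl; ring. Qed.

Lemma period_index_unique (x : R) (k j : Z) :
  (- PI <= x + 2 * PI * IZR k < PI)%R -> (- PI <= x + 2 * PI * IZR j < PI)%R -> k = j.
Proof.
  intros H K. pose proof PI_RGT_0.
  assert (A : (-1 < IZR k - IZR j < 1)%R).
  { split; apply Rmult_lt_reg_l with (2 * PI)%R; lra. }
  rewrite <- minus_IZR in A. destruct A as [A1 A2]. apply lt_IZR in A1, A2. lia.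
Qed.

Lemma near_Re (z : C) (a b : R) : (a < Re z < b)%R -> near z (fun w => (a < Re w < b)%R).
Proof.
  intros H. exists (Rmin (Re z - a) (b - Re z)). split; [apply Rmin_glb_lt; lra|].
  intros w Hw. pose proof (lt_Rmin_l _ _ _ Hw) as W1; pose proof (lt_Rmin_r _ _ _ Hw) as W2.
  pose proof (re_le_Cmod (w - z)) as Q. replace (Re (w - z)) with (Re w - Re z)%R in Q by reflexivity.
  assert (Q1 : (Rabs (Re w - Re z) <= Cmod (w - z))%R) by exact Q.
  apply Rabs_le_between in Q1. lra.
Qed.

(** The values are moved to the base strip by a multiple of the period; agreement
    on neighbourhoods of one side makes the result analytic on both sides. *)
Lemma periodic_gluing (n : C -> C) :
  analytic_on (vstrip (- PI) PI) n ->
  (forall z, Re z = (- PI)%R -> near z (fun w => n (w + RtoC (2 * PI)) = n w)) ->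
  exists N, entire N /\ (forall z, N (z + RtoC (2 * PI)) = N z) /\
    forall z, vstrip (- PI) PI z -> near z (fun w => N w = n w).
Proof.
  intros An Per. pose proof PI_RGT_0.
  set (k := fun z : C => proj1_sig (constructive_indefinite_description _ (reduce_period (Re z)))).
  assert (Hk : forall z, (- PI <= Re z + 2 * PI * IZR (k z) < PI)%R).
  { intros z. unfold k. exact (proj2_sig (constructive_indefinite_description _ (reduce_period (Re z)))). }
  set (N := fun z => n (z + RtoC (2 * PI * IZR (k z)))).
  assert (PN : forall z, N (z + RtoC (2 * PI)) = N z).
  { intros z. unfold N. replace (k (z + RtoC (2 * PI))) with (k z - 1)%Z.
    - f_equal. rewrite minus_IZR, <- Cplus_assoc, <- RtoC_plus. do 2 f_equal. ring.
    - apply (period_index_unique (Re (z + RtoC (2 * PI)))); [|apply Hk].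
      rewrite Re_add_R, minus_IZR. specialize (Hk z). lra. }
  assert (N0 : forall w, (- PI <= Re w < PI)%R -> N w = n w).
  { intros w Hw. unfold N. replace (k w) with 0%Z.
    - rewrite Rmult_0_r. f_equal; ring.
    - apply (period_index_unique (Re w)); [lra|apply Hk]. }
  assert (Loc : forall z, vstrip (- PI) PI z -> near z (fun w => N w = n w)).
  { intros z [Hz1 Hz2]. destruct (Req_dec (Re z) (- PI)) as [E|E1].
    - assert (R1 : (- PI - PI < Re z < PI)%R) by lra.
      eapply near_imp; [|apply (near_and _ _ _ (Per z E) (near_Re z _ _ R1))].
      intros w [W1 W2]. destruct (Rle_dec (- PI) (Re w)); [apply N0; lra|].
      rewrite <- PN, <- W1. apply N0. rewrite Re_add_R; lra.
    - destruct (Req_dec (Re z) PI) as [E|E2].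
      + assert (E' : Re (z + RtoC (- (2 * PI))) = (- PI)%R) by (rewrite Re_add_R; lra).
        assert (R1 : (0 < Re z < 2 * PI)%R) by lra.
        eapply near_imp; [|apply (near_and _ _ _ (near_shift _ _ _ (Per _ E')) (near_Re z _ _ R1))].
        cbn beta. intros w [W1 W2]. destruct (Rlt_dec (Re w) PI); [apply N0; lra|].
        assert (Ew : w + RtoC (- (2 * PI)) + RtoC (2 * PI) = w).
        { rewrite <- Cplus_assoc, <- RtoC_plus. replace (- (2 * PI) + 2 * PI)%R with 0%R by ring. ring. }
        rewrite Ew in W1. rewrite W1. rewrite <- Ew at 1. rewrite PN. apply N0.
        rewrite Re_add_R. lra.
      + assert (R1 : (- PI < Re z < PI)%R) by lra.
        eapply near_imp; [|apply (near_Re z _ _ R1)]. intros w W. apply N0; lra. }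
  exists N. repeat split; auto.
  intros z. pose proof (Hk z) as Kz.
  apply (an_ext (fun w => N (w + RtoC (2 * PI * IZR (k z))))).
  - apply near_true. intros w. apply (period_Z N PN).
  - apply an_shift. set (z' := z + RtoC (2 * PI * IZR (k z))).
    assert (V : vstrip (- PI) PI z') by (unfold vstrip, z'; rewrite Re_add_R; lra).
    apply (an_ext n); [|now apply An].
    eapply near_imp; [|apply (Loc z' V)]. auto.
Qed.

(** * Exponential growth at the ends of a strip *)

Definition egrow (D : C -> Prop) (f : C -> C) : Prop :=
  exists K k Y : R, (0 <= K)%R /\ (0 <= k)%R /\
    forall z, D z -> (Y <= Rabs (Im z))%R -> (Cmod (f z) <= K * exp (k * Rabs (Im z)))%R.

Lemma egrow_ext (D : C -> Prop) (f g : C -> C) (Y0 : R) :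
  (forall z, D z -> (Y0 <= Rabs (Im z))%R -> f z = g z) -> egrow D f -> egrow D g.
Proof.
  intros E [K [k [Y [HK [Hk H]]]]]. exists K, k, (Rmax Y Y0). repeat split; auto.
  intros z Dz Hz. pose proof (Rmax_l Y Y0); pose proof (Rmax_r Y Y0).
  rewrite <- E by (auto; lra). apply H; auto; lra.
Qed.

Lemma egrow_sub (D D' : C -> Prop) (f : C -> C) :
  (forall z, D' z -> D z) -> egrow D f -> egrow D' f.
Proof.
  intros S [K [k [Y [HK [Hk H]]]]]. exists K, k, Y. repeat split; auto.
Qed.

Lemma egrow_union (D D' D'' : C -> Prop) (f : C -> C) :
  (forall z, D'' z -> D z \/ D' z) -> egrow D f -> egrow D' f -> egrow D'' f.
Proof.
  intros S [K [k [Y [HK [Hk H]]]]] [K' [k' [Y' [HK' [Hk' H']]]]].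
  exists (K + K')%R, (k + k')%R, (Rmax Y Y'). repeat split; try lra.
  intros z Dz Hz. pose proof (Rmax_l Y Y'); pose proof (Rmax_r Y Y'). pose proof (Rabs_pos (Im z)).
  assert (E1 : (exp (k * Rabs (Im z)) <= exp ((k + k') * Rabs (Im z)))%R) by (apply exp_mono; nra).
  assert (E2 : (exp (k' * Rabs (Im z)) <= exp ((k + k') * Rabs (Im z)))%R) by (apply exp_mono; nra).
  pose proof (exp_pos (k * Rabs (Im z))). pose proof (exp_pos (k' * Rabs (Im z))).
  destruct (S z Dz) as [D1|D1].
  - specialize (H z D1 ltac:(lra)). nra.
  - specialize (H' z D1 ltac:(lra)). nra.
Qed.

Lemma egrow_add (D : C -> Prop) (f g : C -> C) :
  egrow D f -> egrow D g -> egrow D (fun z => f z + g z).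
Proof.
  intros [K [k [Y [HK [Hk H]]]]] [K' [k' [Y' [HK' [Hk' H']]]]].
  exists (K + K')%R, (k + k')%R, (Rmax Y Y'). repeat split; try lra.
  intros z Dz Hz. pose proof (Rmax_l Y Y'); pose proof (Rmax_r Y Y'). pose proof (Rabs_pos (Im z)).
  assert (E1 : (exp (k * Rabs (Im z)) <= exp ((k + k') * Rabs (Im z)))%R) by (apply exp_mono; nra).
  assert (E2 : (exp (k' * Rabs (Im z)) <= exp ((k + k') * Rabs (Im z)))%R) by (apply exp_mono; nra).
  specialize (H z Dz ltac:(lra)). specialize (H' z Dz ltac:(lra)).
  eapply Rle_trans; [apply Cmod_triangle|]. nra.
Qed.

Lemma egrow_mul (D : C -> Prop) (f g : C -> C) :
  egrow D f -> egrow D g -> egrow D (fun z => f z * g z).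
Proof.
  intros [K [k [Y [HK [Hk H]]]]] [K' [k' [Y' [HK' [Hk' H']]]]].
  exists (K * K')%R, (k + k')%R, (Rmax Y Y'). repeat split; try lra; [now apply Rmult_le_pos|].
  intros z Dz Hz. pose proof (Rmax_l Y Y'); pose proof (Rmax_r Y Y').
  specialize (H z Dz ltac:(lra)). specialize (H' z Dz ltac:(lra)).
  rewrite Cmod_mult, Rmult_plus_distr_r, exp_plus.
  replace (K * K' * (exp (k * Rabs (Im z)) * exp (k' * Rabs (Im z))))%R
    with ((K * exp (k * Rabs (Im z))) * (K' * exp (k' * Rabs (Im z))))%R by ring.
  apply Rmult_le_compat; auto; apply Cmod_ge_0.
Qed.

Lemma egrow_const (D : C -> Prop) (c : C) : egrow D (fun _ => c).
Proof.
  exists (Cmod c), 0%R, 0%R. repeat split; try lra; [apply Cmod_ge_0|].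
  intros z _ _. rewrite Rmult_0_l, exp_0. lra.
Qed.

Lemma egrow_scal (D : C -> Prop) (c : C) (f : C -> C) : egrow D f -> egrow D (fun z => c * f z).
Proof. apply egrow_mul, egrow_const. Qed.

Lemma egrow_sub_fun (D : C -> Prop) (f g : C -> C) :
  egrow D f -> egrow D g -> egrow D (fun z => f z - g z).
Proof.
  intros H K. apply (egrow_ext D (fun z => f z + - (1) * g z) _ 0); [intros; ring|].
  apply egrow_add; auto. now apply egrow_scal.
Qed.

Lemma egrow_id (a b : R) : egrow (vstrip a b) (fun z => z).
Proof.
  exists (1 + Rabs a + Rabs b)%R, 1%R, 0%R.
  pose proof (Rabs_pos a); pose proof (Rabs_pos b).
  repeat split; try lra.
  intros z [Hz1 Hz2] _. eapply Rle_trans; [apply Cmod_le_Re_Im|].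
  assert (Rabs (Re z) <= Rabs a + Rabs b)%R.
  { pose proof (Rle_abs b). pose proof (Rle_abs (- a)). rewrite Rabs_Ropp in *. apply Rabs_le; lra. }
  pose proof (exp_ineq1_le (Rabs (Im z))). pose proof (Rabs_pos (Im z)).
  rewrite Rmult_1_l. nra.
Qed.

Lemma egrow_expi (D : C -> Prop) : egrow D expi.
Proof.
  exists 1%R, 1%R, 0%R. repeat split; try lra. intros z _ _. rewrite Cmod_expi, !Rmult_1_l.
  apply exp_mono. rewrite <- Rabs_Ropp. apply Rle_abs.
Qed.

Lemma egrow_expi_inv (D : C -> Prop) : egrow D (fun z => / expi z).
Proof.
  exists 1%R, 1%R, 0%R. repeat split; try lra. intros z _ _.
  rewrite <- expi_opp, Cmod_expi, !Rmult_1_l. apply exp_mono.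
  replace (- Im (- z))%R with (Im z) by (destruct z; unfold Im; simpl; ring). apply Rle_abs.
Qed.

Lemma egrow_shift (D D' : C -> Prop) (c : R) (f : C -> C) :
  (forall z, D' z -> D (z + RtoC c)) -> egrow D f -> egrow D' (fun z => f (z + RtoC c)).
Proof.
  intros S [K [k [Y [HK [Hk H]]]]]. exists K, k, Y. repeat split; auto.
  intros z Dz Hz. rewrite <- (Im_add_R z c). apply H; auto. now rewrite Im_add_R.
Qed.

Lemma egrow_le (D : C -> Prop) (f g : C -> C) (Y0 : R) :
  (forall z, D z -> (Y0 <= Rabs (Im z))%R -> (Cmod (g z) <= Cmod (f z))%R) -> egrow D f -> egrow D g.
Proof.
  intros E [K [k [Y [HK [Hk H]]]]]. exists K, k, (Rmax Y Y0). repeat split; auto.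
  intros z Dz Hz. pose proof (Rmax_l Y Y0); pose proof (Rmax_r Y Y0).
  eapply Rle_trans; [apply E; auto; lra|apply H; auto; lra].
Qed.

Ltac egrow_auto :=
  match goal with
  | |- egrow _ (fun _ => ?c) => apply egrow_const
  | |- egrow _ (fun z => z) => apply egrow_id
  | |- egrow _ (fun z => @?f z + @?g z) => apply (egrow_add _ f g); egrow_auto
  | |- egrow _ (fun z => @?f z - @?g z) => apply (egrow_sub_fun _ f g); egrow_auto
  | |- egrow _ (fun z => @?f z * @?g z) => apply (egrow_mul _ f g); egrow_auto
  | |- _ => auto
  end.

(** By Cauchy's estimate on squares of side [1/2]. *)
Lemma egrow_D (a b Y0 : R) (f : C -> C) :
  (forall z, vstrip a b z -> (Y0 <= Rabs (Im z))%R -> analytic_at f z) ->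
  egrow (vstrip a b) f -> egrow (vstrip (a + 1/4) (b - 1/4)) (C_derive f).
Proof.
  intros An [K [k [Y [HK [Hk H]]]]].
  exists (8 * K * exp k)%R, k, (Rmax Y Y0 + 1)%R.
  pose proof (exp_pos k). repeat split; auto; [apply Rmult_le_pos; lra|].
  intros z [Hz1 Hz2] Hy. pose proof (Rmax_l Y Y0); pose proof (Rmax_r Y Y0).
  assert (S : forall w, square z (1/4) w ->
    vstrip a b w /\ (Rabs (Im z) - 1 <= Rabs (Im w))%R /\ (Rabs (Im w) <= Rabs (Im z) + 1)%R).
  { intros w [W1 W2]. unfold vstrip.
    assert (A : (Rabs (Im w - Im z) <= 1/4)%R) by (apply Rabs_le; lra).
    pose proof (Rabs_triang_inv (Im z) (Im w)) as T1. pose proof (Rabs_triang_inv (Im w) (Im z)) as T2.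
    rewrite (Rabs_minus_sym (Im z)) in T1. lra. }
  replace (8 * K * exp k * exp (k * Rabs (Im z)))%R with (2 * (K * (exp k * exp (k * Rabs (Im z)))) / (1/4))%R by field.
  apply cauchy_estimate; [lra| |].
  - intros w Hw. destruct (S w Hw) as [S1 [S2 S3]]. apply An; auto; lra.
  - intros w Hw. destruct (S w Hw) as [S1 [S2 S3]]. eapply Rle_trans; [apply H; auto; lra|].
    apply Rmult_le_compat_l; auto. rewrite <- exp_plus. apply exp_mono. nra.
Qed.

(** A power of [expi] turns the growth at the upper end into boundedness. *)
Lemma egrow_polynomial (N : C -> C) : entire N -> (forall z, N (z + RtoC (2 * PI)) = N z) ->
  egrow univ N -> exists (m : nat) (P : C -> C), is_poly P /\ forall z, expi z ^ m * N z = P (expi z).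
Proof.
  intros En Per [K [k [Y [HK [Hk H]]]]].
  destruct (archimed k) as [A1 _]. set (m := Z.to_nat (up k)).
  assert (Hm : (k <= INR m)%R).
  { unfold m. rewrite INR_IZR_INZ, Z2Nat.id; [lra|]. apply le_IZR; lra. }
  assert (Mm : forall z, Cmod (expi z ^ m) = exp (INR m * - Im z)).
  { intros z. rewrite Cmod_pow, Cmod_expi. rewrite <- Rpower_pow by apply exp_pos.
    unfold Rpower. now rewrite ln_exp. }
  (* [periodic_polynomial n] allows the order [n - 1] at the lower end. *)
  destruct (periodic_polynomial (2 * m + 1) (fun z => expi z ^ m * N z) K (Rmax Y 0)) as [P [HP E]].
  - intros z. apply an_mul; [apply an_pow, an_expi|apply En].
  - intros z. now rewrite expi_period, Per.
  - intros z Hz. pose proof (Rmax_l Y 0); pose proof (Rmax_r Y 0).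
    rewrite Cmod_mult, Mm. specialize (H z I). rewrite Rabs_pos_eq in H by lra. specialize (H ltac:(lra)).
    pose proof (exp_pos (INR m * - Im z)).
    apply Rle_trans with (exp (INR m * - Im z) * (K * exp (k * Im z)))%R; [apply Rmult_le_compat_l; lra|].
    replace (exp (INR m * - Im z) * (K * exp (k * Im z)))%R with (K * (exp (INR m * - Im z) * exp (k * Im z)))%R by ring.
    rewrite <- exp_plus. rewrite <- (Rmult_1_r K) at 2. apply Rmult_le_compat_l; auto.
    rewrite <- exp_0. apply exp_mono. nra.
  - intros z Hz. pose proof (Rmax_l Y 0); pose proof (Rmax_r Y 0).
    rewrite Cmod_mult, Mm. specialize (H z I). rewrite Rabs_left1 in H by lra. specialize (H ltac:(lra)).
    pose proof (exp_pos (INR m * - Im z)).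
    apply Rle_trans with (exp (INR m * - Im z) * (K * exp (k * - Im z)))%R; [apply Rmult_le_compat_l; lra|].
    replace (exp (INR m * - Im z) * (K * exp (k * - Im z)))%R with (K * (exp (INR m * - Im z) * exp (k * - Im z)))%R by ring.
    rewrite <- exp_plus. apply Rmult_le_compat_l; auto. apply exp_mono.
    rewrite plus_INR, mult_INR. simpl (INR 2); simpl (INR 1). nra.
  - now exists m, P.
Qed.

(** Evenness and periodicity reduce the growth to half a period. *)
Lemma even_cylinder_extension (n : C -> C) :
  analytic_on (vstrip (- PI) PI) n ->
  (forall z, Re z = (- PI)%R -> near z (fun w => n (w + RtoC (2 * PI)) = n w)) ->
  near 0 (fun z => n (- z) = n z) ->
  egrow (vstrip (- PI) 0) n ->
  exists (N : C -> C) (m : nat) (P : C -> C),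
    entire N /\ (forall z, N (- z) = N z) /\
    (forall z, vstrip (- PI) PI z -> near z (fun w => N w = n w)) /\
    is_poly P /\ forall z, expi z ^ m * N z = P (expi z).
Proof.
  intros An Per Ev Gr. destruct (periodic_gluing n An Per) as [N [EN [PN Loc]]].
  pose proof PI_RGT_0.
  assert (NE : forall z, N (- z) = N z).
  { assert (L0 : near 0 (fun w => N w = n w)) by (apply Loc; unfold vstrip, Re; simpl; lra).
    assert (L1 : near 0 (fun w => N (0 - w) = n (0 - w))).
    { apply (near_reflect 0 0 (fun w => N w = n w)). now replace (0 - 0) with (RtoC 0) by ring. }
    intros z. assert (Z : N (0 - z) - N z = 0).
    { apply (identity_entire (fun z => N (0 - z) - N z) 0).
      - intros w. apply an_sub; [|apply EN]. apply an_reflect, EN.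
      - eapply near_imp; [|apply (near_and _ _ _ L0 (near_and _ _ _ L1 Ev))].
        cbn beta. intros w [A [B E]]. replace (0 - w) with (- w) in * by ring.
        rewrite A, B, E. ring. }
    replace (- z) with (0 - z) by ring. replace (N (0 - z)) with (N (0 - z) - N z + N z) by ring.
    rewrite Z; ring. }
  assert (GN : egrow (vstrip (- PI) 0) N).
  { apply (egrow_ext _ n _ 0); auto. intros z [Hz1 Hz2] _. symmetry.
    apply (near_self z (fun w => N w = n w)), Loc. unfold vstrip; lra. }
  destruct (egrow_polynomial N EN PN) as [m [P [HP E]]].
  - destruct GN as [K [k [Y [HK [Hk Hb]]]]]. exists K, k, Y. repeat split; auto.
    intros z _ Hz. destruct (reduce_period (Re z)) as [j Hj].
    set (z' := z + RtoC (2 * PI * IZR j)).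
    assert (Ez : N z = N z') by (symmetry; apply (period_Z N PN)).
    assert (Iz : Im z' = Im z) by apply Im_add_R.
    assert (Rz : (- PI <= Re z' < PI)%R) by (unfold z'; rewrite Re_add_R; lra).
    rewrite Ez, <- Iz. rewrite <- Iz in Hz. destruct (Rle_dec (Re z') 0) as [L|L].
    + apply Hb; auto. unfold vstrip; lra.
    + rewrite <- NE. replace (Rabs (Im z')) with (Rabs (Im (- z'))) in *.
      2:{ rewrite <- Rabs_Ropp. f_equal. destruct z'; unfold Im; simpl; ring. }
      apply Hb; auto. unfold vstrip. replace (Re (- z')) with (- Re z')%R by (destruct z'; reflexivity). lra.
  - exists N, m, P. repeat split; auto.
Qed.

(** * The branching function and its Wronskians *)

Notation tau := (RtoC (2 * PI)).
Definition eta : C := RtoC (PI / 2).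

Lemma tau_eta : tau = 4 * eta.
Proof. unfold eta. rewrite <- RtoC_mult. f_equal. field. Qed.

Lemma tau2 : RtoC (4 * PI) = tau + tau.
Proof. rewrite <- RtoC_plus. f_equal. ring. Qed.

(** [ramif] vanishes at the branch points of [T], [ramif_tau] at those of its
    translate by [tau]. *)
Definition ramif (z : C) : C := (z + eta) * (z - 5 * eta).
Definition ramif_tau (z : C) : C := (z + 5 * eta) * (z - eta).
Definition dramif (z : C) : C := 2 * z - 4 * eta.
Definition dramif_tau (z : C) : C := 2 * z + 4 * eta.

Lemma ramif_tau_shift (z : C) : ramif_tau z = ramif (z + tau).
Proof. rewrite tau_eta. unfold ramif, ramif_tau. ring. Qed.

Lemma dramif_tau_shift (z : C) : dramif_tau z = dramif (z + tau).
Proof. rewrite tau_eta. unfold dramif, dramif_tau. ring. Qed.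

Lemma an_ramif (z : C) : analytic_at ramif z.
Proof. unfold ramif; an. Qed.

Lemma an_dramif (z : C) : analytic_at dramif z.
Proof. unfold dramif; an. Qed.

Lemma an_ramif_tau (z : C) : analytic_at ramif_tau z.
Proof. unfold ramif_tau; an. Qed.

Lemma an_dramif_tau (z : C) : analytic_at dramif_tau z.
Proof. unfold dramif_tau; an. Qed.

#[local] Hint Resolve an_ramif an_dramif an_ramif_tau an_dramif_tau : analytic.

Lemma D_ramif (z : C) : C_derive ramif z = dramif z.
Proof. unfold ramif, dramif. D_expand. ring. Qed.

Lemma D_dramif (z : C) : C_derive dramif z = 2.
Proof. unfold dramif. D_expand. ring. Qed.

(** If [s * s = p] and [U = s * A], then [2 p U' = s * jet1] and
    [4 p ^ 2 U'' = s * jet2]: the square root factors out of all derivatives. *)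
Definition jet1 (p dp A A1 : C) : C := dp * A + 2 * p * A1.
Definition jet2 (p dp A A1 A2 : C) : C := 4 * p * A + 4 * p * dp * A1 + 4 * p * p * A2 - dp * dp * A.

Definition wron (U U1 : C -> C) (z : C) : C := U z * U1 (z + tau) - U1 z * U (z + tau).

(** Up to the square roots and powers of the ramification polynomials,
    [wron_core] and [wron2_core] are the Wronskians of [U] and its translate and of
    their derivatives.  They are analytic at the branch points. *)
Definition wron_core (h : C -> C) (z : C) : C :=
  ramif z * h z * jet1 (ramif_tau z) (dramif_tau z) (h (z + tau)) (C_derive h (z + tau))
  - ramif_tau z * h (z + tau) * jet1 (ramif z) (dramif z) (h z) (C_derive h z).

Definition wron2_core (h : C -> C) (z : C) : C :=
  ramif z * jet1 (ramif z) (dramif z) (h z) (C_derive h z)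
       * jet2 (ramif_tau z) (dramif_tau z) (h (z + tau)) (C_derive h (z + tau)) (C_derive (C_derive h) (z + tau))
  - ramif_tau z * jet2 (ramif z) (dramif z) (h z) (C_derive h z) (C_derive (C_derive h) z)
       * jet1 (ramif_tau z) (dramif_tau z) (h (z + tau)) (C_derive h (z + tau)).

Definition ccos (z : C) : C := (expi z + / expi z) / 2.

Lemma an_ccos (z : C) : analytic_at ccos z.
Proof.
  apply an_mul; [|apply an_const]. apply an_add; [apply an_expi|].
  apply an_inv; [apply an_expi|apply expi_neq0].
Qed.

#[local] Hint Resolve an_ccos : analytic.

Lemma two_neq0 : RtoC 2 <> 0.
Proof. apply RtoC_neq0; lra. Qed.

Lemma ccos_opp (z : C) : ccos (- z) = ccos z.
Proof. unfold ccos. rewrite expi_opp. field; repeat split; auto using two_neq0, expi_neq0. Qed.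

Lemma ccos_period (z : C) : ccos (z + tau) = ccos z.
Proof. unfold ccos. now rewrite expi_period. Qed.

Lemma ccos_expi (z : C) : 2 * expi z * ccos z = expi z ^ 2 + 1.
Proof. unfold ccos. simpl. field; repeat split; auto using two_neq0, expi_neq0. Qed.

Lemma ccos_real (x : R) : ccos (RtoC x) = RtoC (cos x).
Proof.
  unfold ccos. rewrite <- expi_opp. replace (- RtoC x) with (RtoC (- x)) by (now rewrite RtoC_opp).
  rewrite !expi_real. unfold cis. rewrite cos_neg, sin_neg.
  replace ((cos x, sin x) + (cos x, (- sin x)%R)) with (2 * RtoC (cos x)).
  - field; auto using two_neq0.
  - unfold RtoC, Cplus, Cmult; simpl. f_equal; ring.
Qed.

Lemma D_ccos (z : C) : C_derive ccos z = Ci * (expi z - / expi z) / 2.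
Proof.
  rewrite (D_ext (fun z => / 2 * (expi z + expi (0 - z)))).
  - D_expand. rewrite !D_expi. replace (0 - z) with (- z) by ring. rewrite expi_opp.
    field; repeat split; auto using two_neq0, expi_neq0.
  - apply near_true. intros w. unfold ccos. replace (0 - w) with (- w) by ring. rewrite expi_opp.
    field; repeat split; auto using two_neq0, expi_neq0.
  - an.
Qed.

Lemma eta_neq0 : eta <> 0.
Proof. apply RtoC_neq0. pose proof PI_RGT_0; lra. Qed.

Lemma divide_root (f : C -> C) (a : C) : entire f -> f a = 0 ->
  exists g, entire g /\ forall z, f z = (z - a) * g z.
Proof.
  intros E Z. exists (dquot f a). split.
  - intros z. apply an_dquot; apply E.
  - intros z. rewrite <- dquot_mul, Z. ring.
Qed.

Lemma cos_half_odd : (cos (- (PI / 2)) = 0 /\ cos (5 * (PI / 2)) = 0 /\ cos (- (5 * (PI / 2))) = 0)%R.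
Proof.
  assert (E : cos (5 * (PI / 2)) = 0%R).
  { replace (5 * (PI / 2))%R with (PI / 2 + 2 * PI)%R by field.
    rewrite cos_plus, cos_2PI, sin_2PI, cos_PI2. ring. }
  repeat split; auto; rewrite cos_neg; auto using cos_PI2.
Qed.

(** The cosine vanishes at the branch points of [T] and of its translate. *)
Lemma ccos_factor : exists kap, entire kap /\ forall z, ccos z = ramif z * ramif_tau z * kap z.
Proof.
  destruct cos_half_odd as [C1 [C2 C3]]. pose proof eta_neq0 as E0.
  assert (N : forall k : R, k <> 0%R -> RtoC k * eta <> 0).
  { intros k Hk. apply Cmult_neq_0; auto. now apply RtoC_neq0. }
  destruct (divide_root ccos (- eta)) as [f1 [H1 F1]].
  { exact an_ccos. }
  { unfold eta. rewrite <- RtoC_opp, ccos_real, C1. reflexivity. }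
  destruct (divide_root f1 eta) as [f2 [H2 F2]]; auto.
  { assert (X : ccos eta = 0) by (unfold eta; rewrite ccos_real, cos_PI2; reflexivity).
    rewrite F1 in X. replace (eta - - eta) with (2 * eta) in X by ring.
    apply NNPP; intros M. exact (Cmult_neq_0 _ _ (N 2%R ltac:(lra)) M X). }
  destruct (divide_root f2 (5 * eta)) as [f3 [H3 F3]]; auto.
  { assert (X : ccos (5 * eta) = 0) by (unfold eta; rewrite <- RtoC_mult, ccos_real, C2; reflexivity).
    rewrite F1, F2 in X. replace (5 * eta - - eta) with (6 * eta) in X by ring.
    replace (5 * eta - eta) with (4 * eta) in X by ring.
    apply NNPP; intros M. exact (Cmult_neq_0 _ _ (N 6%R ltac:(lra)) (Cmult_neq_0 _ _ (N 4%R ltac:(lra)) M) X). }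
  destruct (divide_root f3 (- (5 * eta))) as [f4 [H4 F4]]; auto.
  { assert (X : ccos (- (5 * eta)) = 0).
    { unfold eta; rewrite <- RtoC_mult, <- RtoC_opp, ccos_real, C3; reflexivity. }
    rewrite F1, F2, F3 in X. replace (- (5 * eta) - - eta) with (- (4) * eta) in X by ring.
    replace (- (5 * eta) - eta) with (- (6) * eta) in X by ring.
    replace (- (5 * eta) - 5 * eta) with (- (10) * eta) in X by ring.
    rewrite <- !RtoC_opp in X.
    apply NNPP; intros M. exact (Cmult_neq_0 _ _ (N (-4)%R ltac:(lra)) (Cmult_neq_0 _ _ (N (-6)%R ltac:(lra))
      (Cmult_neq_0 _ _ (N (-10)%R ltac:(lra)) M)) X). }
  exists f4. split; auto. intros z. rewrite F1, F2, F3, F4. unfold ramif, ramif_tau. ring.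
Qed.

(** [U] agrees with [T] on [slit_strip] and is analytic in a neighbourhood of each
    point of it, those on the edges included. *)
Record branch (lam : C) (sg h U : C -> C) : Prop := {
  br_sg : analytic_on slit_strip sg;
  br_sq : forall b, slit_strip b -> sg b * sg b = ramif b;
  br_h : analytic_on strip h;
  br_U : forall b, U b = sg b * h b;
  br_shift : shift_equation lam U;
  br_growth : exp_growth U;
  br_sym : reflection_symmetric U
}.

Lemma slit_strip_mono (z w : C) : slit_strip z -> Re w = Re z ->
  (Re z = 5 * PI / 2 -> Im w <= Im z)%R -> (Re z <> 5 * PI / 2 -> Im z <= Im w)%R -> slit_strip w.
Proof.
  intros [S [N1 N2]] E L1 L2. pose proof PI_RGT_0. unfold slit_strip, strip. rewrite E. split; [exact S|]. split.
  - intros [A B]. apply N1. split; auto. specialize (L2 ltac:(lra)). lra.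
  - intros [A B]. apply N2. split; auto. specialize (L1 A). lra.
Qed.

(** Identities pass from [slit_strip] to a neighbourhood of each of its points,
    those on its edges included. *)
Lemma slit_strip_zero (f : C -> C) (z : C) : slit_strip z -> analytic_at f z ->
  (forall b, slit_strip b -> f b = 0) -> near z (fun w => f w = 0).
Proof.
  intros S An H. apply an_zero_accum; auto. intros eps He.
  assert (V : forall t : R, (t <> 0)%R -> (Rabs t < eps)%R ->
     z + Ci * RtoC t <> z /\ (Cmod (z + Ci * RtoC t - z) < eps)%R).
  { intros t T0 T1. replace (z + Ci * RtoC t - z) with (Ci * RtoC t) by ring.
    rewrite Cmod_mult, Cmod_Ci, Cmod_R. split; [|lra]. intros E.
    assert (X : Ci * RtoC t = 0) by (replace (Ci * RtoC t) with (z + Ci * RtoC t - z) by ring; rewrite E; ring).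
    unfold Ci, Cmult, RtoC in X; simpl in X. injection X. lra. }
  assert (RI : forall t, Re (z + Ci * RtoC t) = Re z /\ Im (z + Ci * RtoC t) = (Im z + t)%R).
  { intros t. destruct z; unfold Re, Im, Ci; simpl. split; ring. }
  destruct (Req_dec (Re z) (5 * PI / 2)) as [E|N].
  - destruct (V (- (eps / 2))%R) as [V1 V2]; [lra| |].
    { rewrite Rabs_Ropp, Rabs_pos_eq; lra. }
    exists (z + Ci * RtoC (- (eps / 2))). repeat split; auto. apply H.
    destruct (RI (- (eps / 2))%R) as [R1 R2].
    apply (slit_strip_mono z); auto; intros; rewrite ?R2; [lra|contradiction].
  - destruct (V (eps / 2)%R) as [V1 V2]; [lra| |].
    { rewrite Rabs_pos_eq; lra. }
    exists (z + Ci * RtoC (eps / 2)). repeat split; auto. apply H.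
    destruct (RI (eps / 2)%R) as [R1 R2].
    apply (slit_strip_mono z); auto; intros; rewrite ?R2; [contradiction|lra].
Qed.

(** * Local formulas for the Wronskians and their symmetries *)

Lemma slit_in_strip (z : C) : slit_strip z -> strip z.
Proof. now intros [H _]. Qed.

Lemma br_an lam sg h U : branch lam sg h U -> forall z, slit_strip z -> analytic_at U z.
Proof.
  intros B z Hz. apply (an_ext (fun w => sg w * h w)).
  - apply near_true. intros w. symmetry. apply (br_U _ _ _ _ B).
  - apply an_mul; [now apply (br_sg _ _ _ _ B)|now apply (br_h _ _ _ _ B), slit_in_strip].
Qed.

Lemma Cmult_eq_0 (a b : C) : a * b = 0 -> a = 0 \/ b = 0.
Proof.
  intros H. destruct (Ceq_dec a 0); auto. destruct (Ceq_dec b 0); auto.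
  exfalso. now apply (Cmult_neq_0 a b).
Qed.

Lemma Cmult_reg_l (a b c : C) : a <> 0 -> a * b = a * c -> b = c.
Proof.
  intros N E. replace b with (/ a * (a * b)) by (field; auto). rewrite E. field; auto.
Qed.

Lemma ramif_neq0 (z : C) : slit_strip z -> ramif z <> 0.
Proof.
  intros [S [N1 N2]] E. apply Cmult_eq_0 in E. unfold eta in E. destruct E as [E|E].
  - apply N1. replace z with (RtoC (- (PI / 2))).
    + unfold Re, Im; simpl; split; lra.
    + rewrite RtoC_opp. replace z with (z + RtoC (PI / 2) - RtoC (PI / 2)) by ring. rewrite E; ring.
  - apply N2. replace z with (RtoC (5 * (PI / 2))).
    + unfold Re, Im; simpl; split; lra.
    + rewrite RtoC_mult. replace z with (z - 5 * RtoC (PI / 2) + 5 * RtoC (PI / 2)) by ring. rewrite E; ring.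
Qed.

Lemma sg_sq_near lam sg h U : branch lam sg h U -> forall z, slit_strip z ->
  near z (fun w => sg w * sg w = ramif w).
Proof.
  intros B z Hz. pose proof (br_sg _ _ _ _ B z Hz) as A.
  eapply near_imp; [|apply (slit_strip_zero (fun w => sg w * sg w - ramif w) z Hz)].
  - intros w E. cbn beta in E. replace (sg w * sg w) with (sg w * sg w - ramif w + ramif w) by ring. rewrite E; ring.
  - an.
  - intros b Hb. rewrite (br_sq _ _ _ _ B b Hb). ring.
Qed.

Definition jet (sg h U : C -> C) (w : C) : Prop :=
  sg w * sg w = ramif w /\
  2 * ramif w * C_derive U w = sg w * jet1 (ramif w) (dramif w) (h w) (C_derive h w) /\
  4 * ramif w * ramif w * C_derive (C_derive U) w
    = sg w * jet2 (ramif w) (dramif w) (h w) (C_derive h w) (C_derive (C_derive h) w).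

Lemma branch_jet lam sg h U : branch lam sg h U -> forall z, slit_strip z ->
  near z (fun w => ramif w <> 0 /\ jet sg h U w).
Proof.
  intros B z Hz. pose proof (br_sg _ _ _ _ B z Hz) as As.
  pose proof (br_h _ _ _ _ B z (slit_in_strip z Hz)) as Ah.
  assert (N1 : near z (fun w => ramif w <> 0 /\ analytic_at sg w /\ analytic_at h w /\
     near w (fun v => sg v * sg v = ramif v))).
  { apply near_and; [apply an_ne0; [apply an_ramif|now apply ramif_neq0]|].
    apply near_and; [now apply an_near|]. apply near_and; [now apply an_near|].
    apply near_near. eapply sg_sq_near; eauto. }
  assert (N2 : near z (fun w => 2 * ramif w * C_derive U w = sg w * jet1 (ramif w) (dramif w) (h w) (C_derive h w)
     /\ 2 * sg w * C_derive sg w = dramif w /\ analytic_at U w)).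
  { eapply near_imp; [|exact N1]. intros w [_ [Asw [Ahw Sq]]].
    assert (D1 : 2 * sg w * C_derive sg w = dramif w).
    { rewrite <- D_ramif. rewrite (D_ext (fun v => sg v * sg v) ramif w Sq) by now apply an_mul.
      D_expand. ring. }
    assert (EU : near w (fun v => sg v * h v = U v)).
    { apply near_true; intros v; symmetry; apply (br_U _ _ _ _ B). }
    split; [|split; auto].
    - rewrite (D_ext (fun v => sg v * h v) U w EU) by now apply an_mul.
      D_expand. unfold jet1. rewrite <- D1, <- (near_self _ _ Sq). ring.
    - apply (an_ext (fun v => sg v * h v)); auto. now apply an_mul. }
  eapply near_imp; [|apply (near_and _ _ _ N1 (near_near _ _ N2))].
  intros w [[P0 [Asw [Ahw Sq]]] N2w]. cbn beta in *.
  destruct (near_self _ _ N2w) as [E1 [D1 AU]].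
  pose proof (near_self _ _ Sq) as Sq0. cbn beta in Sq0.
  split; auto. repeat split; auto.
  set (F := fun v => 2 * ramif v * C_derive U v).
  set (G := fun v => sg v * (dramif v * h v + 2 * ramif v * C_derive h v)).
  pose proof (an_D _ _ AU) as AU1. pose proof (an_D _ _ Ahw) as Ah1.
  pose proof (an_ramif w) as Ap. pose proof (an_dramif w) as Adp.
  assert (DF : C_derive F w = 2 * dramif w * C_derive U w + 2 * ramif w * C_derive (C_derive U) w).
  { unfold F. D_expand. rewrite D_ramif. ring. }
  assert (DG : C_derive G w = C_derive sg w * jet1 (ramif w) (dramif w) (h w) (C_derive h w)
     + sg w * (2 * h w + 3 * dramif w * C_derive h w + 2 * ramif w * C_derive (C_derive h) w)).
  { unfold G. D_expand. rewrite D_ramif, D_dramif. unfold jet1. ring. }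
  assert (FG : C_derive F w = C_derive G w).
  { apply D_ext; [|unfold G; an]. eapply near_imp; [|exact N2w].
    intros v [Ev _]. unfold F, G. rewrite Ev. reflexivity. }
  rewrite DF, DG in FG. apply (f_equal (fun t => 2 * ramif w * t)) in FG.
  unfold jet1, jet2 in *. set (p := ramif w) in *. set (dp := dramif w) in *. set (s := sg w) in *.
  set (s1 := C_derive sg w) in *. set (u1 := C_derive U w) in *. set (u2 := C_derive (C_derive U) w) in *.
  set (a := h w) in *. set (a1 := C_derive h w) in *. set (a2 := C_derive (C_derive h) w) in *.
  replace (4 * p * p * u2) with (2 * p * (2 * dp * u1 + 2 * p * u2) - 2 * dp * (2 * p * u1)) by ring.
  rewrite FG, E1.
  replace (2 * p * (s1 * (dp * a + 2 * p * a1) + s * (2 * a + 3 * dp * a1 + 2 * p * a2)))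
    with (2 * p * s1 * (dp * a + 2 * p * a1) + 2 * p * s * (2 * a + 3 * dp * a1 + 2 * p * a2)) by ring.
  replace (2 * p * s1) with (s * dp) by (rewrite <- D1, <- Sq0; ring). ring.
Qed.

Definition wron_sq (kap h : C -> C) (z : C) : C := kap z * wron_core h z ^ 2.
Definition wron_mix (kap h : C -> C) (z : C) : C := kap z ^ 2 * (wron_core h z * wron2_core h z).

(** Elimination from the equations for [U] and its translate gives
    [f = - wronskian' / wronskian] and [g = wronskian2 / wronskian]. *)
Definition wronskian (U : C -> C) : C -> C := wron U (C_derive U).
Definition wronskian2 (U : C -> C) : C -> C := wron (C_derive U) (C_derive (C_derive U)).

Definition wron_formula (kap h U : C -> C) (w : C) : Prop :=
  wron_sq kap h w = 4 * wronskian U w ^ 2 * ccos w /\ wron_mix kap h w = 16 * (wronskian U w * wronskian2 U w) * ccos w ^ 2.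

Lemma local_formula lam sg h U kap : branch lam sg h U ->
  (forall z, ccos z = ramif z * ramif_tau z * kap z) ->
  forall z, slit_strip z -> slit_strip (z + tau) -> near z (wron_formula kap h U).
Proof.
  intros B Hk z Hz Hz'.
  eapply near_imp; [|apply (near_and _ _ _ (branch_jet _ _ _ _ B z Hz)
     (near_shift _ _ _ (branch_jet _ _ _ _ B (z + tau) Hz')))].
  intros w [[P0 [S [E1 E2]]] [Q0 [S' [E1' E2']]]].
  rewrite <- ramif_tau_shift in *. rewrite <- dramif_tau_shift in *.
  unfold wron_formula, wron_sq, wron_mix, wronskian, wronskian2, wron, wron_core, wron2_core. rewrite !Hk, (br_U _ _ _ _ B w), (br_U _ _ _ _ B (w + tau)).
  set (p := ramif w) in *. set (q := ramif_tau w) in *. set (k := kap w) in *.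
  set (s := sg w) in *. set (t := sg (w + tau)) in *.
  set (x1 := jet1 p (dramif w) (h w) (C_derive h w)) in *.
  set (x2 := jet2 p (dramif w) (h w) (C_derive h w) (C_derive (C_derive h) w)) in *.
  set (y1 := jet1 q (dramif_tau w) (h (w + tau)) (C_derive h (w + tau))) in *.
  set (y2 := jet2 q (dramif_tau w) (h (w + tau)) (C_derive h (w + tau)) (C_derive (C_derive h) (w + tau))) in *.
  set (u1 := C_derive U w) in *. set (u2 := C_derive (C_derive U) w) in *.
  set (v1 := C_derive U (w + tau)) in *. set (v2 := C_derive (C_derive U) (w + tau)) in *.
  set (a := h w) in *. set (b := h (w + tau)) in *.
  assert (PQ : p * q <> 0) by now apply Cmult_neq_0.
  assert (X : 2 * (p * q) * (s * a * v1 - u1 * (t * b)) = s * t * (p * a * y1 - q * b * x1)).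
  { replace (2 * (p * q) * (s * a * v1 - u1 * (t * b)))
      with (p * s * a * (2 * q * v1) - q * t * b * (2 * p * u1)) by ring.
    rewrite E1, E1'. ring. }
  assert (Y : 8 * (p * q) * (p * q) * (u1 * v2 - u2 * v1) = s * t * (p * x1 * y2 - q * x2 * y1)).
  { replace (8 * (p * q) * (p * q) * (u1 * v2 - u2 * v1))
      with (p * (2 * p * u1) * (4 * q * q * v2) - q * (4 * p * p * u2) * (2 * q * v1)) by ring.
    rewrite E1, E1', E2, E2'. ring. }
  set (Wr := s * a * v1 - u1 * (t * b)) in *. set (Vr := u1 * v2 - u2 * v1) in *.
  set (wv := p * a * y1 - q * b * x1) in *. set (vvv := p * x1 * y2 - q * x2 * y1) in *.
  assert (ST : s * t * (s * t) = p * q) by (rewrite <- S, <- S'; ring).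
  assert (R1 : wv ^ 2 = 4 * (p * q) * Wr ^ 2).
  { apply (Cmult_reg_l (p * q)); auto.
    replace (p * q * wv ^ 2) with ((s * t * wv) * (s * t * wv)) by (rewrite <- ST; ring).
    rewrite <- X. ring. }
  assert (R2 : wv * vvv = 16 * (p * q) * (p * q) * (Wr * Vr)).
  { apply (Cmult_reg_l (p * q)); auto.
    replace (p * q * (wv * vvv)) with ((s * t * wv) * (s * t * vvv)) by (rewrite <- ST; ring).
    rewrite <- X, <- Y. ring. }
  split.
  - rewrite R1. ring.
  - rewrite R2. ring.
Qed.

Lemma slit_left (z : C) : Re z = (- PI)%R -> slit_strip z /\ slit_strip (z + tau) /\ slit_strip (z + tau + tau).
Proof.
  intros E. pose proof PI_RGT_0. unfold slit_strip, strip. rewrite !Re_add_R, E. repeat split; try lra; intros [X Y]; lra.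
Qed.

(** The functional equation is given on the line [Re z = - PI] only, but zeros on a
    line accumulate. *)
Lemma shift_near lam sg h U : branch lam sg h U -> forall z, Re z = (- PI)%R ->
  near z (fun w => U (w + tau + tau) = lam * U (w + tau) - U w /\
     C_derive U (w + tau + tau) = lam * C_derive U (w + tau) - C_derive U w /\
     C_derive (C_derive U) (w + tau + tau) = lam * C_derive (C_derive U) (w + tau) - C_derive (C_derive U) w).
Proof.
  intros B z E. destruct (slit_left z E) as [S0 [S1 S2]].
  pose proof (br_an _ _ _ _ B z S0) as A0.
  pose proof (br_an _ _ _ _ B _ S1) as A1. pose proof (br_an _ _ _ _ B _ S2) as A2.
  assert (AN : near z (fun w => analytic_at U w /\ analytic_at U (w + tau) /\ analytic_at U (w + tau + tau))).
  { apply near_and; [now apply an_near|]. apply near_and.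
    - apply (near_shift z tau (analytic_at U)). now apply an_near.
    - apply (near_shift z tau (fun v => analytic_at U (v + tau))).
      apply (near_shift (z + tau) tau (analytic_at U)). now apply an_near. }
  assert (Sh2 : forall (f : C -> C) w, analytic_at f (w + tau + tau) ->
     analytic_at (fun v => f (v + tau + tau)) w /\ C_derive (fun v => f (v + tau + tau)) w = C_derive f (w + tau + tau)).
  { intros f w Hf. pose proof (an_shift (fun v => f (v + tau)) tau w (an_shift f tau _ Hf)).
    split; auto. rewrite (D_shift (fun v => f (v + tau)) tau w) by an. now D_expand. }
  assert (N0 : near z (fun w => U (w + tau + tau) = lam * U (w + tau) - U w)).
  { set (F := fun w => U w + U (w + tau + tau) - lam * U (w + tau)).
    assert (AF : analytic_at F z).
    { destruct (Sh2 U z A2). unfold F. an. }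
    eapply near_imp; [|apply (an_zero_accum F z AF)].
    - intros w Hw. replace (U (w + tau + tau)) with (F w + lam * U (w + tau) - U w) by (unfold F; ring).
      rewrite Hw; ring.
    - intros eps He. exists (z + Ci * RtoC (eps / 2)).
      assert (Hn : Ci * RtoC (eps / 2) <> 0).
      { apply Cmult_neq_0; [intros X; injection X; lra|apply RtoC_neq0; lra]. }
      repeat split.
      + intros X. apply Hn. replace (Ci * RtoC (eps / 2)) with (z + Ci * RtoC (eps / 2) - z) by ring. rewrite X; ring.
      + replace (z + Ci * RtoC (eps / 2) - z) with (Ci * RtoC (eps / 2)) by ring.
        rewrite Cmod_mult, Cmod_Ci, Cmod_R, Rabs_pos_eq; lra.
      + unfold F. rewrite <- Cplus_assoc, <- tau2. apply (br_shift _ _ _ _ B).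
        rewrite <- E. destruct z; unfold Re, Ci; simpl; ring. }
  assert (Step : forall f : C -> C,
     near z (fun w => analytic_at f w /\ analytic_at f (w + tau) /\ analytic_at f (w + tau + tau)) ->
     near z (fun w => f (w + tau + tau) = lam * f (w + tau) - f w) ->
     near z (fun w => C_derive f (w + tau + tau) = lam * C_derive f (w + tau) - C_derive f w)).
  { intros f Af Ef. eapply near_imp; [|apply (near_and _ _ _ Af (near_near _ _ Ef))].
    intros w [[F0 [F1 F2]] Ew]. destruct (Sh2 f w F2) as [_ <-].
    rewrite (D_ext (fun v => lam * f (v + tau) - f v) (fun v => f (v + tau + tau))).
    - D_expand. ring.
    - eapply near_imp; [|exact Ew]. auto.
    - an. }
  assert (N1 := Step U AN N0).
  assert (N2 : near z (fun w => C_derive (C_derive U) (w + tau + tau)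
     = lam * C_derive (C_derive U) (w + tau) - C_derive (C_derive U) w)).
  { apply Step; auto. eapply near_imp; [|exact AN]. intros w [F0 [F1 F2]]. repeat split; now apply an_D. }
  exact (near_and _ _ _ N0 (near_and _ _ _ N1 N2)).
Qed.

(** The shift maps the pair [(U, U (. + tau))] by a matrix of determinant one. *)
Lemma periodic_near lam sg h U kap : branch lam sg h U ->
  (forall z, ccos z = ramif z * ramif_tau z * kap z) ->
  forall z, Re z = (- PI)%R ->
  near z (fun w => wron_sq kap h (w + tau) = wron_sq kap h w /\ wron_mix kap h (w + tau) = wron_mix kap h w).
Proof.
  intros B Hk z E. destruct (slit_left z E) as [S0 [S1 S2]].
  eapply near_imp; [|apply (near_and _ _ _ (local_formula _ _ _ _ _ B Hk z S0 S1)
    (near_and _ _ _ (near_shift _ _ _ (local_formula _ _ _ _ _ B Hk (z + tau) S1 S2)) (shift_near _ _ _ _ B z E)))].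
  intros w [[N0 G0] [[N1 G1] [E0 [E1 E2]]]].
  assert (WW : wronskian U (w + tau) = wronskian U w) by (unfold wronskian, wron; rewrite E0, E1; ring).
  assert (VV : wronskian2 U (w + tau) = wronskian2 U w) by (unfold wronskian2, wron; rewrite E1, E2; ring).
  rewrite N0, N1, G0, G1, WW, VV, ccos_period. auto.
Qed.

Lemma slit_center (z : C) : (Rabs (Re z) < 1)%R -> slit_strip z /\ slit_strip (z + tau).
Proof.
  intros H. apply Rabs_def2 in H. pose proof PI2_1. unfold slit_strip, strip. rewrite Re_add_R.
  repeat split; try lra; intros [X Y]; lra.
Qed.

Lemma slit_0 : slit_strip 0 /\ slit_strip (0 + tau).
Proof. apply slit_center. unfold Re; simpl. rewrite Rabs_R0; lra. Qed.

(** [U b = U (2 pi - b)] at [b = - w], and its derivatives. *)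
Lemma reflect_near lam sg h U : branch lam sg h U ->
  near 0 (fun w => U (- w) = U (w + tau) /\ C_derive U (- w) = - C_derive U (w + tau) /\
     C_derive (C_derive U) (- w) = C_derive (C_derive U) (w + tau)).
Proof.
  intros B. destruct slit_0 as [S0 S1].
  assert (N : near 0 (fun w => U (- w) = U (w + tau) /\ analytic_at U (- w) /\ analytic_at U (w + tau))).
  { exists 1%R. split; [lra|]. intros w Hw. replace (w - 0) with w in Hw by ring.
    pose proof (re_le_Cmod w) as R.
    assert (Sw : slit_strip w /\ slit_strip (w + tau)) by (apply slit_center; lra).
    assert (Rm : (Rabs (Re (- w)) < 1)%R).
    { replace (Re (- w)) with (- Re w)%R by (destruct w; reflexivity). rewrite Rabs_Ropp; lra. }
    destruct Sw as [Sw1 Sw2]. destruct (slit_center _ Rm) as [Sm1 Sm2].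
    repeat split; try (now apply (br_an _ _ _ _ B)).
    rewrite (br_sym _ _ _ _ B (- w) Sm1). f_equal. ring. }
  assert (Step : forall c (f : C -> C), near 0 (fun w => f (- w) = c * f (w + tau) /\ analytic_at f (- w) /\ analytic_at f (w + tau)) ->
     near 0 (fun w => C_derive f (- w) = - c * C_derive f (w + tau) /\ analytic_at (C_derive f) (- w) /\ analytic_at (C_derive f) (w + tau))).
  { intros c f H. eapply near_imp; [|apply near_near, H]. intros w Nw.
    destruct (near_self _ _ Nw) as [_ [A1 A2]]. split; [|split; now apply an_D].
    assert (A1' : analytic_at f (0 - w)) by (now replace (0 - w) with (- w) by ring).
    pose proof (D_reflect f 0 w A1') as R. replace (0 - w) with (- w) in R by ring.
    rewrite (D_ext (fun v => c * f (v + tau)) (fun v => f (0 - v))) in R.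
    - revert R. D_expand. intros R.
      replace (C_derive f (- w)) with (- - C_derive f (- w)) by ring. rewrite <- R. ring.
    - eapply near_imp; [|exact Nw]. intros v [Ev _]. replace (0 - v) with (- v) by ring. now symmetry.
    - an. }
  assert (N0 : near 0 (fun w => U (- w) = 1 * U (w + tau) /\ analytic_at U (- w) /\ analytic_at U (w + tau))).
  { eapply near_imp; [|exact N]. intros w [E A]. split; auto. rewrite E; ring. }
  pose proof (Step _ _ N0) as N1. pose proof (Step _ _ N1) as N2.
  eapply near_imp; [|apply (near_and _ _ _ N (near_and _ _ _ N1 N2))].
  intros w [[E0 _] [[E1 _] [E2 _]]]. rewrite E0, E1, E2. repeat split; ring.
Qed.

Lemma even_near lam sg h U kap : branch lam sg h U ->
  (forall z, ccos z = ramif z * ramif_tau z * kap z) ->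
  near 0 (fun w => wron_sq kap h (- w) = wron_sq kap h w /\ wron_mix kap h (- w) = wron_mix kap h w).
Proof.
  intros B Hk. destruct slit_0 as [S0 S1].
  pose proof (local_formula _ _ _ _ _ B Hk 0 S0 S1) as L.
  assert (L' : near 0 (fun w => wron_formula kap h U (0 - w))).
  { apply near_reflect. now replace (0 - 0) with (RtoC 0) by ring. }
  assert (R' : near 0 (fun w => U (- (0 - w)) = U (0 - w + tau) /\ C_derive U (- (0 - w)) = - C_derive U (0 - w + tau) /\
     C_derive (C_derive U) (- (0 - w)) = C_derive (C_derive U) (0 - w + tau))).
  { apply (near_reflect 0 0 (fun w => U (- w) = U (w + tau) /\ C_derive U (- w) = - C_derive U (w + tau) /\
     C_derive (C_derive U) (- w) = C_derive (C_derive U) (w + tau))).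
    replace (0 - 0) with (RtoC 0) by ring. eapply reflect_near; eauto. }
  eapply near_imp; [|apply (near_and _ _ _ L (near_and _ _ _ L' (near_and _ _ _ R' (reflect_near _ _ _ _ B))))].
  intros w [[N0 G0] [[N1 G1] [[F0 [F1 F2]] [E0 [E1 E2]]]]].
  replace (0 - w) with (- w) in * by ring. replace (- - w) with w in * by ring.
  assert (WW : wronskian U (- w) = wronskian U w).
  { unfold wronskian, wron. rewrite E0, E1, <- F0.
    replace (C_derive U (- w + tau)) with (- - C_derive U (- w + tau)) by ring. rewrite <- F1. ring. }
  assert (VV : wronskian2 U (- w) = wronskian2 U w).
  { unfold wronskian2, wron. rewrite E1, E2, <- F2.
    replace (C_derive U (- w + tau)) with (- - C_derive U (- w + tau)) by ring. rewrite <- F1. ring. }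
  rewrite N0, N1, G0, G1, WW, VV, ccos_opp. auto.
Qed.

(** * Growth of the Wronskians, and why they do not vanish *)

Lemma branch_egrow lam sg h U : branch lam sg h U -> egrow slit_strip U.
Proof.
  intros B. destruct (br_growth _ _ _ _ B) as [K [k H]].
  exists (Rabs K), (Rabs k), 0%R. repeat split; try apply Rabs_pos.
  intros z Hz _. apply Rlt_le. eapply Rlt_le_trans; [apply H; auto|].
  pose proof (exp_pos (k * Rabs (Im z))). pose proof (Rle_abs K). pose proof (Rabs_pos K).
  assert (exp (k * Rabs (Im z)) <= exp (Rabs k * Rabs (Im z)))%R.
  { apply exp_mono. apply Rmult_le_compat_r; [apply Rabs_pos|apply Rle_abs]. }
  nra.
Qed.

Lemma ramif_ge_1 (z : C) : (1 <= Rabs (Im z))%R -> (1 <= Cmod (ramif z))%R.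
Proof.
  intros H. unfold ramif. rewrite Cmod_mult. unfold eta.
  pose proof (im_le_Cmod (z + RtoC (PI / 2))) as I1. rewrite Im_add_R in I1.
  replace (z - 5 * RtoC (PI / 2)) with (z + RtoC (- (5 * (PI / 2)))) by (rewrite RtoC_opp, RtoC_mult; ring).
  pose proof (im_le_Cmod (z + RtoC (- (5 * (PI / 2))))) as I2. rewrite Im_add_R in I2.
  rewrite <- (Rmult_1_r 1). apply Rmult_le_compat; lra.
Qed.

Lemma ramif_tau_ge_1 (z : C) : (1 <= Rabs (Im z))%R -> (1 <= Cmod (ramif_tau z))%R.
Proof. intros H. rewrite ramif_tau_shift. apply ramif_ge_1. now rewrite Im_add_R. Qed.

Lemma egrow_kap (kap : C -> C) (D : C -> Prop) :
  (forall z, ccos z = ramif z * ramif_tau z * kap z) -> egrow D kap.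
Proof.
  intros Hk. apply (egrow_le D ccos kap 1).
  - intros z _ Hz. rewrite Hk, !Cmod_mult.
    pose proof (ramif_ge_1 z Hz); pose proof (ramif_tau_ge_1 z Hz). pose proof (Cmod_ge_0 (kap z)).
    rewrite <- (Rmult_1_l (Cmod (kap z))) at 1. apply Rmult_le_compat_r; auto.
    rewrite <- (Rmult_1_r 1). apply Rmult_le_compat; lra.
  - unfold ccos. apply (egrow_mul D (fun z => expi z + / expi z) (fun _ => / 2)); [|apply egrow_const].
    apply (egrow_add D expi (fun z => / expi z)); [apply egrow_expi|apply egrow_expi_inv].
Qed.

(** Away from the real axis [|sg| >= 1]; on the slits, where [U] is not under
    control, the bound for [h] follows by continuity. *)
Lemma egrow_h lam sg h U : branch lam sg h U -> egrow strip h.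
Proof.
  intros B. destruct (branch_egrow _ _ _ _ B) as [K [k [Y [HK [Hk H]]]]].
  assert (G : forall z, slit_strip z -> (Rmax Y 1 <= Rabs (Im z))%R -> (Cmod (h z) <= K * exp (k * Rabs (Im z)))%R).
  { intros z Hz Hy. pose proof (Rmax_l Y 1); pose proof (Rmax_r Y 1).
    eapply Rle_trans; [|apply H; auto; lra]. rewrite (br_U _ _ _ _ B), Cmod_mult.
    assert (S1 : (1 <= Cmod (sg z))%R).
    { pose proof (br_sq _ _ _ _ B z Hz) as Sq. apply (f_equal Cmod) in Sq. rewrite Cmod_mult in Sq.
      pose proof (ramif_ge_1 z ltac:(lra)). pose proof (Cmod_ge_0 (sg z)). nra. }
    pose proof (Cmod_ge_0 (h z)). nra. }
  exists K, k, (Rmax Y 1). repeat split; auto.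
  intros z Hz Hy. destruct (classic (slit_strip z)) as [Sz|Nz]; [now apply G|].
  pose proof PI_RGT_0.
  assert (RZ : (Re z = - PI / 2 \/ Re z = 5 * PI / 2)%R).
  { apply NNPP; intros N. apply Nz. split; auto. split; intros [A _]; apply N; auto. }
  apply Rnot_lt_le; intros Hlt.
  set (d := (Cmod (h z) - K * exp (k * Rabs (Im z)))%R). assert (Hd : (0 < d)%R) by (unfold d; lra).
  destruct (an_Cmod_cont h z d (br_h _ _ _ _ B z Hz) Hd) as [r [Hr Hc]].
  set (t := Rmin (r / 2) (PI / 4)).
  assert (t1 : (t <= r / 2)%R) by apply Rmin_l. assert (t2 : (t <= PI / 4)%R) by apply Rmin_r.
  assert (t0 : (0 < t)%R) by (apply Rmin_glb_lt; lra).
  specialize (Hc (z + RtoC t)). replace (z + RtoC t - z) with (RtoC t) in Hc by ring.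
  rewrite Cmod_R, Rabs_pos_eq in Hc by lra. specialize (Hc ltac:(lra)).
  assert (S' : slit_strip (z + RtoC t)).
  { unfold slit_strip, strip in *. rewrite Re_add_R, Im_add_R. repeat split; try lra; intros [A _]; lra. }
  pose proof (G _ S') as G'. rewrite Im_add_R in G'. specialize (G' Hy).
  apply Rabs_def2 in Hc. unfold d in Hc. lra.
Qed.

Lemma egrow_D_strip (a b : R) (f : C -> C) :
  analytic_on (vstrip a b) f -> egrow (vstrip a b) f ->
  forall a' b', (a' = a + 1/4)%R -> (b' = b - 1/4)%R -> egrow (vstrip a' b') (C_derive f).
Proof.
  intros An G a' b' -> ->. apply (egrow_D a b 0); auto.
Qed.

Lemma growth_inner lam sg h U kap : branch lam sg h U ->
  (forall z, ccos z = ramif z * ramif_tau z * kap z) ->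
  egrow (vstrip (- PI + 1/2) 0) (wron_sq kap h) /\ egrow (vstrip (- PI + 1/2) 0) (wron_mix kap h).
Proof.
  intros B Hk. pose proof PI2_1.
  pose proof (egrow_h _ _ _ _ B) as G0.
  assert (A0 : analytic_on (vstrip (- PI) (3 * PI)) h) by exact (br_h _ _ _ _ B).
  assert (A1 : analytic_on (vstrip (- PI + 1/4) (3 * PI - 1/4)) (C_derive h)).
  { intros z [Hz1 Hz2]. apply an_D, A0. unfold vstrip; lra. }
  pose proof (egrow_D_strip _ _ _ A0 G0 (- PI + 1/4) (3 * PI - 1/4) ltac:(lra) ltac:(lra)) as G1.
  pose proof (egrow_D_strip _ _ _ A1 G1 (- PI + 1/2) (3 * PI - 1/2) ltac:(lra) ltac:(lra)) as G2.
  set (D := vstrip (- PI + 1/2) 0).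
  assert (g0 : egrow D h) by (eapply egrow_sub; [|exact G0]; unfold D, vstrip, strip; intros; lra).
  assert (g1 : egrow D (C_derive h)) by (eapply egrow_sub; [|exact G1]; unfold D, vstrip; intros; lra).
  assert (g2 : egrow D (C_derive (C_derive h))) by (eapply egrow_sub; [|exact G2]; unfold D, vstrip; intros; lra).
  assert (k0 : egrow D (fun z => h (z + tau))).
  { eapply egrow_shift; [|exact G0]; unfold D, vstrip, strip; intros z; rewrite Re_add_R; lra. }
  assert (k1 : egrow D (fun z => C_derive h (z + tau))).
  { eapply egrow_shift; [|exact G1]; unfold D, vstrip; intros z; rewrite Re_add_R; lra. }
  assert (k2 : egrow D (fun z => C_derive (C_derive h) (z + tau))).
  { eapply egrow_shift; [|exact G2]; unfold D, vstrip; intros z; rewrite Re_add_R; lra. }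
  assert (gk : egrow D kap) by now apply egrow_kap.
  assert (gp : egrow D ramif) by (unfold ramif, D; egrow_auto).
  assert (gq : egrow D ramif_tau) by (unfold ramif_tau, D; egrow_auto).
  assert (gdp : egrow D dramif) by (unfold dramif, D; egrow_auto).
  assert (gdq : egrow D dramif_tau) by (unfold dramif_tau, D; egrow_auto).
  assert (gw : egrow D (wron_core h)) by (unfold wron_core, jet1; egrow_auto).
  assert (gv : egrow D (wron2_core h)) by (unfold wron2_core, jet1, jet2; egrow_auto).
  split.
  - unfold wron_sq. apply (egrow_mul D kap (fun z => wron_core h z ^ 2)); auto.
    apply (egrow_ext D (fun z => wron_core h z * wron_core h z) _ 0); [intros; ring|]. egrow_auto.
  - unfold wron_mix. apply (egrow_mul D (fun z => kap z ^ 2) (fun z => wron_core h z * wron2_core h z)); [|egrow_auto].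
    apply (egrow_ext D (fun z => kap z * kap z) _ 0); [intros; ring|]. egrow_auto.
Qed.

(** Next to the line [Re z = - PI] the derivatives of [U] are controlled through
    its extension to the left by the functional equation. *)
Lemma left_extension lam sg h U : branch lam sg h U -> exists E : C -> C,
  analytic_on (vstrip (- PI - 1/2) (- PI + 1)) E /\ egrow (vstrip (- PI - 1/2) (- PI + 1)) E /\
  forall z, vstrip (- PI) (- PI + 1/2) z -> near z (fun w => E w = U w).
Proof.
  intros B. pose proof PI2_1.
  set (E := fun z => if Rlt_dec (Re z) (- PI) then lam * U (z + tau) - U (z + tau + tau) else U z).
  assert (Sr : forall z, vstrip (- PI) (- PI + 1) z -> slit_strip z).
  { intros z [Z1 Z2]. unfold slit_strip, strip. repeat split; try lra; intros [X _]; lra. }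
  assert (Sl : forall z, (- PI - 1/2 <= Re z < - PI)%R -> slit_strip (z + tau) /\ slit_strip (z + tau + tau)).
  { intros z Hz. unfold slit_strip, strip. rewrite !Re_add_R. repeat split; try lra; intros [X _]; lra. }
  assert (Er : forall z, vstrip (- PI) (- PI + 1) z -> near z (fun w => E w = U w)).
  { intros z [Z1 Z2]. destruct (Req_dec (Re z) (- PI)) as [Ez|Nz].
    - eapply near_imp; [|apply (shift_near _ _ _ _ B z Ez)]. intros w [Sh _].
      unfold E. destruct (Rlt_dec (Re w) (- PI)); auto. rewrite Sh. ring.
    - assert (R1 : (- PI < Re z < - PI + 2)%R) by lra.
      eapply near_imp; [|apply (near_Re z _ _ R1)]. intros w Hw. unfold E.
      destruct (Rlt_dec (Re w) (- PI)); auto. lra. }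
  exists E. split; [|split].
  - intros z [Z1 Z2]. destruct (Rlt_dec (Re z) (- PI)) as [L|L].
    + destruct (Sl z ltac:(lra)) as [S1 S2].
      apply (an_ext (fun w => lam * U (w + tau) - U (w + tau + tau))).
      * assert (R1 : (- PI - 1 < Re z < - PI)%R) by lra.
        eapply near_imp; [|apply (near_Re z _ _ R1)]. intros w Hw. unfold E.
        destruct (Rlt_dec (Re w) (- PI)); auto. lra.
      * pose proof (br_an _ _ _ _ B _ S1).
        pose proof (an_shift (fun w => U (w + tau)) tau z (an_shift U tau _ (br_an _ _ _ _ B _ S2))). an.
    + assert (Vz : vstrip (- PI) (- PI + 1) z) by (unfold vstrip; lra).
      apply (an_ext U).
      * eapply near_imp; [|apply (Er z Vz)]. auto.
      * apply (br_an _ _ _ _ B), Sr, Vz.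
  - pose proof (branch_egrow _ _ _ _ B) as G.
    apply (egrow_union (fun z => - PI - 1/2 <= Re z < - PI)%R (vstrip (- PI) (- PI + 1))).
    + intros z [Z1 Z2]. unfold vstrip. lra.
    + apply (egrow_ext _ (fun z => lam * U (z + tau) - U (z + tau + tau)) _ 0).
      * intros z Hz _. unfold E. destruct (Rlt_dec (Re z) (- PI)); auto; lra.
      * assert (G1 : egrow (fun z => - PI - 1/2 <= Re z < - PI)%R (fun z => U (z + tau))).
        { apply (egrow_shift slit_strip); auto. intros z Hz. now apply Sl. }
        assert (G2 : egrow (fun z => - PI - 1/2 <= Re z < - PI)%R (fun z => U (z + tau + tau))).
        { apply (egrow_ext _ (fun z => U (z + RtoC (4 * PI))) _ 0).
          - intros z _ _. now rewrite tau2, Cplus_assoc.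
          - apply (egrow_shift slit_strip); auto. intros z Hz. rewrite tau2, Cplus_assoc. now apply Sl. }
        apply (egrow_sub_fun _ (fun z => lam * U (z + tau)) (fun z => U (z + tau + tau))); auto.
        now apply (egrow_scal _ lam (fun z => U (z + tau))).
    + apply (egrow_ext _ U _ 0).
      * intros z Hz _. unfold E. destruct (Rlt_dec (Re z) (- PI)); auto. destruct Hz; lra.
      * eapply egrow_sub; [|exact G]. exact Sr.
  - intros z [Z1 Z2]. apply Er. unfold vstrip; lra.
Qed.

Lemma growth_left lam sg h U kap : branch lam sg h U ->
  (forall z, ccos z = ramif z * ramif_tau z * kap z) ->
  egrow (vstrip (- PI) (- PI + 1/2)) (wron_sq kap h) /\ egrow (vstrip (- PI) (- PI + 1/2)) (wron_mix kap h).
Proof.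
  intros B Hk. pose proof PI2_1.
  destruct (left_extension _ _ _ _ B) as [E [AE [GE LE]]].
  set (D := vstrip (- PI) (- PI + 1/2)) in *.
  assert (AE1 : analytic_on (vstrip (- PI - 1/4) (- PI + 3/4)) (C_derive E)).
  { intros z [Z1 Z2]. apply an_D, AE. unfold vstrip; lra. }
  pose proof (egrow_D_strip _ _ _ AE GE (- PI - 1/4) (- PI + 3/4) ltac:(lra) ltac:(lra)) as GE1.
  pose proof (egrow_D_strip _ _ _ AE1 GE1 (- PI) (- PI + 1/2) ltac:(lra) ltac:(lra)) as GE2.
  assert (AEz : forall z, D z -> near z (fun w => analytic_at E w)).
  { intros z [Z1 Z2]. apply an_near, AE. unfold vstrip; lra. }
  assert (LE1 : forall z, D z -> near z (fun w => C_derive E w = C_derive U w)).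
  { intros z Dz. eapply near_imp; [|apply (near_and _ _ _ (AEz z Dz) (near_near _ _ (LE z Dz)))].
    intros w [A1 A2]. symmetry. now apply D_ext. }
  assert (g0 : egrow D U).
  { apply (egrow_ext D E _ 0); [|eapply egrow_sub; [|exact GE]; unfold D, vstrip; intros; lra].
    intros z Dz _. exact (near_self _ _ (LE z Dz)). }
  assert (g1 : egrow D (C_derive U)).
  { apply (egrow_ext D (C_derive E) _ 0); [|eapply egrow_sub; [|exact GE1]; unfold D, vstrip; intros; lra].
    intros z Dz _. exact (near_self _ _ (LE1 z Dz)). }
  assert (g2 : egrow D (C_derive (C_derive U))).
  { apply (egrow_ext D (C_derive (C_derive E)) _ 0); auto.
    intros z Dz _. symmetry. apply D_ext; [now apply LE1|]. apply an_D. exact (near_self _ _ (AEz z Dz)). }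
  assert (S1 : forall z, vstrip (PI - 1/2) (PI + 1) z -> slit_strip z).
  { intros z [Z1 Z2]. unfold slit_strip, strip. repeat split; try lra; intros [X _]; lra. }
  assert (A0 : analytic_on (vstrip (PI - 1/2) (PI + 1)) U) by (intros z Hz; apply (br_an _ _ _ _ B); auto).
  assert (A1 : analytic_on (vstrip (PI - 1/4) (PI + 3/4)) (C_derive U)).
  { intros z [Z1 Z2]. apply an_D, A0. unfold vstrip; lra. }
  assert (G0 : egrow (vstrip (PI - 1/2) (PI + 1)) U) by (eapply egrow_sub; [exact S1|eapply branch_egrow; eauto]).
  pose proof (egrow_D_strip _ _ _ A0 G0 (PI - 1/4) (PI + 3/4) ltac:(lra) ltac:(lra)) as G1.
  pose proof (egrow_D_strip _ _ _ A1 G1 PI (PI + 1/2) ltac:(lra) ltac:(lra)) as G2.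
  assert (k0 : egrow D (fun z => U (z + tau))).
  { eapply egrow_shift; [|exact G0]; unfold D, vstrip; intros z; rewrite Re_add_R; lra. }
  assert (k1 : egrow D (fun z => C_derive U (z + tau))).
  { eapply egrow_shift; [|exact G1]; unfold D, vstrip; intros z; rewrite Re_add_R; lra. }
  assert (k2 : egrow D (fun z => C_derive (C_derive U) (z + tau))).
  { eapply egrow_shift; [|exact G2]; unfold D, vstrip; intros z; rewrite Re_add_R; lra. }
  assert (gc : egrow D ccos).
  { unfold ccos. apply (egrow_mul D (fun z => expi z + / expi z) (fun _ => / 2)); [|apply egrow_const].
    apply (egrow_add D expi (fun z => / expi z)); [apply egrow_expi|apply egrow_expi_inv]. }
  assert (gW : egrow D (wronskian U)) by (unfold wronskian, wron; egrow_auto).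
  assert (gV : egrow D (wronskian2 U)) by (unfold wronskian2, wron; egrow_auto).
  assert (F : forall z, D z -> wron_formula kap h U z).
  { intros z [Z1 Z2]. apply (near_self z), (local_formula _ _ _ _ _ B Hk);
      unfold slit_strip, strip; rewrite ?Re_add_R; repeat split; try lra; intros [X _]; lra. }
  split.
  - apply (egrow_ext D (fun z => 4 * (wronskian U z * wronskian U z) * ccos z) _ 0); [|egrow_auto].
    intros z Dz _. rewrite (proj1 (F z Dz)). ring.
  - apply (egrow_ext D (fun z => 16 * (wronskian U z * wronskian2 U z) * (ccos z * ccos z)) _ 0); [|egrow_auto].
    intros z Dz _. rewrite (proj2 (F z Dz)). ring.
Qed.

Lemma an_wron_sq_mix lam sg h U kap : branch lam sg h U -> entire kap ->
  analytic_on (vstrip (- PI) PI) (wron_sq kap h) /\ analytic_on (vstrip (- PI) PI) (wron_mix kap h).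
Proof.
  intros B Ek. pose proof PI_RGT_0.
  assert (F : forall z, vstrip (- PI) PI z -> analytic_at (wron_core h) z /\ analytic_at (wron2_core h) z).
  { intros z [Z1 Z2].
    assert (A : analytic_at h z) by (apply (br_h _ _ _ _ B); unfold strip; lra).
    assert (A' : analytic_at h (z + tau)) by (apply (br_h _ _ _ _ B); unfold strip; rewrite Re_add_R; lra).
    split; [unfold wron_core, jet1; an|unfold wron2_core, jet1, jet2; an]. }
  split; intros z Hz; destruct (F z Hz) as [F1 F2]; pose proof (Ek z).
  - unfold wron_sq; an.
  - unfold wron_mix; an.
Qed.

Lemma D_monomial (a : C) (k : nat) (z : C) :
  (z + a) * C_derive (fun w => (w + a) ^ k) z = RtoC (INR k) * (z + a) ^ k.
Proof.
  induction k as [|k IH].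
  - simpl. rewrite D_const. ring.
  - change (fun w => (w + a) ^ S k) with (fun w => (w + a) * (w + a) ^ k). D_expand.
    rewrite S_INR, RtoC_plus, Cpow_S.
    replace ((z + a) * ((1 + 0) * (z + a) ^ k + (z + a) * C_derive (fun w => (w + a) ^ k) z))
      with ((z + a) * (z + a) ^ k + (z + a) * ((z + a) * C_derive (fun w => (w + a) ^ k) z)) by ring.
    rewrite IH. ring.
Qed.

Lemma D_factor (f g : C -> C) (a : C) (k : nat) (z : C) :
  (forall w, f w = (w + a) ^ k * g w) -> analytic_at g z ->
  (z + a) * C_derive f z = (z + a) ^ k * (RtoC (INR k) * g z + (z + a) * C_derive g z).
Proof.
  intros E A. rewrite (D_ext (fun w => (w + a) ^ k * g w) f) by (an || now apply near_true).
  D_expand. transitivity ((z + a) * C_derive (fun w => (w + a) ^ k) z * g z + (z + a) ^ k * ((z + a) * C_derive g z)).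
  - ring.
  - rewrite D_monomial. ring.
Qed.

Lemma odd_neq0 (a b : nat) : RtoC (2 * (INR b - INR a) - 1) <> 0.
Proof.
  apply RtoC_neq0. intros E.
  assert (X : INR (2 * b) = INR (2 * a + 1)).
  { rewrite plus_INR, !mult_INR. simpl (INR 2). simpl (INR 1). lra. }
  apply INR_eq in X. lia.
Qed.

(** At the branch point [- eta] of [U] its translate is regular.  With orders of
    vanishing [a] and [b] of [h] and its translate there, the leading coefficient
    of the Wronskian carries the factor [2 (b - a) - 1], which is odd. *)
Lemma wron_core_zero (h : C -> C) : analytic_at h (- eta) -> analytic_at h (- eta + tau) ->
  near (- eta) (fun z => wron_core h z = 0) ->
  near (- eta) (fun z => h z = 0) \/ near (- eta + tau) (fun z => h z = 0).
Proof.
  intros A0 A1 Z.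
  pose proof (an_shift h tau _ A1) as B0.
  destruct (an_zero_or_factor h _ A0) as [L|[a [al [Aal [Nal Ea]]]]]; [now left|].
  destruct (an_zero_or_factor _ _ B0) as [L|[b [be [Abe [Nbe Eb]]]]].
  { right. apply (near_shift _ (- tau)) in L || idtac.
    destruct L as [r [Hr L]]. exists r; split; auto. intros w Hw.
    specialize (L (w - tau)). replace (w - tau - - eta) with (w - (- eta + tau)) in L by ring.
    specialize (L Hw). now replace (w - tau + tau) with w in L by ring. }
  exfalso.
  set (br := fun z => ramif z * dramif_tau z * al z * be z - ramif_tau z * dramif z * al z * be z
     + 2 * ramif_tau z * (z - 5 * eta) * (al z * (RtoC (INR b) * be z + (z + eta) * C_derive be z)
         - be z * (RtoC (INR a) * al z + (z + eta) * C_derive al z))).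
  assert (Abr : analytic_at br (- eta)) by (unfold br; an).
  assert (Nbr : br (- eta) <> 0).
  { replace (br (- eta)) with (ramif_tau (- eta) * (- 6 * eta) * (al (- eta) * be (- eta)) * RtoC (2 * (INR b - INR a) - 1)).
    - pose proof eta_neq0. repeat apply Cmult_neq_0; auto using odd_neq0.
      + replace (- eta + 5 * eta) with (4 * eta) by ring. apply Cmult_neq_0; auto. apply RtoC_neq0; lra.
      + replace (- eta - eta) with (- 2 * eta) by ring. apply Cmult_neq_0; auto.
        apply RtoC_neq0; lra.
      + apply RtoC_neq0; lra.
    - unfold br. replace (ramif (- eta)) with (RtoC 0) by (unfold ramif; ring).
      replace (dramif (- eta)) with (- 6 * eta) by (unfold dramif; ring).
      rewrite RtoC_minus, RtoC_mult, RtoC_minus. ring. }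
  assert (Near : near (- eta) (fun z => analytic_at al z /\ analytic_at be z /\ analytic_at h (z + tau))).
  { apply near_and; [now apply an_near|]. apply near_and; [now apply an_near|].
    apply (near_shift (- eta) tau (analytic_at h)). now apply an_near. }
  destruct (near_punctured _ _ (near_and _ _ _ Z (near_and _ _ _ (an_ne0 _ _ Abr Nbr) Near)))
    as [z [Nz [Wz [Brz [Alz [Bez Hz]]]]]].
  set (x := z + eta). assert (Nx : x <> 0).
  { unfold x. replace (z + eta) with (z - - eta) by ring. now apply Csub_ne0. }
  assert (Ah : forall w, h w = (w + eta) ^ a * al w) by (intros w; rewrite Ea; f_equal; f_equal; ring).
  assert (Bh : forall w, h (w + tau) = (w + eta) ^ b * be w) by (intros w; rewrite Eb; f_equal; f_equal; ring).
  pose proof (D_factor _ _ _ _ _ Ah Alz) as Da. pose proof (D_factor _ _ _ _ _ Bh Bez) as Db.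
  rewrite (D_shift h tau z Hz) in Db. fold x in Da, Db.
  assert (F : wron_core h z = x ^ a * x ^ b * br z).
  { unfold wron_core, jet1, br. rewrite (Ah z), (Bh z). fold x.
    replace (ramif z) with (x * (z - 5 * eta)) by reflexivity.
    set (h1 := C_derive h z) in *. set (k1 := C_derive h (z + tau)) in *.
    set (p1 := z - 5 * eta).
    replace (x * p1 * (x ^ a * al z) * (dramif_tau z * (x ^ b * be z) + 2 * ramif_tau z * k1)
       - ramif_tau z * (x ^ b * be z) * (dramif z * (x ^ a * al z) + 2 * (x * p1) * h1))
      with (x ^ a * x ^ b * (x * p1 * dramif_tau z * al z * be z - ramif_tau z * dramif z * al z * be z)
        + 2 * ramif_tau z * p1 * (x ^ a * al z * (x * k1) - x ^ b * be z * (x * h1))) by ring.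
    rewrite Da, Db. ring. }
  rewrite F in Wz. revert Wz. repeat apply Cmult_neq_0; auto; now apply Cpow_nz.
Qed.

Lemma strip_convex : convex strip.
Proof.
  intros x y t Hx Hy Ht. destruct x as [x1 x2], y as [y1 y2]. unfold strip, Re in *; simpl in *. split; nra.
Qed.

Lemma wronskian_nontrivial lam sg h U kap : branch lam sg h U -> entire kap ->
  (forall z, ccos z = ramif z * ramif_tau z * kap z) ->
  near (- eta) (fun z => wron_sq kap h z = 0) -> forall b, slit_strip b -> U b = 0.
Proof.
  intros B Ek Hk Z b Hb. pose proof PI_RGT_0.
  assert (S0 : strip (- eta)).
  { unfold strip, eta. rewrite <- RtoC_opp. simpl. lra. }
  assert (S1 : strip (- eta + tau)).
  { unfold strip. rewrite Re_add_R. unfold eta. rewrite <- RtoC_opp. simpl. lra. }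
  pose proof (br_h _ _ _ _ B _ S0) as A0. pose proof (br_h _ _ _ _ B _ S1) as A1.
  assert (Zh : exists z, strip z /\ near z (fun w => h w = 0)).
  { assert (Aw : analytic_at (wron_core h) (- eta)).
    { unfold wron_core, jet1; an. }
    assert (Aw2 : analytic_at (fun w => wron_core h w * wron_core h w) (- eta)) by now apply an_mul.
    assert (Z2 : near (- eta) (fun w => kap w * (wron_core h w * wron_core h w) = 0)).
    { eapply near_imp; [|exact Z]. intros w Hw. rewrite <- Hw. unfold wron_sq. ring. }
    assert (Zw : near (- eta) (fun w => wron_core h w = 0)).
    { destruct (an_mul_zero kap (fun w => wron_core h w * wron_core h w) _ (Ek _) Aw2 Z2) as [Zk|Zw2].
      - exfalso. pose proof (identity_entire kap (- eta) 0 Ek Zk) as K0.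
        pose proof (Hk 0) as X. rewrite K0 in X. replace (ramif 0 * ramif_tau 0 * 0) with (RtoC 0) in X by ring.
        pose proof (ccos_real 0) as Y. rewrite cos_0 in Y. rewrite X in Y. injection Y; lra.
      - destruct (an_mul_zero (wron_core h) (wron_core h) _ Aw Aw Zw2); auto. }
    destruct (wron_core_zero h A0 A1 Zw); eauto. }
  destruct Zh as [z [Sz Nz]].
  rewrite (br_U _ _ _ _ B).
  pose proof (near_self _ _ (identity_convex strip h z b strip_convex (br_h _ _ _ _ B) Sz Nz (slit_in_strip _ Hb))) as E.
  cbn beta in E. rewrite E. ring.
Qed.

Definition wron_squares (U N G : C -> C) (w : C) : Prop :=
  N w = 4 * wronskian U w ^ 2 * ccos w /\ G w = 16 * (wronskian U w * wronskian2 U w) * ccos w ^ 2.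

(** In these products the signs which the Wronskians pick up around the branch points
    cancel, and they become Laurent polynomials. *)
Lemma coefficients lam sg h U : branch lam sg h U ->
  exists (N G : C -> C) (m m' : nat) (P Q : C -> C),
    entire N /\ entire G /\
    (forall z, N (- z) = N z) /\ (forall z, G (- z) = G z) /\
    is_poly P /\ is_poly Q /\
    (forall z, expi z ^ m * N z = P (expi z)) /\ (forall z, expi z ^ m' * G z = Q (expi z)) /\
    (forall z, vstrip (- PI) PI z -> slit_strip z -> slit_strip (z + tau) ->
       near z (wron_squares U N G)) /\
    ((forall z, N z = 0) -> forall b, slit_strip b -> U b = 0).
Proof.
  intros B. destruct ccos_factor as [kap [Ek Hk]]. pose proof PI2_1.
  destruct (an_wron_sq_mix _ _ _ _ _ B Ek) as [An Ag].
  destruct (growth_inner _ _ _ _ _ B Hk) as [In Ig]. destruct (growth_left _ _ _ _ _ B Hk) as [Ln Lg].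
  assert (U0 : forall z, vstrip (- PI) 0 z -> vstrip (- PI) (- PI + 1/2) z \/ vstrip (- PI + 1/2) 0 z).
  { intros z [Z1 Z2]. unfold vstrip. lra. }
  pose proof (even_near _ _ _ _ _ B Hk) as Ev.
  destruct (even_cylinder_extension (wron_sq kap h)) as [N [m [P [EN [NE [LN [HP PE]]]]]]]; auto.
  { intros z Hz. eapply near_imp; [|apply (periodic_near _ _ _ _ _ B Hk z Hz)]. now intros w [? ?]. }
  { eapply near_imp; [|exact Ev]. now intros w [? ?]. }
  { exact (egrow_union _ _ _ _ U0 Ln In). }
  destruct (even_cylinder_extension (wron_mix kap h)) as [G [m' [Q [EG [GE [LG [HQ QE]]]]]]]; auto.
  { intros z Hz. eapply near_imp; [|apply (periodic_near _ _ _ _ _ B Hk z Hz)]. now intros w [? ?]. }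
  { eapply near_imp; [|exact Ev]. now intros w [? ?]. }
  { exact (egrow_union _ _ _ _ U0 Lg Ig). }
  exists N, G, m, m', P, Q. do 8 (split; [assumption|]). split.
  - intros z Vz S0 S1.
    eapply near_imp; [|apply (near_and _ _ _ (local_formula _ _ _ _ _ B Hk z S0 S1) (near_and _ _ _ (LN z Vz) (LG z Vz)))].
    intros w [[F1 F2] [E1 E2]].
    unfold wron_squares. rewrite E1, E2. split; assumption.
  - intros Z. apply (wronskian_nontrivial _ _ _ _ _ B Ek Hk).
    eapply near_imp; [|apply (LN (- eta))].
    + intros w <-. apply Z.
    + unfold vstrip, eta. rewrite <- RtoC_opp. simpl. lra.
Qed.

(** * The differential equation near regular points *)

(** [- W' / W] and [V / W] in terms of [N = 4 W ^ 2 cos] and [G = 16 W V cos ^ 2]. *)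
Definition fval (N : C -> C) (z : C) : C := - (C_derive N z / N z - C_derive ccos z / ccos z) / 2.
Definition gval (N G : C -> C) (z : C) : C := G z / (4 * ccos z * N z).

Definition local_coeffs (U N G : C -> C) : Prop :=
  entire N /\ entire G /\
  forall z, vstrip (- PI) PI z -> slit_strip z -> slit_strip (z + tau) -> near z (wron_squares U N G).

Lemma ode_local (U N G : C -> C) (z : C) : analytic_at U z -> analytic_at U (z + tau) ->
  near z (wron_squares U N G) -> N z <> 0 -> ccos z <> 0 ->
  wronskian U z <> 0 /\
  C_derive (C_derive U) z + fval N z * C_derive U z + gval N G z * U z = 0 /\
  C_derive (C_derive U) (z + tau) + fval N z * C_derive U (z + tau) + gval N G z * U (z + tau) = 0.
Proof.
  intros A A' L N0 c0.
  destruct (near_self _ _ L) as [EqN EqG].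
  assert (W0 : wronskian U z <> 0).
  { intros E. apply N0. rewrite EqN, E. ring. }
  assert (AW : analytic_at (wronskian U) z) by (unfold wronskian, wron; an).
  assert (DW : C_derive (wronskian U) z = U z * C_derive (C_derive U) (z + tau) - C_derive (C_derive U) z * U (z + tau)).
  { unfold wronskian, wron. D_expand. ring. }
  assert (DN : C_derive N z = 8 * wronskian U z * C_derive (wronskian U) z * ccos z + 4 * wronskian U z ^ 2 * C_derive ccos z).
  { rewrite (D_ext (fun w => 4 * (wronskian U w * wronskian U w) * ccos w) N).
    - D_expand. ring.
    - eapply near_imp; [|exact L]. intros w [E _]. rewrite E. ring.
    - an. }
  assert (Ef : fval N z = - (C_derive (wronskian U) z / wronskian U z)).
  { unfold fval. rewrite DN, EqN. field. auto. }
  assert (Eg : gval N G z = wronskian2 U z / wronskian U z).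
  { unfold gval. rewrite EqN, EqG. field. auto. }
  rewrite Ef, Eg. split; auto. rewrite DW. clear - W0. unfold wronskian, wronskian2, wron in *.
  split; field; auto.
Qed.

(** * Solutions on a vertical ray *)

Lemma nondecreasing_from (f df : R -> R) (a : R) :
  (forall y, (a <= y)%R -> derivable_pt_lim f y (df y)) ->
  (forall y, (a <= y)%R -> (0 <= df y)%R) ->
  forall y, (a <= y)%R -> (f a <= f y)%R.
Proof.
  intros D P y Hy. destruct (MVT_gen f a y df) as [c [Hc E]].
  - intros x Hx. apply is_derive_Reals, D. rewrite Rmin_left in Hx by lra. lra.
  - intros x Hx. apply derivable_continuous_pt. exists (df x). apply D.
    rewrite Rmin_left in Hx by lra. lra.
  - rewrite Rmin_left in Hc by lra.
    assert (0 <= df c * (y - a))%R by (apply Rmult_le_pos; [apply P; lra|lra]). lra.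
Qed.

Lemma derivable_exp_lin (K y : R) : derivable_pt_lim (fun t => exp (K * t)) y (K * exp (K * y))%R.
Proof.
  replace (K * exp (K * y))%R with (exp (K * y) * K)%R by ring.
  apply (derivable_pt_lim_comp (fun t => K * t)%R exp).
  - pose proof (derivable_pt_lim_scal id K y 1 (derivable_pt_lim_id y)) as H.
    rewrite Rmult_1_r in H. exact H.
  - apply derivable_pt_lim_exp.
Qed.

(** With [K = k + 1], [(phi' + K phi) exp (- K y)] does not decrease, hence
    [phi] grows at least like [exp (K y)]. *)
Lemma convex_growth (phi phi1 phi2 : R -> R) (a k Cb : R) :
  (0 <= k)%R ->
  (forall y, (a <= y)%R -> derivable_pt_lim phi y (phi1 y)) ->
  (forall y, (a <= y)%R -> derivable_pt_lim phi1 y (phi2 y)) ->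
  (forall y, (a <= y)%R -> ((k + 1) * (k + 1) * phi y <= phi2 y)%R) ->
  (0 <= phi a)%R -> (0 < phi1 a)%R ->
  (forall y, (a <= y)%R -> (phi y <= Cb * exp (k * y))%R) -> False.
Proof.
  intros Hk D0 D1 P Ha H1 Up. set (K := (k + 1)%R) in *.
  set (c0 := (exp (- K * a) * (phi1 a + K * phi a))%R).
  assert (C0 : (0 < c0)%R).
  { apply Rmult_lt_0_compat; [apply exp_pos|]. assert (0 <= K * phi a)%R by (apply Rmult_le_pos; unfold K; lra). lra. }
  assert (S1 : forall y, (a <= y)%R -> (c0 <= exp (- K * y) * (phi1 y + K * phi y))%R).
  { apply (nondecreasing_from (fun y => exp (- K * y) * (phi1 y + K * phi y))%R
      (fun y => exp (- K * y) * (phi2 y - K * K * phi y))%R).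
    - intros y Hy.
      replace (exp (- K * y) * (phi2 y - K * K * phi y))%R
        with (- K * exp (- K * y) * (phi1 y + K * phi y) + exp (- K * y) * (phi2 y + K * phi1 y))%R by ring.
      apply (derivable_pt_lim_mult (fun t => exp (- K * t)) (fun t => phi1 t + K * phi t)%R).
      + apply derivable_exp_lin.
      + apply (derivable_pt_lim_plus phi1 (fun t => K * phi t)%R); auto.
        apply (derivable_pt_lim_scal phi K); auto.
    - intros y Hy. apply Rmult_le_pos; [apply Rlt_le, exp_pos|]. specialize (P y Hy). lra. }
  set (c1 := (c0 / (2 * K))%R).
  assert (K0 : (0 < K)%R) by (unfold K; lra).
  assert (C1 : (0 < c1)%R) by (apply Rdiv_lt_0_compat; lra).
  set (X := (exp (K * a) * phi a - c1 * exp (2 * K * a))%R).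
  assert (S2 : forall y, (a <= y)%R -> (X <= exp (K * y) * phi y - c1 * exp (2 * K * y))%R).
  { apply (nondecreasing_from (fun y => exp (K * y) * phi y - c1 * exp (2 * K * y))%R
      (fun y => exp (K * y) * (phi1 y + K * phi y) - c0 * exp (2 * K * y))%R).
    - intros y Hy.
      replace (exp (K * y) * (phi1 y + K * phi y) - c0 * exp (2 * K * y))%R
        with ((K * exp (K * y) * phi y + exp (K * y) * phi1 y) - c1 * (2 * K * exp (2 * K * y)))%R.
      2:{ unfold c1. field. lra. }
      apply (derivable_pt_lim_minus (fun t => exp (K * t) * phi t)%R (fun t => c1 * exp (2 * K * t))%R).
      + apply (derivable_pt_lim_mult (fun t => exp (K * t)) phi); auto. apply derivable_exp_lin.
      + apply (derivable_pt_lim_scal (fun t => exp (2 * K * t)) c1). apply derivable_exp_lin.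
    - intros y Hy. specialize (S1 y Hy). replace (2 * K * y)%R with (K * y + K * y)%R by ring. rewrite exp_plus.
      replace (- K * y)%R with (- (K * y))%R in S1 by ring. rewrite exp_Ropp in S1.
      pose proof (exp_pos (K * y)) as E.
      apply Rmult_le_compat_l with (r := exp (K * y)) in S1; [|lra].
      rewrite <- Rmult_assoc, Rinv_r, Rmult_1_l in S1 by lra.
      apply Rmult_le_compat_l with (r := exp (K * y)) in S1; [|lra]. lra. }
  set (y := Rmax a (Rmax 0 ((Rabs Cb + Rabs X) / c1))).
  assert (y1 : (a <= y)%R) by apply Rmax_l.
  assert (y2 : (0 <= y)%R) by (eapply Rle_trans; [apply Rmax_l|apply Rmax_r]).
  assert (y3 : ((Rabs Cb + Rabs X) / c1 <= y)%R) by (eapply Rle_trans; [apply Rmax_r|apply Rmax_r]).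
  specialize (S2 y y1). specialize (Up y y1).
  pose proof (exp_pos (K * y)) as e1.
  assert (T : (c1 * exp (2 * K * y) <= Rabs Cb * exp ((K + k) * y) + Rabs X)%R).
  { replace ((K + k) * y)%R with (K * y + k * y)%R by ring. rewrite exp_plus.
    pose proof (exp_pos (k * y)). pose proof (Rle_abs Cb). pose proof (Rle_abs (- X)). rewrite Rabs_Ropp in *.
    assert (exp (K * y) * phi y <= Rabs Cb * (exp (K * y) * exp (k * y)))%R.
    { apply Rle_trans with (exp (K * y) * (Cb * exp (k * y)))%R; [apply Rmult_le_compat_l; lra|].
      replace (exp (K * y) * (Cb * exp (k * y)))%R with (Cb * (exp (K * y) * exp (k * y)))%R by ring.
      apply Rmult_le_compat_r; auto. apply Rmult_le_pos; lra. }
    lra. }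
  replace (2 * K * y)%R with ((K + k) * y + y)%R in T by (unfold K; ring). rewrite exp_plus in T.
  set (e := exp ((K + k) * y)) in *.
  assert (E1 : (1 <= e)%R).
  { unfold e. rewrite <- exp_0. apply exp_mono. apply Rmult_le_pos; lra. }
  pose proof (exp_ineq1_le y) as E2. pose proof (Rabs_pos X). pose proof (Rabs_pos Cb).
  assert (T2 : (c1 * exp y <= Rabs Cb + Rabs X)%R).
  { apply Rmult_le_reg_r with e; [lra|]. nra. }
  assert (T3 : (Rabs Cb + Rabs X <= c1 * y)%R).
  { apply Rmult_le_compat_l with (r := c1) in y3; [|lra].
    replace (c1 * ((Rabs Cb + Rabs X) / c1))%R with (Rabs Cb + Rabs X)%R in y3 by (field; lra). lra. }
  nra.
Qed.

Definition ray (x y : R) : C := (x, y).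

Lemma derivable_on_ray (F : C -> C) (x y : R) : analytic_at F (ray x y) ->
  derivable_pt_lim (fun t => Re (F (ray x t))) y (Re (Ci * C_derive F (ray x y))) /\
  derivable_pt_lim (fun t => Im (F (ray x t))) y (Im (Ci * C_derive F (ray x y))).
Proof.
  intros A. set (z := ray x y) in *.
  assert (V : dquot F z z = C_derive F z) by (unfold dquot; destruct (Ceq_dec z z); congruence).
  assert (H : forall eps, (0 < eps)%R -> exists d : posreal, forall t, t <> 0%R -> (Rabs t < d)%R ->
     (Cmod (/ RtoC t * (F (ray x (y + t)) - F z) - Ci * C_derive F z) < eps)%R).
  { intros eps He. destruct (an_cont _ _ eps (an_dquot F z z A A) He) as [r [Hr K]].
    exists (mkposreal r Hr). intros t T0 T1. simpl in T1.
    assert (Ew : ray x (y + t) - z = Ci * RtoC t).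
    { unfold z. apply injective_projections; simpl; ring. }
    specialize (K (ray x (y + t))). rewrite Ew, Cmod_mult, Cmod_Ci, Cmod_R, V in K.
    specialize (K ltac:(lra)).
    replace (/ RtoC t * (F (ray x (y + t)) - F z) - Ci * C_derive F z)
      with (Ci * (dquot F z (ray x (y + t)) - C_derive F z)).
    - rewrite Cmod_mult, Cmod_Ci. lra.
    - rewrite dquot_mul, Ew. field. now apply RtoC_neq0. }
  split; intros eps He; destruct (H eps He) as [d Hd]; exists d; intros t T0 T1;
    eapply Rle_lt_trans; [|exact (Hd t T0 T1)| |exact (Hd t T0 T1)].
  - eapply Rle_trans; [|apply re_le_Cmod]. apply Req_le. f_equal.
    rewrite <- RtoC_inv by auto. unfold Cminus at 1.
    replace (Re (RtoC (/ t) * (F (ray x (y + t)) - F z) + - (Ci * C_derive F z)))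
      with (Re (RtoC (/ t) * (F (ray x (y + t)) - F z)) - Re (Ci * C_derive F z))%R by reflexivity.
    rewrite Re_scal. unfold Rdiv.
    replace (Re (F (ray x (y + t)) - F z)) with (Re (F (ray x (y + t))) - Re (F z))%R by reflexivity.
    fold z. ring.
  - eapply Rle_trans; [|apply im_le_Cmod]. apply Req_le. f_equal.
    rewrite <- RtoC_inv by auto. unfold Cminus at 1.
    replace (Im (RtoC (/ t) * (F (ray x (y + t)) - F z) + - (Ci * C_derive F z)))
      with (Im (RtoC (/ t) * (F (ray x (y + t)) - F z)) - Im (Ci * C_derive F z))%R by reflexivity.
    assert (IS : forall s w, Im (RtoC s * w) = (s * Im w)%R).
    { intros s w. destruct w; unfold Im, Cmult, RtoC; simpl; ring. }
    rewrite IS. unfold Rdiv.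
    replace (Im (F (ray x (y + t)) - F z)) with (Im (F (ray x (y + t))) - Im (F z))%R by reflexivity.
    fold z. ring.
Qed.

(** The term with [f] is absorbed by [2 |u'| ^ 2] and a multiple of [|u| ^ 2]. *)
Lemma Re_conj_bound (u v f : C) (M : R) : (Cmod f <= M)%R ->
  (- (M * M / 2) * Cmod u ^ 2 <= 2 * Cmod v ^ 2 + 2 * Re (Cconj u * (f * v)))%R.
Proof.
  intros Hf. pose proof (re_le_Cmod (Cconj u * (f * v))) as R1.
  rewrite !Cmod_mult, Cmod_conj in R1. apply Rabs_le_between in R1.
  pose proof (Cmod_ge_0 u); pose proof (Cmod_ge_0 v); pose proof (Cmod_ge_0 f).
  assert (Cmod u * (Cmod f * Cmod v) <= Cmod u * (M * Cmod v))%R.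
  { apply Rmult_le_compat_l; auto. now apply Rmult_le_compat_r. }
  assert (0 <= (2 * Cmod v - M * Cmod u) ^ 2)%R by apply pow2_ge_0.
  nra.
Qed.

(** If the coefficient [g] tended to infinity within the right half plane along a
    vertical ray, [|u| ^ 2] would outgrow every exponential for a suitable
    combination [u] of [U] and its translate. *)
Lemma no_blowup lam sg h U N G : branch lam sg h U -> local_coeffs U N G ->
  forall (x M Y0 : R), (- PI <= x <= PI / 3)%R ->
  (forall y, (Y0 <= y)%R -> N (ray x y) <> 0 /\ ccos (ray x y) <> 0 /\ (Cmod (fval N (ray x y)) <= M)%R) ->
  (forall L, exists Y, forall y, (Y <= y)%R -> (L <= Re (gval N G (ray x y)))%R) -> False.
Proof.
  intros B LC x M Y0 Hx Reg Blow. pose proof PI2_1.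
  destruct (branch_egrow _ _ _ _ B) as [K [k [Y1 [HK [Hk Gr]]]]].
  (* [|u| ^ 2] has order [2 k], and [convex_growth] asks for one more. *)
  set (L := (2 * k + 1)%R).
  destruct (Blow ((L * L + M * M / 2) / 2)%R) as [Y2 HY2].
  set (a := Rmax (Rmax Y0 Y1) (Rmax Y2 1)).
  assert (a0 : (Y0 <= a)%R) by (eapply Rle_trans; [apply Rmax_l|apply Rmax_l]).
  assert (a1 : (Y1 <= a)%R) by (eapply Rle_trans; [apply Rmax_r|apply Rmax_l]).
  assert (a2 : (Y2 <= a)%R) by (eapply Rle_trans; [apply Rmax_l|apply Rmax_r]).
  assert (a3 : (1 <= a)%R) by (eapply Rle_trans; [apply Rmax_r|apply Rmax_r]).
  assert (S0 : forall y, (a <= y)%R -> slit_strip (ray x y) /\ slit_strip (ray x y + tau) /\ vstrip (- PI) PI (ray x y)).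
  { intros y Hy. unfold slit_strip, strip, vstrip. rewrite Re_add_R, Im_add_R. unfold ray, Re, Im; simpl.
    repeat split; try lra; intros [X X']; lra. }
  assert (OD : forall y, (a <= y)%R -> wronskian U (ray x y) <> 0 /\
     C_derive (C_derive U) (ray x y) + fval N (ray x y) * C_derive U (ray x y) + gval N G (ray x y) * U (ray x y) = 0 /\
     C_derive (C_derive U) (ray x y + tau) + fval N (ray x y) * C_derive U (ray x y + tau) + gval N G (ray x y) * U (ray x y + tau) = 0).
  { intros y Hy. destruct (S0 y Hy) as [S1 [S2 S3]]. destruct (Reg y ltac:(lra)) as [R1 [R2 _]].
    destruct LC as [_ [_ LL]]. apply ode_local; auto; now apply (br_an _ _ _ _ B). }
  set (z0 := ray x a). destruct (OD a ltac:(lra)) as [W0 _]. fold z0 in W0.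
  (* [u = 1] and [du / dy = i u' = 1] at the start, so [|u| ^ 2] increases there. *)
  set (al := (C_derive U (z0 + tau) + Ci * U (z0 + tau)) / wronskian U z0).
  set (be := (- Ci * U z0 - C_derive U z0) / wronskian U z0).
  set (u := fun z => al * U z + be * U (z + tau)).
  set (u1 := fun z => al * C_derive U z + be * C_derive U (z + tau)).
  set (u2 := fun z => al * C_derive (C_derive U) z + be * C_derive (C_derive U) (z + tau)).
  assert (I0 : u z0 = 1) by (unfold u, al, be, wronskian, wron in *; field; auto).
  assert (I1 : u1 z0 = - Ci) by (unfold u1, al, be, wronskian, wron in *; field; auto).
  assert (Lin : forall (f : C -> C) z, analytic_at f z -> analytic_at f (z + tau) ->
     analytic_at (fun z => al * f z + be * f (z + tau)) z /\
     C_derive (fun z => al * f z + be * f (z + tau)) z = al * C_derive f z + be * C_derive f (z + tau)).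
  { intros f z A A'. split; [an|]. D_expand. ring. }
  assert (Au : forall y, (a <= y)%R -> analytic_at u (ray x y) /\ analytic_at u1 (ray x y) /\
     C_derive u (ray x y) = u1 (ray x y) /\ C_derive u1 (ray x y) = u2 (ray x y)).
  { intros y Hy. destruct (S0 y Hy) as [S1 [S2 _]].
    pose proof (br_an _ _ _ _ B _ S1) as A1. pose proof (br_an _ _ _ _ B _ S2) as A2.
    destruct (Lin U _ A1 A2) as [L1 L2]. destruct (Lin (C_derive U) _ (an_D _ _ A1) (an_D _ _ A2)) as [L3 L4].
    repeat split; auto. }
  set (p := fun y => Re (u (ray x y))). set (q := fun y => Im (u (ray x y))).
  set (p1 := fun y => (- Im (u1 (ray x y)))%R). set (q1 := fun y => Re (u1 (ray x y))).
  assert (ReI : forall w, Re (Ci * w) = (- Im w)%R) by (intros w; destruct w; unfold Re, Im, Ci; simpl; ring).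
  assert (ImI : forall w, Im (Ci * w) = Re w) by (intros w; destruct w; unfold Re, Im, Ci; simpl; ring).
  assert (dp : forall y, (a <= y)%R -> derivable_pt_lim p y (p1 y) /\ derivable_pt_lim q y (q1 y)).
  { intros y Hy. destruct (Au y Hy) as [A1 [_ [E _]]]. destruct (derivable_on_ray u x y A1) as [D1 D2].
    rewrite E, ReI in D1. rewrite E, ImI in D2. split; auto. }
  assert (dp1 : forall y, (a <= y)%R -> derivable_pt_lim p1 y (- Re (u2 (ray x y)))%R /\
     derivable_pt_lim q1 y (- Im (u2 (ray x y)))%R).
  { intros y Hy. destruct (Au y Hy) as [_ [A1 [_ E]]]. destruct (derivable_on_ray u1 x y A1) as [D1 D2].
    rewrite E, ReI in D1. rewrite E, ImI in D2. split; auto. now apply (derivable_pt_lim_opp (fun t => Im (u1 (ray x t)))). }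
  apply (convex_growth (fun y => p y * p y + q y * q y)%R
    (fun y => (p1 y * p y + p y * p1 y) + (q1 y * q y + q y * q1 y))%R
    (fun y => ((- Re (u2 (ray x y)) * p y + p1 y * p1 y) + (p1 y * p1 y + p y * - Re (u2 (ray x y))))
       + ((- Im (u2 (ray x y)) * q y + q1 y * q1 y) + (q1 y * q1 y + q y * - Im (u2 (ray x y)))))%R
    a (2 * k) ((K * (Cmod al + Cmod be)) ^ 2)).
  - lra.
  - intros y Hy. destruct (dp y Hy) as [D1 D2].
    apply (derivable_pt_lim_plus (fun y => p y * p y)%R (fun y => q y * q y)%R).
    + apply (derivable_pt_lim_mult p p); auto.
    + apply (derivable_pt_lim_mult q q); auto.
  - intros y Hy. destruct (dp y Hy) as [D1 D2]. destruct (dp1 y Hy) as [D3 D4].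
    apply (derivable_pt_lim_plus (fun y => p1 y * p y + p y * p1 y)%R (fun y => q1 y * q y + q y * q1 y)%R).
    + apply (derivable_pt_lim_plus (fun y => p1 y * p y)%R (fun y => p y * p1 y)%R).
      * apply (derivable_pt_lim_mult p1 p); auto.
      * apply (derivable_pt_lim_mult p p1); auto.
    + apply (derivable_pt_lim_plus (fun y => q1 y * q y)%R (fun y => q y * q1 y)%R).
      * apply (derivable_pt_lim_mult q1 q); auto.
      * apply (derivable_pt_lim_mult q q1); auto.
  - intros y Hy. fold L. destruct (Reg y ltac:(lra)) as [_ [_ Fb]]. specialize (HY2 y ltac:(lra)).
    destruct (OD y Hy) as [_ [O1 O2]].
    set (f := fval N (ray x y)) in *. set (g := gval N G (ray x y)) in *.
    assert (OU : u2 (ray x y) = - (f * u1 (ray x y)) - g * u (ray x y)).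
    { unfold u, u1, u2.
      replace (C_derive (C_derive U) (ray x y)) with (- (f * C_derive U (ray x y)) - g * U (ray x y)).
      2:{ replace (- (f * C_derive U (ray x y)) - g * U (ray x y)) with (C_derive (C_derive U) (ray x y) -
           (C_derive (C_derive U) (ray x y) + f * C_derive U (ray x y) + g * U (ray x y))) by ring. rewrite O1. ring. }
      replace (C_derive (C_derive U) (ray x y + tau)) with (- (f * C_derive U (ray x y + tau)) - g * U (ray x y + tau)).
      2:{ replace (- (f * C_derive U (ray x y + tau)) - g * U (ray x y + tau)) with (C_derive (C_derive U) (ray x y + tau) -
           (C_derive (C_derive U) (ray x y + tau) + f * C_derive U (ray x y + tau) + g * U (ray x y + tau))) by ring. rewrite O2. ring. }
      ring. }
    unfold p, q, p1, q1. rewrite OU.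
    pose proof (Re_conj_bound (u (ray x y)) (u1 (ray x y)) f M Fb) as RB.
    rewrite !Cmod2_alt in RB.
    destruct (u (ray x y)) as [s1 s2], (u1 (ray x y)) as [t1 t2], f as [f1 f2], g as [g1 g2].
    unfold Re, Im, Cconj, Cmult, Cminus, Cplus, Copp in *; cbn [fst snd] in *.
    assert (Hg : ((L * L + M * M / 2) * (s1 * s1 + s2 * s2) <= 2 * g1 * (s1 * s1 + s2 * s2))%R).
    { apply Rmult_le_compat_r; [|lra]. pose proof (Rle_0_sqr s1); pose proof (Rle_0_sqr s2); unfold Rsqr in *; lra. }
    lra.
  - pose proof (Rle_0_sqr (p a)); pose proof (Rle_0_sqr (q a)); unfold Rsqr in *; lra.
  - unfold p, q, p1, q1. fold z0. rewrite I0, I1. unfold Re, Im, Ci; simpl. lra.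
  - intros y Hy. destruct (S0 y Hy) as [S1 [S2 _]].
    assert (Bu : (Cmod (u (ray x y)) <= K * (Cmod al + Cmod be) * exp (k * y))%R).
    { pose proof (Gr _ S1) as G1. pose proof (Gr _ S2) as G2. rewrite Im_add_R in G2.
      replace (Im (ray x y)) with y in G1, G2 by reflexivity. rewrite Rabs_pos_eq in G1, G2 by lra.
      specialize (G1 ltac:(lra)). specialize (G2 ltac:(lra)).
      unfold u. eapply Rle_trans; [apply Cmod_triangle|]. rewrite !Cmod_mult.
      pose proof (Cmod_ge_0 al); pose proof (Cmod_ge_0 be).
      apply Rle_trans with (Cmod al * (K * exp (k * y)) + Cmod be * (K * exp (k * y)))%R; [|apply Req_le; ring].
      apply Rplus_le_compat; apply Rmult_le_compat_l; auto. }
    replace (p y * p y + q y * q y)%R with (Cmod (u (ray x y)) ^ 2)%R by (rewrite Cmod2_alt; unfold p, q; ring).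
    replace (exp (2 * k * y)) with (exp (k * y) ^ 2)%R.
    2:{ simpl. rewrite Rmult_1_r, <- exp_plus. f_equal. ring. }
    rewrite <- Rpow_mult_distr. apply pow_incr. split; [apply Cmod_ge_0|auto].
Qed.

(** * The coefficients as rational functions *)

Lemma poly_strip (P : C -> C) : is_poly P -> (exists v, P v <> 0) ->
  exists (k : nat) (P1 : C -> C), is_poly P1 /\ P1 0 <> 0 /\ forall v, P v = v ^ k * P1 v.
Proof.
  intros [p Hp]. revert P Hp. induction p as [|a p IH]; intros P Hp [v Hv].
  - exfalso. apply Hv. rewrite Hp. reflexivity.
  - destruct (Ceq_dec a 0) as [->|Na].
    + destruct (IH (peval p)) as [k [P1 [H1 [H2 H3]]]]; auto.
      { exists v. intros E. apply Hv. rewrite Hp. change (0 + v * peval p v = 0). rewrite E. ring. }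
      exists (S k), P1. repeat split; auto. intros w. rewrite Hp. simpl. fold (peval p w). rewrite H3. ring.
    + exists O, P. repeat split; [now exists (a :: p)| |intros; simpl; ring].
      intros E. apply Na. rewrite Hp in E. transitivity (a + 0 * peval p 0); [ring|exact E].
Qed.

Lemma near_top (P : C -> Prop) : near 0 P -> exists Y, forall z, (Y <= Im z)%R -> P (expi z).
Proof.
  intros [r [Hr H]]. exists (1 - ln r)%R. intros z Hz. apply H.
  replace (expi z - 0) with (expi z) by ring. rewrite Cmod_expi.
  rewrite <- (exp_ln r Hr). apply exp_increasing. lra.
Qed.

Lemma quotient_top (F D : C -> C) : is_poly F -> is_poly D -> D 0 <> 0 ->
  exists M Y, forall z, (Y <= Im z)%R -> D (expi z) <> 0 /\ (Cmod (F (expi z) / D (expi z)) <= M)%R.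
Proof.
  intros HF HD D0.
  assert (A : analytic_at (fun v => F v / D v) 0) by (apply an_div; auto; now apply an_poly).
  destruct (near_top (fun v => D v <> 0 /\ (Cmod (F v / D v - F 0 / D 0) < 1)%R)) as [Y HY].
  { apply near_and; [apply an_ne0; auto; now apply an_poly|]. apply (an_cont _ _ 1 A). lra. }
  exists (Cmod (F 0 / D 0) + 1)%R, Y. intros z Hz. destruct (HY z Hz) as [H1 H2]. split; auto.
  pose proof (Cmod_sub_le (F (expi z) / D (expi z)) (F 0 / D 0)). lra.
Qed.

Lemma D_expi_pow (m : nat) (z : C) : C_derive (fun w => expi w ^ m) z = RtoC (INR m) * Ci * expi z ^ m.
Proof.
  induction m as [|m IH].
  - simpl. rewrite D_const. ring.
  - change (fun w => expi w ^ S m) with (fun w => expi w * expi w ^ m).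
    D_expand. rewrite IH, D_expi, S_INR, RtoC_plus. simpl. ring.
Qed.

Lemma log_derivative (N P1 : C -> C) (m k : nat) : entire N -> is_poly P1 ->
  (forall z, expi z ^ m * N z = expi z ^ k * P1 (expi z)) ->
  forall z, N z <> 0 -> P1 (expi z) <> 0 ->
  C_derive N z / N z = Ci * (RtoC (INR k - INR m) + expi z * C_derive P1 (expi z) / P1 (expi z)).
Proof.
  intros EN HP E z N0 P0.
  pose proof (an_poly_expi P1 z HP) as Ap.
  assert (X : C_derive (fun w => expi w ^ m * N w) z = C_derive (fun w => expi w ^ k * P1 (expi w)) z).
  { apply D_ext; [apply near_true; intros w; now rewrite E|]. pose proof (EN z). an. }
  pose proof (EN z) as AN. revert X. D_expand. rewrite D_poly_expi, !D_expi_pow by auto. intros X.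
  set (r := expi z) in *. set (a := r ^ m) in *. set (b := r ^ k) in *.
  assert (Na : a <> 0) by apply Cpow_nz, expi_neq0.
  assert (Ez : a * N z = b * P1 r) by apply E.
  assert (Y : a * C_derive N z = Ci * (RtoC (INR k) - RtoC (INR m)) * (a * N z) + b * (C_derive P1 r * (Ci * r))).
  { replace (a * C_derive N z) with ((RtoC (INR m) * Ci * a * N z + a * C_derive N z) - RtoC (INR m) * Ci * (a * N z)) by ring.
    rewrite X, Ez. ring. }
  apply (Cmult_reg_l (a * N z)); [now apply Cmult_neq_0|].
  replace (a * N z * (C_derive N z / N z)) with (a * C_derive N z) by (field; auto).
  rewrite Y, RtoC_minus.
  replace (a * N z * (Ci * (INR k - INR m + r * C_derive P1 r / P1 r)))
    with (Ci * (INR k - INR m) * (a * N z) + (a * N z) * (Ci * (r * C_derive P1 r / P1 r))) by ring.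
  rewrite Ez at 3. f_equal. field. auto.
Qed.

(** If [g] behaved like [c e ^ (- i M z)] at the upper end, with [M > 0], its real
    part would tend to infinity on the ray [Re z = x / M] for a direction [x] that
    makes an acute angle with [c]. *)
Lemma no_pole_at_top lam sg h U N G (D F1 Q1 : C -> C) (M : nat) :
  branch lam sg h U -> local_coeffs U N G ->
  is_poly D -> is_poly F1 -> is_poly Q1 -> D 0 <> 0 -> Q1 0 <> 0 -> (1 <= M)%nat ->
  (forall z, D (expi z) <> 0 -> N z <> 0 /\ ccos z <> 0 /\ F1 (expi z) / D (expi z) = fval N z /\
     expi z ^ M * gval N G z = Q1 (expi z) / D (expi z)) -> False.
Proof.
  intros B LC HD HF HQ1 D0 Q10 HM Reg.
  assert (M1 : (1 <= INR M)%R) by (apply (le_INR 1); auto).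
  set (c := Q1 0 / D 0).
  assert (c0 : c <> 0).
  { unfold c. intros E. apply Q10. replace (Q1 0) with (D 0 * (Q1 0 / D 0)) by (field; auto). rewrite E; ring. }
  destruct (acute_direction c c0) as [x [Hx Hpos]]. pose proof PI_RGT_0 as PI0.
  set (x0 := (x / INR M)%R).
  assert (x0b : (- PI <= x0 <= PI / 3)%R).
  { assert (Ex : x = (x0 * INR M)%R) by (unfold x0; field; lra).
    destruct Hx as [H|[H|H]]; split; apply Rnot_lt_le; intros Hlt; nra. }
  destruct (quotient_top F1 D HF HD D0) as [Mf [Y0 HY0]].
  apply (no_blowup lam sg h U N G B LC x0 Mf Y0 x0b).
  - intros y Hy. destruct (HY0 (ray x0 y) Hy) as [R1 R2].
    destruct (Reg _ R1) as [n0 [c1 [FV _]]]. repeat split; auto. now rewrite <- FV.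
  - intros L. set (H := fun v => cis (- x) * (Q1 v / D v)).
    assert (AH : analytic_at H 0).
    { apply (an_mul (fun _ => cis (- x)) (fun v => Q1 v / D v)); [apply an_const|].
      apply an_div; auto; now apply an_poly. }
    assert (H0 : (0 < Re (H 0))%R) by (unfold H; fold c; now rewrite Cmult_comm).
    set (d := (Re (H 0) / 2)%R). assert (Hd : (0 < d)%R) by (unfold d; lra).
    destruct (near_top _ (an_cont H 0 d AH Hd)) as [Y1 HY1].
    exists (Rmax (Rmax Y0 Y1) (Rmax 0 (L / d))). intros y Hy.
    assert (y0 : (Y0 <= y)%R) by (eapply Rle_trans; [|exact Hy]; eapply Rle_trans; [apply Rmax_l|apply Rmax_l]).
    assert (y1 : (Y1 <= y)%R) by (eapply Rle_trans; [|exact Hy]; eapply Rle_trans; [apply Rmax_r|apply Rmax_l]).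
    assert (y2 : (0 <= y)%R) by (eapply Rle_trans; [|exact Hy]; eapply Rle_trans; [apply Rmax_l|apply Rmax_r]).
    assert (y3 : (L / d <= y)%R) by (eapply Rle_trans; [|exact Hy]; eapply Rle_trans; [apply Rmax_r|apply Rmax_r]).
    destruct (HY0 (ray x0 y) y0) as [R1 _]. specialize (HY1 (ray x0 y) y1). cbn beta in HY1.
    assert (Rh : (d <= Re (H (expi (ray x0 y))))%R).
    { pose proof (re_le_Cmod (H (expi (ray x0 y)) - H 0)) as Q2.
      assert (Q3 : (Rabs (Re (H (expi (ray x0 y))) - Re (H 0)) < d)%R) by (eapply Rle_lt_trans; [exact Q2|exact HY1]).
      apply Rabs_def2 in Q3. unfold d in *. lra. }
    assert (Rr : expi (ray x0 y) = cis x0 * RtoC (exp (- y))).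
    { unfold expi, cexp, ray, cis. unfold Ci, Cmult, RtoC, Re, Im; simpl.
      replace (0 * x0 - 1 * y)%R with (- y)%R by ring. replace (0 * y + 1 * x0)%R with x0 by ring. f_equal; ring. }
    assert (RM : expi (ray x0 y) ^ M = cis x * RtoC (exp (- y) ^ M)).
    { rewrite Rr, Cpow_mult_l, cis_pow, RtoC_pow. do 2 f_equal. unfold x0. field. lra. }
    assert (Gv : gval N G (ray x0 y) = RtoC (/ exp (- y) ^ M) * H (expi (ray x0 y))).
    { unfold H. rewrite <- (proj2 (proj2 (proj2 (Reg _ R1)))). rewrite RM.
      replace (RtoC (/ exp (- y) ^ M) * (cis (- x) * (cis x * RtoC (exp (- y) ^ M) * gval N G (ray x0 y))))
        with ((RtoC (/ exp (- y) ^ M) * RtoC (exp (- y) ^ M)) * (cis (- x) * cis x) * gval N G (ray x0 y)) by ring.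
      rewrite <- cis_add, <- RtoC_mult. replace (- x + x)%R with 0%R by ring.
      rewrite cis_0, Rinv_l by (apply pow_nonzero, Rgt_not_eq, exp_pos). ring. }
    rewrite Gv, Re_scal.
    assert (Ex : (y <= / exp (- y) ^ M)%R).
    { rewrite <- pow_inv, exp_Ropp, Rinv_inv. pose proof (exp_ineq1_le y).
      apply Rle_trans with (exp y ^ 1)%R; [simpl; lra|]. apply Rle_pow; auto. lra. }
    assert (L <= y * d)%R.
    { apply Rmult_le_compat_r with (r := d) in y3; [|lra].
      replace (L / d * d)%R with L in y3 by (field; lra). auto. }
    apply Rle_trans with (y * Re (H (expi (ray x0 y))))%R; [nra|]. apply Rmult_le_compat_r; lra.
Qed.

(** A denominator with [D 0 <> 0] makes both quotients bounded at the upper end.  For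
    [f] it comes from the logarithmic derivative; for [g] the powers of [expi] must
    cancel, which is [no_pole_at_top]. *)
Lemma rational_form lam sg h U N G (m m' : nat) (P Q : C -> C) : branch lam sg h U ->
  local_coeffs U N G -> is_poly P -> is_poly Q ->
  (forall z, expi z ^ m * N z = P (expi z)) -> (forall z, expi z ^ m' * G z = Q (expi z)) ->
  (exists z, N z <> 0) ->
  exists D F1 G1, is_poly D /\ is_poly F1 /\ is_poly G1 /\ D 0 <> 0 /\
    forall z, (D (expi z) <> 0 <-> N z <> 0 /\ ccos z <> 0) /\
      (D (expi z) <> 0 -> F1 (expi z) / D (expi z) = fval N z /\ G1 (expi z) / D (expi z) = gval N G z).
Proof.
  intros B LC HP HQ EP EQ [zN HN].
  destruct (poly_strip P HP) as [k [P1 [HP1 [P10 SP]]]].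
  { exists (expi zN). rewrite <- EP. apply Cmult_neq_0; auto. apply Cpow_nz, expi_neq0. }
  assert (EP1 : forall z, expi z ^ m * N z = expi z ^ k * P1 (expi z)) by (intros z; now rewrite EP, SP).
  destruct LC as [EN [EG LL]].
  set (D := fun v => 2 * (v ^ 2 + 1) * P1 v).
  set (F1 := fun v => - Ci * ((RtoC (INR k - INR m) * P1 v + v * C_derive P1 v) * (v ^ 2 + 1) - (v ^ 2 - 1) * P1 v)).
  assert (X2 : is_poly (fun v => v ^ 2 + 1)) by (apply poly_add; [apply poly_pow|apply poly_const]).
  assert (HD : is_poly D).
  { apply (poly_mul (fun v => 2 * (v ^ 2 + 1)) P1); auto. now apply (poly_scal 2 (fun v => v ^ 2 + 1)). }
  assert (HF : is_poly F1).
  { apply (poly_scal (- Ci) (fun v => (RtoC (INR k - INR m) * P1 v + v * C_derive P1 v) * (v ^ 2 + 1) - (v ^ 2 - 1) * P1 v)).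
    apply (poly_sub (fun v => (RtoC (INR k - INR m) * P1 v + v * C_derive P1 v) * (v ^ 2 + 1)) (fun v => (v ^ 2 - 1) * P1 v)).
    - apply (poly_mul (fun v => RtoC (INR k - INR m) * P1 v + v * C_derive P1 v)); auto.
      apply (poly_add (fun v => RtoC (INR k - INR m) * P1 v)); [now apply poly_scal|now apply poly_X, poly_D].
    - apply (poly_mul (fun v => v ^ 2 - 1)); auto. apply poly_sub; [apply poly_pow|apply poly_const]. }
  assert (D0 : D 0 <> 0).
  { unfold D. replace (2 * (0 ^ 2 + 1) * P1 0) with (2 * P1 0) by (simpl; ring). apply Cmult_neq_0; auto using two_neq0. }
  assert (Reg : forall z, D (expi z) <> 0 <-> N z <> 0 /\ ccos z <> 0).
  { intros z. pose proof (expi_neq0 z) as R0. pose proof (Cpow_nz _ m R0) as Rm. pose proof (Cpow_nz _ k R0) as Rk.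
    unfold D. rewrite <- ccos_expi. split.
    - intros H. split; intros E.
      + pose proof (EP1 z) as X. rewrite E in X. replace (expi z ^ m * 0) with (RtoC 0) in X by ring.
        destruct (Cmult_eq_0 (expi z ^ k) (P1 (expi z))) as [X1|X1]; [now symmetry|now apply Rk|].
        apply H. rewrite X1. ring.
      + apply H. rewrite E. ring.
    - intros [H1 H2]. pose proof two_neq0.
      apply Cmult_neq_0; [apply Cmult_neq_0; auto; apply Cmult_neq_0; auto; now apply Cmult_neq_0|].
      intros E. pose proof (EP1 z) as X. rewrite E in X. replace (expi z ^ k * 0) with (RtoC 0) in X by ring.
      revert X. now apply Cmult_neq_0. }
  assert (P1ne : forall z, D (expi z) <> 0 -> P1 (expi z) <> 0 /\ expi z ^ 2 + 1 <> 0).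
  { intros z H. unfold D in H. split; intros E; apply H; rewrite E; ring. }
  assert (FV : forall z, D (expi z) <> 0 -> F1 (expi z) / D (expi z) = fval N z).
  { intros z Hz. destruct (P1ne z Hz) as [p1 p2]. destruct (proj1 (Reg z) Hz) as [n0 c0].
    unfold fval. rewrite (log_derivative N P1 m k EN HP1 EP1 z n0 p1).
    assert (Tn : C_derive ccos z / ccos z = Ci * ((expi z ^ 2 - 1) / (expi z ^ 2 + 1))).
    { apply (Cmult_reg_l (2 * expi z * ccos z)).
      - apply Cmult_neq_0; auto. apply Cmult_neq_0; auto using two_neq0, expi_neq0.
      - rewrite ccos_expi at 2. rewrite D_ccos. pose proof (expi_neq0 z). pose proof two_neq0. field. auto. }
    rewrite Tn. unfold F1, D. pose proof two_neq0. field. auto. }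
  assert (GV : forall z, D (expi z) <> 0 -> expi z ^ (k + m') * (gval N G z * D (expi z)) = expi z ^ (S m) * Q (expi z)).
  { intros z Hz. destruct (proj1 (Reg z) Hz) as [n0 c0]. rewrite <- EQ, Cpow_add_r, Cpow_S.
    unfold gval, D. rewrite <- ccos_expi.
    replace (expi z ^ k * expi z ^ m' * (G z / (4 * ccos z * N z) * (2 * (2 * expi z * ccos z) * P1 (expi z))))
      with (expi z ^ m' * (expi z * G z / N z) * (expi z ^ k * P1 (expi z))).
    - rewrite <- EP1. field. auto.
    - pose proof (RtoC_neq0 4 ltac:(lra)). field. repeat split; auto. }
  destruct (classic (exists v, Q v <> 0)) as [QN|QZ].
  - destruct (poly_strip Q HQ QN) as [l [Q1 [HQ1 [Q10 SQ]]]].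
    destruct (le_lt_dec (k + m') (S m + l)) as [Le|Gt].
    +
      (* The net power of [expi] in [g] is [e]. *)
      set (e := (S m + l - (k + m'))%nat). set (G1 := fun v => v ^ e * Q1 v).
      exists D, F1, G1. split; [exact HD|split; [exact HF|split; [|split; [exact D0|]]]].
      { apply (poly_mul (fun v => v ^ e)); auto. apply poly_pow. }
      intros z. split; [apply Reg|]. intros Hz. split; [now apply FV|].
      pose proof (GV z Hz) as X. rewrite SQ in X.
      replace (expi z ^ S m * (expi z ^ l * Q1 (expi z))) with (expi z ^ (k + m') * G1 (expi z)) in X.
      2:{ unfold G1. rewrite !Cmult_assoc, <- !Cpow_add_r. do 2 f_equal. unfold e. lia. }
      apply Cmult_reg_l in X; [|apply Cpow_nz, expi_neq0]. rewrite <- X. field. auto.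
    + exfalso. set (M := (k + m' - (S m + l))%nat).
      assert (HM : (1 <= M)%nat) by (unfold M; lia).
      assert (GM : forall z, D (expi z) <> 0 -> expi z ^ M * gval N G z = Q1 (expi z) / D (expi z)).
      { intros z Hz. pose proof (GV z Hz) as X. rewrite SQ in X.
        replace (k + m')%nat with ((S m + l) + M)%nat in X by (unfold M; lia).
        rewrite (Cpow_add_r _ (S m + l)), (Cpow_add_r _ (S m)) in X.
        apply (Cmult_reg_l (expi z ^ S m * expi z ^ l)); [apply Cmult_neq_0; apply Cpow_nz, expi_neq0|].
        apply (Cmult_reg_l (D (expi z))); auto.
        replace (D (expi z) * (expi z ^ S m * expi z ^ l * (expi z ^ M * gval N G z)))
          with (expi z ^ S m * expi z ^ l * expi z ^ M * (gval N G z * D (expi z))) by ring.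
        rewrite X. field. auto. }
      apply (no_pole_at_top lam sg h U N G D F1 Q1 M); auto; [split; auto|].
      intros z Hz. destruct (proj1 (Reg z) Hz). auto.
  - assert (GZ : forall z, G z = 0).
    { intros z. destruct (Cmult_eq_0 (expi z ^ m') (G z)) as [E|E]; auto.
      - rewrite EQ. apply NNPP. intros X. apply QZ; eauto.
      - exfalso. revert E. apply Cpow_nz, expi_neq0. }
    exists D, F1, (fun _ => 0).
    split; [exact HD|split; [exact HF|split; [apply poly_const|split; [exact D0|]]]].
    intros z. split; [apply Reg|]. intros Hz. split; [now apply FV|].
    destruct (proj1 (Reg z) Hz) as [n0 c0]. unfold gval. rewrite GZ.
    pose proof (RtoC_neq0 4 ltac:(lra)). field. auto.
Qed.

(** * Continuation of the equation along paths *)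

Definition ode_cleared (f g : ratfun) (F : C -> C) (z : C) : C :=
  peval (Defs.den f) (expi z) * peval (Defs.den g) (expi z) * C_derive (C_derive F) z
  + peval (Defs.num f) (expi z) * peval (Defs.den g) (expi z) * C_derive F z
  + peval (Defs.num g) (expi z) * peval (Defs.den f) (expi z) * F z.

Lemma an_ode_cleared (f g : ratfun) (F : C -> C) (z : C) :
  analytic_at F z -> analytic_at (ode_cleared f g F) z.
Proof.
  intros A. assert (Ap : forall p, analytic_at (fun w => peval p (expi w)) z).
  { intros p. apply (an_poly_expi (peval p)). now exists p. }
  pose proof (Ap (Defs.den f)). pose proof (Ap (Defs.den g)). pose proof (Ap (Defs.num f)). pose proof (Ap (Defs.num g)).
  unfold ode_cleared. an.
Qed.

Lemma ode_cleared_ext (f g : ratfun) (F1 F2 : C -> C) (z : C) :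
  analytic_at F2 z -> near z (fun w => F1 w = F2 w) ->
  near z (fun w => ode_cleared f g F1 w = ode_cleared f g F2 w).
Proof.
  intros A E.
  assert (E1 : near z (fun w => C_derive F1 w = C_derive F2 w)).
  { eapply near_imp; [|apply (near_and _ _ _ (an_near _ _ A) (near_near _ _ E))].
    intros w [Aw Ew]. apply D_ext; auto. eapply near_imp; [|exact Ew]. auto. }
  assert (E2 : near z (fun w => C_derive (C_derive F1) w = C_derive (C_derive F2) w)).
  { eapply near_imp; [|apply (near_and _ _ _ (an_near _ _ (an_D _ _ A)) (near_near _ _ E1))].
    intros w [Aw Ew]. apply D_ext; auto. eapply near_imp; [|exact Ew]. auto. }
  eapply near_imp; [|apply (near_and _ _ _ E (near_and _ _ _ E1 E2))].
  intros w [X [X1 X2]]. unfold ode_cleared. now rewrite X, X1, X2.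
Qed.

(** With denominators cleared the equation is an identity between analytic
    germs, so it follows every continuation. *)
Lemma solves_ode_from_pi (f g : ratfun) (T : C -> C) :
  analytic_at T (RtoC PI) -> near (RtoC PI) (fun z => ode_cleared f g T z = 0) -> solves_ode f g T.
Proof.
  intros AT Z gamma F [G0 [Cg [F0 [AF Co]]]] t Ht b Rf Rg.
  assert (N : near (gamma t) (fun z => ode_cleared f g (F t) z = 0)).
  { apply (identity_along gamma (fun t => ode_cleared f g (F t))); auto.
    - intros s Hs eps He. specialize (Cg s Hs).
      apply (filterlim_locally_ball_norm (U := C_NormedModule)) with (eps := mkposreal eps He) in Cg.
      destruct Cg as [d Hd]. exists d. split; [apply cond_pos|]. intros s' _ Hs'.
      exact (Hd s' Hs').
    - intros s Hs. apply an_ode_cleared. now apply AF.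
    - intros s Hs. destruct (Co s Hs) as [eps [He Hc]].
      specialize (AF s Hs). apply an_near in AF. destruct AF as [r [Hr An]].
      specialize (Cg s Hs).
      apply (filterlim_locally_ball_norm (U := C_NormedModule)) with (eps := mkposreal r Hr) in Cg.
      destruct Cg as [d Hd]. exists (Rmin eps d). split; [apply Rmin_glb_lt; [auto|apply cond_pos]|].
      intros s' Hs' Hss. apply ode_cleared_ext.
      + apply An. exact (Hd s' (lt_Rmin_r _ _ _ Hss)).
      + apply near_locally. apply Hc; auto. exact (lt_Rmin_l _ _ _ Hss).
    - rewrite G0. apply near_locally in F0.
      eapply near_imp; [|apply (near_and _ _ _ Z (ode_cleared_ext f g (F 0%R) T _ AT F0))].
      intros w [E1 E2]. now rewrite E2. }
  apply near_self in N. unfold ode_cleared in N. fold b in N.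
  unfold regular_at in Rf, Rg. fold (expi b) in Rf, Rg. unfold value_at. fold (expi b).
  apply (Cmult_reg_l (peval (Defs.den f) (expi b) * peval (Defs.den g) (expi b))); [now apply Cmult_neq_0|].
  rewrite Cmult_0_r, <- N. field. auto.
Qed.

Lemma fval_opp (N : C -> C) (z : C) : entire N -> (forall z, N (- z) = N z) ->
  fval N (- z) = - fval N z.
Proof.
  intros EN NE.
  assert (X : forall f : C -> C, entire f -> (forall z, f (- z) = f z) -> C_derive f (- z) = - C_derive f z).
  { intros f Ef Ev. pose proof (D_reflect f 0 z (Ef _)) as R. replace (0 - z) with (- z) in R by ring.
    rewrite (D_ext f) in R by (try apply Ef; apply near_true; intros w; replace (0 - w) with (- w) by ring; now rewrite Ev).
    rewrite R. ring. }
  unfold fval. rewrite (X N EN NE), (X ccos an_ccos ccos_opp), NE, ccos_opp. unfold Cdiv. ring.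
Qed.

Lemma peval_nonzero_coef (d : list C) (v : C) : peval d v <> 0 -> exists c, In c d /\ c <> 0.
Proof.
  induction d as [|a d IH]; intros H; [now exfalso; apply H|].
  destruct (Ceq_dec a 0) as [->|N].
  - destruct IH as [c [H1 H2]].
    + intros E. apply H. simpl. fold (peval d v). rewrite E. ring.
    + exists c. split; auto. now right.
  - exists a. split; auto. now left.
Qed.

Lemma ramified_branch (lam : C) (T : C -> C) :
  sqrt_ramified T -> shift_equation lam T -> exp_growth T -> reflection_symmetric T ->
  exists sg h U, branch lam sg h U /\ forall b, slit_strip b -> T b = U b.
Proof.
  intros [s1 [s2 [h [[A1 Q1] [[A2 Q2] [Ah E]]]]]] Sh Gr Sy.
  set (sg := fun b => s1 b * s2 b). set (U := fun b => sg b * h b).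
  assert (Sq : forall b, slit_strip b -> sg b * sg b = ramif b).
  { intros b Hb. unfold sg. replace (s1 b * s2 b * (s1 b * s2 b)) with ((s1 b * s1 b) * (s2 b * s2 b)) by ring.
    rewrite Q1, Q2 by auto. unfold ramif, eta.
    replace (- PI / 2)%R with (- (PI / 2))%R by field. replace (5 * PI / 2)%R with (5 * (PI / 2))%R by field.
    rewrite RtoC_opp, RtoC_mult. ring. }
  assert (TU : forall b, slit_strip b -> T b = U b).
  { intros b Hb. unfold U, sg. rewrite <- E by auto.
    assert (N : s1 b * s2 b <> 0).
    { intros X. apply (ramif_neq0 b Hb). rewrite <- Sq by auto. unfold sg. rewrite X. ring. }
    assert (N1 : s1 b <> 0) by (intros X; apply N; rewrite X; ring).
    assert (N2 : s2 b <> 0) by (intros X; apply N; rewrite X; ring).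
    field. auto. }
  exists sg, h, U. split; auto. constructor; auto.
  - intros z Hz. apply an_mul; auto.
  - intros b Hb. destruct (slit_left b Hb) as [S0 [S1 S2]].
    pose proof (Sh b Hb) as X. rewrite tau2 in *. rewrite Cplus_assoc in *. rewrite <- !TU by auto. auto.
  - destruct Gr as [K [k H]]. exists K, k. intros b Hb. rewrite <- TU by auto. now apply H.
  - intros b Hb. rewrite <- TU by auto. rewrite (Sy b Hb). apply TU.
    pose proof PI_RGT_0. destruct Hb as [H1 [H2 H3]]. unfold slit_strip, strip in *.
    destruct b as [x y]. unfold Re, Im in *; simpl in *. repeat split; try lra.
Qed.

(** A rational function with even modulus is bounded at both ends if it is at the
    upper one. *)
Lemma even_modulus_bounded (q : ratfun) (M Y : R) :
  (forall b, regular_at q b -> regular_at q (- b)) ->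
  (forall b, regular_at q b -> Cmod (value_at q (- b)) = Cmod (value_at q b)) ->
  (forall b, (Y <= Im b)%R -> regular_at q b /\ (Cmod (value_at q b) <= M)%R) -> bounded_at_ends q.
Proof.
  intros Rg Ev Bd. exists M, Y. intros b Hb. destruct (Rle_dec 0 (Im b)) as [L|L].
  - rewrite Rabs_pos_eq in Hb by auto. now apply Bd.
  - rewrite Rabs_left in Hb by lra.
    destruct (Bd (- b)) as [X1 X2].
    { replace (Im (- b)) with (- Im b)%R by (destruct b; reflexivity). lra. }
    assert (R0 : regular_at q b) by (replace b with (- - b) by ring; now apply Rg).
    split; auto. now rewrite <- Ev.
Qed.

Theorem theorem3p6 :
  forall (lam : C) (T : C -> C),
    sqrt_ramified T ->
    shift_equation lam T ->
    exp_growth T ->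
    reflection_symmetric T ->
    exists f g : ratfun,
      solves_ode f g T /\
      rat_odd f /\ rat_even g /\
      bounded_at_ends f /\ bounded_at_ends g.
Proof.
  intros lam T HR HS HG HY.
  destruct (ramified_branch lam T HR HS HG HY) as [sg [h [U [B TU]]]].
  pose proof PI2_1 as PI21.
  assert (Npi : near (RtoC PI) (fun z => T z = U z)).
  { assert (R1 : (PI - 1 < Re (RtoC PI) < PI + 1)%R) by (simpl; lra).
    eapply near_imp; [|apply (near_Re _ _ _ R1)]. intros w Hw. apply TU.
    unfold slit_strip, strip. repeat split; try lra; intros [X _]; lra. }
  assert (Spi : slit_strip (RtoC PI) /\ slit_strip (RtoC PI + tau) /\ vstrip (- PI) PI (RtoC PI)).
  { unfold slit_strip, strip, vstrip. rewrite Re_add_R. simpl. repeat split; try lra; intros [X _]; lra. }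
  destruct Spi as [S0 [S1 Vpi]].
  pose proof (br_an _ _ _ _ B _ S0) as AU. pose proof (br_an _ _ _ _ B _ S1) as AU'.
  assert (AT : analytic_at T (RtoC PI)).
  { apply (an_ext U); auto. eapply near_imp; [|exact Npi]. auto. }
  destruct (coefficients _ _ _ _ B) as [N [G [m [m' [P [Q [EN [EG [NE [GE [HP [HQ [EP [EQ [LL NZ]]]]]]]]]]]]]]].
  assert (LC : local_coeffs U N G) by (split; [|split]; auto).
  destruct (classic (exists z, N z <> 0)) as [NN|NN].
  - destruct (rational_form _ _ _ _ _ _ _ _ _ _ B LC HP HQ EP EQ NN) as [D [F1 [G1 [HD [HF [HG1 [D0 RF]]]]]]].
    destruct (quotient_top F1 D HF HD D0) as [Mf [Yf Bf]].
    destruct (quotient_top G1 D HG1 HD D0) as [Mg [Yg Bg]].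
    destruct HD as [d Hd], HF as [nf Hf], HG1 as [ng Hg].
    assert (dn : exists c, In c d /\ c <> 0) by (apply (peval_nonzero_coef d 0); now rewrite <- Hd).
    set (f := Ratfun nf d dn). set (g := Ratfun ng d dn).
    assert (Rg : forall b, peval d (expi b) <> 0 -> peval d (expi (- b)) <> 0).
    { intros b Hb. rewrite <- Hd in *. apply RF. rewrite NE, ccos_opp. now apply RF. }
    assert (Vf : forall b, peval d (expi b) <> 0 -> peval nf (expi b) / peval d (expi b) = fval N b).
    { intros b Hb. rewrite <- Hd in *. rewrite <- Hf. now apply RF. }
    assert (Vg : forall b, peval d (expi b) <> 0 -> peval ng (expi b) / peval d (expi b) = gval N G b).
    { intros b Hb. rewrite <- Hd in *. rewrite <- Hg. now apply RF. }
    assert (Of : rat_odd f).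
    { intros b H1 H2. unfold regular_at, value_at in *. cbn [Defs.num Defs.den f] in *.
      fold (expi b) in *. fold (expi (- b)) in *. rewrite !Vf by auto. now apply fval_opp. }
    assert (Og : rat_even g).
    { intros b H1 H2. unfold regular_at, value_at in *. cbn [Defs.num Defs.den g] in *.
      fold (expi b) in *. fold (expi (- b)) in *. rewrite !Vg by auto.
      unfold gval. now rewrite NE, GE, ccos_opp. }
    exists f, g. split; [|split; [exact Of|split; [exact Og|split]]].
    + apply solves_ode_from_pi; auto.
      assert (ZU : near (RtoC PI) (fun z => ode_cleared f g U z = 0)).
      { assert (Ad : analytic_at (fun w => peval d (expi w)) (RtoC PI)).
        { apply (an_poly_expi (peval d)). now exists d. }
        destruct (an_mul_zero (ode_cleared f g U) (fun w => peval d (expi w)) (RtoC PI)) as [Z|Z]; auto.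
        - now apply an_ode_cleared.
        - assert (Loc : near (RtoC PI) (fun z => peval d (expi z) <> 0 ->
            C_derive (C_derive U) z + fval N z * C_derive U z + gval N G z * U z = 0)).
          { eapply near_imp; [|apply (near_and _ _ _ (an_near _ _ AU) (near_and _ _ _
              (near_shift _ _ _ (an_near _ _ AU')) (near_near _ _ (LL _ Vpi S0 S1))))].
            intros w [A1 [A2 L]] Hw. rewrite <- Hd in Hw.
            destruct (proj1 (proj1 (RF w)) Hw) as [H1 H2].
            exact (proj1 (proj2 (ode_local U N G w A1 A2 L H1 H2))). }
          eapply near_imp; [|exact Loc]. intros z Hz.
          destruct (Ceq_dec (peval d (expi z)) 0) as [E|E]; [rewrite E; ring|].
          specialize (Hz E). rewrite <- (Vf z E), <- (Vg z E) in Hz.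
          replace (ode_cleared f g U z) with (RtoC 0); [ring|].
          unfold ode_cleared. cbn [Defs.num Defs.den f g].
          replace (RtoC 0) with (peval d (expi z) * peval d (expi z) * 0) by ring. rewrite <- Hz. field. auto.
        - exfalso. apply near_imp with (Q := fun v => peval d (expi v) = 0) in Z; auto.
          destruct (Bf (ray 0 Yf) (Rle_refl _)) as [X _]. apply X. rewrite Hd.
          apply (identity_entire (fun w => peval d (expi w)) (RtoC PI)); auto.
          intros w. apply (an_poly_expi (peval d)). now exists d. }
      eapply near_imp; [|apply (near_and _ _ _ ZU (ode_cleared_ext f g T U _ AU Npi))].
      intros w [E1 E2]. now rewrite E2.
    + apply (even_modulus_bounded f Mf Yf); [exact Rg| |].
      * intros b Hb. rewrite (Of b Hb (Rg b Hb)). apply Cmod_opp.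
      * intros b Hb. destruct (Bf b Hb) as [X1 X2]. rewrite Hd in X1. rewrite Hd, Hf in X2. split; [exact X1|exact X2].
    + apply (even_modulus_bounded g Mg Yg); [exact Rg| |].
      * intros b Hb. now rewrite (Og b Hb (Rg b Hb)).
      * intros b Hb. destruct (Bg b Hb) as [X1 X2]. rewrite Hd in X1. rewrite Hd, Hg in X2. split; [exact X1|exact X2].
  (* [T = 0]: any coefficients do, and [f = g = 0] are chosen. *)
  - assert (Z : forall b, slit_strip b -> U b = 0).
    { apply NZ. intros z. apply NNPP. intros X. apply NN. eauto. }
    assert (dn : exists c, In c (RtoC 1 :: nil) /\ c <> 0).
    { exists 1. split; [now left|apply RtoC_neq0; lra]. }
    set (f := Ratfun nil (RtoC 1 :: nil) dn).
    assert (V0 : forall b, value_at f b = 0).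
    { intros b. unfold value_at; simpl. unfold Cdiv. ring. }
    assert (Bd : bounded_at_ends f).
    { exists 0%R, 0%R. intros b _. split.
      - unfold regular_at; simpl. replace (1 + cexp (Ci * b) * 0) with (RtoC 1) by ring. apply RtoC_neq0; lra.
      - rewrite V0, Cmod_0. lra. }
    exists f, f. split; [|split; [|split; [|split; exact Bd]]].
    + apply solves_ode_from_pi; auto.
      assert (TZ : near (RtoC PI) (fun z => T z = (fun _ => 0) z)).
      { assert (R1 : (PI - 1 < Re (RtoC PI) < PI + 1)%R) by (simpl; lra).
        eapply near_imp; [|apply (near_and _ _ _ Npi (near_Re _ _ _ R1))]. intros w [E Hw]. rewrite E. apply Z.
        unfold slit_strip, strip. repeat split; try lra; intros [X _]; lra. }
      eapply near_imp; [|apply (ode_cleared_ext f f T (fun _ => 0) _ (an_const 0 _) TZ)].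
      intros w E. rewrite E. unfold ode_cleared; simpl.
      replace (C_derive (fun _ => 0)) with (fun _ : C => RtoC 0)
        by (apply functional_extensionality; intros v; symmetry; apply D_const).
      rewrite D_const. ring.
    + intros b _ _. rewrite !V0. ring.
    + intros b _ _. now rewrite !V0.
Qed.
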